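(* Let the functions $\rho,I_\rho,K,EI,p_1,p_2,h_1,h_2$ satisfy: $\rho,I_\rho,K,EI\in C[0,\ell]$; $p_1,p_2\in L^1[0,\ell]$; $0<C_1\le\rho(x),I_\rho(x),K(x),EI(x)\le C_2$ on $[0,\ell]$ for some constants $C_1,C_2$; $\dfrac{EI(x)\rho(x)}{K(x)I_\rho(x)}$ is constant on $[0,\ell]$; and $h_1,h_2\in AC[0,\ell]$, where $h_1:=\sqrt{EI\cdot I_\rho}$, $h_2:=\sqrt{K\rho}$. Then the Timoshenko operator $\mathcal L$ in $\mathfrak H$ is similar to the $4\times4$ Dirac-type operator $L_{C,D}(Q)$ in $L^2([0,1];\mathbb C^4)$ with the matrices $B,C,D,Q(\cdot)$ given in the context.
   Context: Let $\ell>0$ and $\alpha_1,\alpha_2,\beta_1,\beta_2\in\mathbb C$. $EI$ denotes a single function (flexural rigidity). Let $\widetilde H^1_0[0,\ell]=\{f\in W^{1,2}[0,\ell]:f(0)=0\}$ and $\mathfrak H=\widetilde H^1_0[0,\ell]\times L^2[0,\ell]\times\widetilde H^1_0[0,\ell]\times L^2[0,\ell]$ with norm $\|y\|_{\mathfrak H}^2=\int_0^\ell(EI|y_1'|^2+I_\rho|y_2|^2+K|y_3'-y_1|^2+\rho|y_4|^2)\,dx$. The operator $\mathcal L$ in $\mathfrak H$ is $$\mathcal L\begin{pmatrix} y_1 \\ y_2 \\ y_3 \\ y_4 \end{pmatrix}=\frac1i\begin{pmatrix} y_2 \\ \frac1{I_\rho}\bigl(K(y_3'-y_1)+(EI\,y_1')'-p_1y_2\bigr)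 \\ y_4 \\ \frac1\rho\bigl((K(y_3'-y_1))'-p_2y_4\bigr) \end{pmatrix}$$ with domain consisting of all $y=\operatorname{col}(y_1,y_2,y_3,y_4)$ such that $y_1,\dots,y_4\in\widetilde H^1_0[0,\ell]$; $EI\,y_1'\in AC[0,\ell]$, $(EI\,y_1')'-p_1y_2\in L^2[0,\ell]$; $K(y_3'-y_1)\in AC[0,\ell]$, $(K(y_3'-y_1))'-p_2y_4\in L^2[0,\ell]$; $(EI\,y_1')(\ell)+\alpha_1y_2(\ell)+\beta_1y_4(\ell)=0$; $(K(y_3'-y_1))(\ell)+\alpha_2y_4(\ell)+\beta_2y_2(\ell)=0$. Define $b_1>0$ and $\gamma$ by $\sqrt{I_\rho(x)/EI(x)}=b_1\gamma(x)$ with $\int_0^\ell\gamma\,dx=1$, and $b_2>0$ by $\sqrt{\rho(x)/K(x)}=b_2\gamma(x)$ (possible since $EI\rho/(KI_\rho)$ is constant). Let $B=\operatorname{diag}(-b_1,b_1,-b_2,b_2)$, $\Theta(x)=-2i\operatorname{diag}(I_\rho(x),I_\rho(x),\rho(x),\rho(x))$, $$\widehat Q(x)=\Theta^{-1}(x)\begin{pmatrix} p_1+h_1' & p_1-h_1' & h_2 & -h_2 \\ p_1+h_1' & p_1-h_1' & h_2 & -h_2 \\ -h_2 & -h_2 & p_2+h_2' & p_2-h_2' \\ h_2 & h_2 & p_2+h_2' & p_2-h_2' \end{pmatrix}.$$ Let $t(x)=\int_0^x\gamma(s)\,ds$, let $x(\cdot):[0,1]\to[0,\ell]$ be its inverse,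 and $Q(t)=\widehat Q(x(t))$, $t\in[0,1]$. Finally $$C=\begin{pmatrix} 1 & 1 & 0 & 0 \\ 0 & 0 & 0 & 0 \\ 0 & 0 & 1 & 1 \\ 0 & 0 & 0 & 0 \end{pmatrix},\quad D=\begin{pmatrix} 0 & 0 & 0 & 0 \\ \alpha_1-h_1(\ell) & \alpha_1+h_1(\ell) & \beta_1 & \beta_1 \\ 0 & 0 & 0 & 0 \\ \beta_2 & \beta_2 & \alpha_2-h_2(\ell) & \alpha_2+h_2(\ell) \end{pmatrix}.$$ $L_{C,D}(Q)$ acts in $L^2([0,1];\mathbb C^4)$ by $y\mapsto-iB^{-1}y'+Q(t)y$ on $\{y\in W^{1,1}([0,1];\mathbb C^4):-iB^{-1}y'+Qy\in L^2([0,1];\mathbb C^4),\ Cy(0)+Dy(1)=0\}$. Closed operators $A_1$ in $\mathfrak H_1$ and $A_2$ in $\mathfrak H_2$ are similar if there is a bounded operator $T$ from $\mathfrak H_1$ onto $\mathfrak H_2$ with bounded inverse such that $\operatorname{dom}(A_2)=T\operatorname{dom}(A_1)$ and $A_2=TA_1T^{-1}$. *)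

(* Defs.v *)
From HB Require Import structures.
From mathcomp Require Import all_boot all_order all_algebra.
From mathcomp Require Import complex.
From mathcomp Require Import all_classical all_reals all_analysis.

Set Implicit Arguments.
Unset Strict Implicit.
Unset Printing Implicit Defensive.
Import Order.TTheory GRing.Theory Num.Theory.
Import numFieldNormedType.Exports.
Local Open Scope classical_set_scope.
Local Open Scope ring_scope.

Notation cmod := ComplexField.Normc.normc.

Section FunctionSpaces.
Variable R : realType.
Local Notation C := R[i].
Local Notation mu := (@lebesgue_measure R).
Implicit Types (a b : R) (f g : R -> C).

(* An element of a Lebesgue space on [a, b] is given by a Borel measurable
   representative; values outside [a, b] are irrelevant throughout. *)
Definition cmeasurable a b f : Prop :=
  measurable_fun `[a, b]%classic (fun x => complex.Re (f x)) /\
  measurable_fun `[a, b]%classic (fun x => complex.Im (f x)).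

Definition in_L1 a b f : Prop :=
  cmeasurable a b f /\
  mu.-integrable `[a, b]%classic (fun x => (cmod (f x))%:E).

Definition in_L2 a b f : Prop :=
  cmeasurable a b f /\
  mu.-integrable `[a, b]%classic (fun x => (cmod (f x) ^+ 2)%:E).

Definition in_AC a b f : Prop :=
  forall e : R, 0 < e -> exists2 d : R, 0 < d &
  forall s : seq (R * R),
    (forall p, p \in s -> a <= p.1 /\ p.1 <= p.2 /\ p.2 <= b) ->
    pairwise (fun p q => (p.2 <= q.1) || (q.2 <= p.1)) s ->
    \sum_(p <- s) (p.2 - p.1) < d ->
    \sum_(p <- s) cmod (f p.2 - f p.1) < e.

Definition is_aederiv a b f g : Prop :=
  cmeasurable a b g /\
  \forall x \ae mu, a < x < b ->
    is_derive x 1 (fun s => complex.Re (f s)) (complex.Re (g x)) /\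
    is_derive x 1 (fun s => complex.Im (f s)) (complex.Im (g x)).

(* f' is determined almost everywhere only: this picks one representative *)
Definition aederiv a b f : R -> C := xget (fun=> 0) (is_aederiv a b f).

Definition in_W11 a b f : Prop := in_AC a b f /\ in_L1 a b (aederiv a b f).
Definition in_W12 a b f : Prop := in_AC a b f /\ in_L2 a b (aederiv a b f).

(* no condition is imposed at l *)
Definition in_H10 (l : R) f : Prop := in_W12 0 l f /\ f 0 = 0.

Definition coordf n (y : R -> 'cV[C]_n) (i : 'I_n) : R -> C := fun x => y x i 0.

Definition vderiv a b n (y : R -> 'cV[C]_n) : R -> 'cV[C]_n :=
  fun x => \col_i aederiv a b (coordf y i) x.

End FunctionSpaces.

(* A normed space of (classes of) functions, presented by a seminorm on a set
   of representatives; two representatives denote the same vector when their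
   difference has seminorm 0. *)
Record snspace (R : realType) := SNSpace {
  sncarrier :> lmodType R[i];
  snvec : set sncarrier;
  snorm : sncarrier -> R }.

Section Operators.
Variable R : realType.
Implicit Types X Y : snspace R.

Definition eqv X (x y : X) : Prop :=
  [/\ snvec x, snvec y & snorm (x - y) = 0].

(* An operator is given by its graph on representatives. *)
Definition operator X := X -> X -> Prop.

Definition op_graph X (A : operator X) (x y : X) : Prop :=
  exists x' y', [/\ eqv x x', eqv y y' & A x' y'].

Definition op_dom X (A : operator X) : set X :=
  [set x | exists y, op_graph A x y].

Definition converges X (u : nat -> X) (x : X) : Prop :=
  (fun n => snorm (u n - x)) @ \oo --> (0 : R).

Definition closed_operator X (A : operator X) : Prop :=
  forall (u v : nat -> X) (x y : X),
    (forall n, op_graph A (u n) (v n)) -> snvec x -> snvec y ->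
    converges u x -> converges v y -> op_graph A x y.

Definition bounded_operator X Y (T : X -> Y) : Prop :=
  [/\ forall x, snvec x -> snvec (T x),
      forall (c : R[i]) (x y : X), snvec x -> snvec y ->
        eqv (T (c *: x + y)) (c *: T x + T y) &
      exists M : R, forall x, snvec x -> snorm (T x) <= M * snorm x].

(* S is the inverse of T, and A2 = T A1 S as partially defined operators *)
Definition similar_operators X1 X2 (A1 : operator X1) (A2 : operator X2) :
    Prop :=
  closed_operator A1 /\ closed_operator A2 /\
  exists (T : X1 -> X2) (S : X2 -> X1),
    [/\ bounded_operator T /\ bounded_operator S,
        (forall x, snvec x -> eqv (S (T x)) x) /\
        (forall y, snvec y -> eqv (T (S y)) y),
        forall y, snvec y ->
          (op_dom A2 y <-> exists2 x, op_dom A1 x & eqv y (T x)) &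
        forall y z, snvec y -> snvec z ->
          (op_graph A2 y z <-> exists2 w, op_graph A1 (S y) w & eqv z (T w))].

End Operators.

Section Dirac.
Variable R : realType.
Local Notation C := R[i].
Local Notation mu := (@lebesgue_measure R).

Definition L2space (n : nat) : snspace R :=
  @SNSpace R (R -> 'cV[C]_n)
    [set y | forall i, in_L2 0 1 (coordf y i)]
    (fun y => Num.sqrt
       (\int[mu]_(t in `[0%R, 1%R]%classic) \sum_i cmod (y t i 0) ^+ 2)).

Definition dirac_operator (n : nat) (B C0 D : 'M[C]_n) (Q : R -> 'M[C]_n) :
    operator (L2space n) := fun y z =>
  let Ly t := (- 'i%C) *: (invmx B *m vderiv 0 1 y t) + Q t *m y t in
  [/\ forall i, in_W11 0 1 (coordf y i),
      forall i, in_L2 0 1 (coordf Ly i),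
      C0 *m y 0 + D *m y 1 = 0 &
      z = Ly].

End Dirac.

Section Timoshenko.
Variable R : realType.
Local Notation C := R[i].
Local Notation mu := (@lebesgue_measure R).
Local Open Scope complex_scope.

Definition ord4 (k : nat) : 'I_4 := inord k.
Definition mx4 (s : seq (seq C)) : 'M[C]_4 :=
  \matrix_(i, j) nth 0 (nth [::] s i) j.
Definition col4 (z1 z2 z3 z4 : C) : 'cV[C]_4 :=
  \col_i nth 0 [:: z1; z2; z3; z4] i.

(* 1-based, so that yc y k is y_k for 1 <= k <= 4 *)
Definition yc (y : R -> 'cV[C]_4) (k : nat) : R -> C := coordf y (ord4 k.-1).

Variables (l : R) (EI Irho K rho : R -> R).

Definition timo_space : snspace R :=
  @SNSpace R (R -> 'cV[C]_4)
    [set y | [/\ in_H10 l (yc y 1), in_L2 0 l (yc y 2),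
                 in_H10 l (yc y 3) & in_L2 0 l (yc y 4)]]
    (fun y => Num.sqrt (\int[mu]_(x in `[0%R, l]%classic)
       (EI x * cmod (aederiv 0 l (yc y 1) x) ^+ 2
        + Irho x * cmod (yc y 2 x) ^+ 2
        + K x * cmod (aederiv 0 l (yc y 3) x - yc y 1 x) ^+ 2
        + rho x * cmod (yc y 4 x) ^+ 2))).

(* v1 and v3 are the absolutely continuous representatives of EI y_1' and
   K (y_3' - y_1); boundary values at l are those of v1 and v3. *)
Definition timo_operator (p1 p2 : R -> C) (alpha1 alpha2 beta1 beta2 : C) :
    operator timo_space := fun y z =>
  (forall i, in_H10 l (coordf y i)) /\
  exists v1 v3 : R -> C,
    (in_AC 0 l v1 /\
     v1 = (fun x => (EI x)%:C * aederiv 0 l (yc y 1) x)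
       %[ae mu in `[0%R, l]%classic]) /\
    in_L2 0 l (fun x => aederiv 0 l v1 x - p1 x * yc y 2 x) /\
    (in_AC 0 l v3 /\
     v3 = (fun x => (K x)%:C * (aederiv 0 l (yc y 3) x - yc y 1 x))
       %[ae mu in `[0%R, l]%classic]) /\
    in_L2 0 l (fun x => aederiv 0 l v3 x - p2 x * yc y 4 x) /\
    v1 l + alpha1 * yc y 2 l + beta1 * yc y 4 l = 0 /\
    v3 l + alpha2 * yc y 4 l + beta2 * yc y 2 l = 0 /\
    z = (fun x => ('i%C)^-1 *: col4
      (yc y 2 x)
      ((Irho x)%:C^-1 * (v3 x + aederiv 0 l v1 x - p1 x * yc y 2 x))
      (yc y 4 x)
      ((rho x)%:C^-1 * (aederiv 0 l v3 x - p2 x * yc y 4 x))).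

Definition h1f (x : R) : R := Num.sqrt (EI x * Irho x).
Definition h2f (x : R) : R := Num.sqrt (K x * rho x).

Definition tmap (gamma : R -> R) (x : R) : R :=
  \int[mu]_(s in `[0%R, x]%classic) gamma s.

(* b1, b2, gamma and the inverse xt = x(.) of t(.) on [0, 1] *)
Definition change_of_variable (b1 b2 : R) (gamma xt : R -> R) : Prop :=
  (0 < b1 /\ 0 < b2) /\
  (forall x, 0 <= x <= l -> Num.sqrt (Irho x / EI x) = b1 * gamma x) /\
  (forall x, 0 <= x <= l -> Num.sqrt (rho x / K x) = b2 * gamma x) /\
  \int[mu]_(x in `[0%R, l]%classic) gamma x = 1 /\
  (forall t, 0 <= t <= 1 -> 0 <= xt t <= l /\ tmap gamma (xt t) = t) /\
  (forall x, 0 <= x <= l -> 0 <= tmap gamma x <= 1 /\ xt (tmap gamma x) = x).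

Definition Bmx (b1 b2 : R) : 'M[C]_4 :=
  mx4 [:: [:: - b1%:C;    0;        0;     0];
          [::       0; b1%:C;       0;     0];
          [::       0;    0; - b2%:C;      0];
          [::       0;    0;        0; b2%:C]].

Definition Thetamx (x : R) : 'M[C]_4 :=
  (- 2%:R * 'i%C) *:
    mx4 [:: [:: (Irho x)%:C;           0;          0;          0];
            [::           0; (Irho x)%:C;          0;          0];
            [::           0;           0; (rho x)%:C;          0];
            [::           0;           0;          0; (rho x)%:C]].

Definition Qhat (p1 p2 : R -> C) (x : R) : 'M[C]_4 :=
  let dh1 := aederiv 0 l (fun s => (h1f s)%:C) x in
  let dh2 := aederiv 0 l (fun s => (h2f s)%:C) x in
  let h2 := (h2f x)%:C in
  invmx (Thetamx x) *m
  mx4 [:: [:: p1 x + dh1; p1 x - dh1;         h2;       - h2];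
          [:: p1 x + dh1; p1 x - dh1;         h2;       - h2];
          [::       - h2;       - h2; p2 x + dh2; p2 x - dh2];
          [::         h2;         h2; p2 x + dh2; p2 x - dh2]].

Definition Cmx : 'M[C]_4 :=
  mx4 [:: [:: 1; 1; 0; 0];
          [:: 0; 0; 0; 0];
          [:: 0; 0; 1; 1];
          [:: 0; 0; 0; 0]].

Definition Dmx (alpha1 alpha2 beta1 beta2 : C) : 'M[C]_4 :=
  let h1 := (h1f l)%:C in
  let h2 := (h2f l)%:C in
  mx4 [:: [::           0;           0;           0;           0];
          [:: alpha1 - h1; alpha1 + h1;       beta1;       beta1];
          [::           0;           0;           0;           0];
          [::       beta2;       beta2; alpha2 - h2; alpha2 + h2]].

End Timoshenko.

(* Main.v *)
From HB Require Import structures.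
Require Import Defs.
From mathcomp Require Import all_boot all_order all_algebra.
From mathcomp Require Import complex.
From mathcomp Require Import all_classical all_reals all_analysis.
From mathcomp Require Import measurable_realfun.
From mathcomp Require Import ring lra.
Set Implicit Arguments.
Unset Strict Implicit.
Unset Printing Implicit Defensive.
Import Order.TTheory GRing.Theory Num.Theory.
Import numFieldNormedType.Exports.
Local Open Scope classical_set_scope.
Local Open Scope ring_scope.

(** The equation is diagonalised by its characteristic variables.  Write
    [g_j = b_j gamma] and let [v1 = EI y1'] and [v3 = K (y3' - y1)] be the
    bending moment and the shear force.  The definitions of [b_j], [gamma] and
    [h_j] amount to
      [h1 g1 = Irho],  [EI g1 = h1],  [h2 g2 = rho],  [K g2 = h2],
    so that [y1' / g1 = v1 / h1] and [(y3' - y1) / g2 = v3 / h2].  The operator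
    [to_dirac] sends [y] to the function of [t = t(x)] with the components
      [(y2 -+ y1' / g1) / 2],  [(y4 -+ (y3' - y1) / g2) / 2].
    It makes sense on the whole energy space, and it is bounded with a bounded
    inverse [to_timo]: the energy norm is an L2 norm of [y1'], [y2],
    [y3' - y1], [y4], all coefficients lie between two positive constants, and
    [y1], [y3] are recovered by integration because they vanish at 0.

    On the domain of the Timoshenko operator the same components are
    [(y2 -+ v1 / h1) / 2] and [(y4 -+ v3 / h2) / 2], which are absolutely
    continuous since [h1] and [h2] are, with positive lower bounds.
    Differentiating them, and
    using [d/dx = gamma d/dt], shows that sums and differences of consecutive
    components of [-i B^-1 u' + Q u] are exactly the four lines of the
    Timoshenko operator ([dirac_expr_char]); the matrix [Q] collects the
    damping terms, the derivatives [h_j'] and the zeroth order coupling through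
    [v3].  The conditions [y2(0) = y4(0) = 0] are the rows of [C], and the two
    conditions at [l] those of [D] ([bc_mx]).  Hence [to_dirac] and [to_timo]
    map each graph into the other ([to_dirac_intertwines],
    [to_timo_intertwines]).

    Similarity is a relation between closed operators.  For the Dirac-type
    operator, a Gronwall estimate bounds the supremum of [u] by the L2 norms of
    [u] and of its image ([dirac_sup]), so convergence in the graph norm is
    uniform, and both the integrated equation and the boundary conditions pass
    to the limit ([dirac_closed]).  Closedness of the Timoshenko operator then
    follows through the intertwining ([similar_of_intertwining]).

    Two facts of real analysis carry the computations.  An absolutely
    continuous function is the integral of its derivative; this is obtained
    from the Radon-Nikodym theorem applied to a Lebesgue-Stieltjes measure
    ([rAC_density]).  And a nondecreasing change of variable that is Lipschitz
    in both directions preserves null sets, integrability and absolute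
    continuity, with integrals controlled by the Lipschitz constant
    ([glob_preimage_le], [bilip]). *)

(** * Similarity from intertwining *)

Section AbstractSimilarity.
Variable R : realType.
Implicit Types X Y : snspace R.

(** The constant 2 in the triangle inequality avoids the Cauchy-Schwarz
    inequality for the weighted energy norm: it comes from
    [|a + b|^2 <= 2 |a|^2 + 2 |b|^2], and it is harmless for convergence and for
    equality of classes. *)
Record quasi_seminormed X : Prop := QuasiSeminormed {
  qsn_vec0 : snvec (0 : X);
  qsn_veclin : forall (c : R[i]) (x y : X), snvec x -> snvec y -> snvec (c *: x + y);
  qsn_ge0 : forall x : X, 0 <= snorm x;
  qsn0 : snorm (0 : X) = 0;
  qsnN : forall x : X, snvec x -> snorm (- x) = snorm x;
  qsnD : forall x y : X, snvec x -> snvec y -> snorm (x + y) <= 2 * (snorm x + snorm y) }.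

Section OneSpace.
Variables (X : snspace R) (qX : quasi_seminormed X).
Implicit Types (x y z : X).

Lemma qsn_vecB x y : snvec x -> snvec y -> snvec (x - y).
Proof.
by move=> hx hy; have := qsn_veclin qX (-1) hy hx; rewrite scaleN1r addrC.
Qed.

Lemma qsn_dist x y z : snvec x -> snvec y -> snvec z ->
  snorm (x - z) <= 2 * (snorm (x - y) + snorm (y - z)).
Proof.
move=> hx hy hz; have -> : x - z = (x - y) + (y - z) by rewrite addrA subrK.
by apply: qsnD => //; exact: qsn_vecB.
Qed.

Lemma qsn_distC x y : snvec x -> snvec y -> snorm (x - y) = snorm (y - x).
Proof. by move=> hx hy; rewrite -(qsnN qX) ?opprB//; exact: qsn_vecB. Qed.

Lemma eqv_refl x : snvec x -> eqv x x.
Proof. by move=> hx; split => //; rewrite subrr qsn0. Qed.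

Lemma eqv_sym x y : eqv x y -> eqv y x.
Proof. by move=> [hx hy xy]; split => //; rewrite qsn_distC. Qed.

Lemma eqv_trans y x z : eqv x y -> eqv y z -> eqv x z.
Proof.
move=> [hx hy xy] [_ hz yz]; split => //; apply/eqP; rewrite eq_le qsn_ge0// andbT.
by apply: (le_trans (qsn_dist hx hy hz)); rewrite xy yz addr0 mulr0.
Qed.

Lemma op_graph_eqv (A : operator X) x x' y y' : eqv x x' -> eqv y y' ->
  op_graph A x' y' -> op_graph A x y.
Proof.
move=> xx yy [x1 [y1 [xx1 yy1 A1]]]; exists x1, y1; split => //.
  exact: eqv_trans xx1.
exact: eqv_trans yy1.
Qed.

Lemma op_graph_vec (A : operator X) x y : op_graph A x y -> snvec x /\ snvec y.
Proof. by move=> [x1 [y1 [[] ? _ _ [] ? _ _ _]]]. Qed.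

End OneSpace.

Section TwoSpaces.
Variables (X Y : snspace R) (qX : quasi_seminormed X) (qY : quasi_seminormed Y).
Variables (T : X -> Y) (bT : bounded_operator T).

Let Tvec x : snvec x -> snvec (T x). Proof. by case: bT => h _ _; exact: h. Qed.

Lemma bounded_dist : exists2 M, 0 <= M & forall x y, snvec x -> snvec y ->
  snorm (T x - T y) <= M * snorm (x - y).
Proof.
have [Tv Tl [M HM]] := bT; exists (2 * `|M|) => [|x y hx hy]; first by rewrite mulr_ge0.
have hTx := Tv _ hx; have hTy := Tv _ hy.
have [h1 h2 h3] := Tl (-1) y x hy hx.
rewrite !scaleN1r ![- _ + _]addrC in h1 h2 h3.
have hxy := qsn_vecB qX hx hy; have hTxy := Tv _ hxy.
have h4 : snorm (T x - T y - T (x - y)) = 0 by rewrite qsn_distC.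
have -> : T x - T y = (T x - T y - T (x - y)) + T (x - y) by rewrite subrK.
apply: (le_trans (qsnD qY _ _)) => //; first exact: qsn_vecB.
rewrite h4 add0r -mulrA ler_pM2l//; apply: (le_trans (HM _ hxy)).
by apply: ler_wpM2r; rewrite ?qsn_ge0// ler_norm.
Qed.

Lemma bounded_eqv x y : eqv x y -> eqv (T x) (T y).
Proof.
move=> [hx hy xy]; split; [exact: Tvec|exact: Tvec|].
have [M M0 HM] := bounded_dist; apply/eqP; rewrite eq_le qsn_ge0// andbT.
by apply: (le_trans (HM _ _ hx hy)); rewrite xy mulr0.
Qed.

Lemma bounded_converges (u : nat -> X) x : (forall n, snvec (u n)) -> snvec x ->
  converges u x -> converges (fun n => T (u n)) (T x).
Proof.
move=> hu hx ux; have [M M0 HM] := bounded_dist; rewrite /converges.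
have h0 : (fun n => M * snorm (u n - x)) @ \oo --> (0 : R).
  by rewrite -(mulr0 M); apply: cvgM => //; exact: cvg_cst.
apply: (squeeze_cvgr _ (cvg_cst (0 : R)) h0).
by apply: nearW => n; rewrite qsn_ge0//= HM.
Qed.

End TwoSpaces.

(** It suffices to transport the graphs on exact representatives: bounded maps
    respect classes, which extends the two inclusions to classes, and the
    inclusion for S is the converse of the one for T because S inverts T. A
    graph limit for A1 is mapped by T to one for A2, where closedness applies,
    and is brought back by S. *)
Lemma similar_of_intertwining (X1 X2 : snspace R) (A1 : operator X1) (A2 : operator X2)
    (T : X1 -> X2) (S : X2 -> X1) :
  quasi_seminormed X1 -> quasi_seminormed X2 ->
  bounded_operator T -> bounded_operator S ->
  (forall x, snvec x -> eqv (S (T x)) x) -> (forall y, snvec y -> eqv (T (S y)) y) ->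
  (forall x w, A1 x w -> op_graph A2 (T x) (T w)) ->
  (forall y z, A2 y z -> op_graph A1 (S y) (S z)) ->
  closed_operator A2 -> similar_operators A1 A2.
Proof.
move=> q1 q2 bT bS STK TSK TA SA cl2.
have TG x w : op_graph A1 x w -> op_graph A2 (T x) (T w).
  move=> [x1 [w1 [xx ww /TA]]]; apply: op_graph_eqv => //; exact: bounded_eqv.
have SG y z : op_graph A2 y z -> op_graph A1 (S y) (S z).
  move=> [y1 [z1 [yy zz /SA]]]; apply: op_graph_eqv => //; exact: bounded_eqv.
have Tv x : snvec x -> snvec (T x) by case: bT => h _ _; exact: h.
have Sv y : snvec y -> snvec (S y) by case: bS => h _ _; exact: h.
have eqvTS y x : snvec y -> snvec x -> eqv (S y) x -> eqv y (T x).
  move=> hy hx h; apply: (eqv_trans q2 (eqv_sym q2 (TSK _ hy))).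
  exact: (bounded_eqv q1 q2 bT).
have eqvST y x : snvec y -> snvec x -> eqv y (T x) -> eqv (S y) x.
  move=> hy hx h; apply: (eqv_trans q1 _ (STK _ hx)).
  exact: (bounded_eqv q2 q1 bS).
split; [|split => //].
  move=> u v x y Guv hx hy ux vy.
  have hu n : snvec (u n) by have [] := op_graph_vec (Guv n).
  have hv n : snvec (v n) by have [] := op_graph_vec (Guv n).
  have := cl2 _ _ _ _ (fun n => TG _ _ (Guv n)) (Tv _ hx) (Tv _ hy)
    (bounded_converges q1 q2 bT hu hx ux) (bounded_converges q1 q2 bT hv hy vy).
  move=> /SG; apply: op_graph_eqv => //; apply: eqv_sym => //; exact: STK.
exists T, S; split => //.
- move=> y hy; split.
    move=> [z /SG Gyz]; exists (S y); first by exists (S z).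
    exact/eqv_sym/TSK.
  move=> [x [w Gxw] yTx]; exists (T w).
  have [hx hw] := op_graph_vec Gxw.
  by apply: op_graph_eqv (TG _ _ Gxw) => //; apply: eqv_refl => //; exact: Tv.
- move=> y z hy hz; split.
    move=> /SG Gyz; exists (S z) => //; exact/eqv_sym/TSK.
  move=> [w Gyw zTw]; have [hSy hw] := op_graph_vec Gyw.
  by apply: op_graph_eqv (TG _ _ Gyw) => //; exact/eqv_sym/TSK.
Qed.

End AbstractSimilarity.

(** * Absolutely continuous real functions are integrals *)

Section RealAC.
Variable R : realType.
Local Notation mu := (@lebesgue_measure R).
Implicit Types (a b : R) (f g : R -> R) (s : seq (R * R)).

Definition nonoverlap s := pairwise (fun p q => (p.2 <= q.1) || (q.2 <= p.1)) s.
Definition itvs_in a b s := forall p, p \in s -> a <= p.1 /\ p.1 <= p.2 /\ p.2 <= b.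
Definition len s := \sum_(p <- s) (p.2 - p.1).
Definition osc f s := \sum_(p <- s) `|f p.2 - f p.1|.

Definition rAC a b f := forall e : R, 0 < e -> exists2 d : R, 0 < d &
  forall s, itvs_in a b s -> nonoverlap s -> len s < d -> osc f s < e.

Lemma len_cat s t : len (s ++ t) = len s + len t.
Proof. by rewrite /len big_cat. Qed.
Lemma osc_cat f s t : osc f (s ++ t) = osc f s + osc f t.
Proof. by rewrite /osc big_cat. Qed.

Definition steps a (r : seq R) := zip (a :: r) r.
Arguments steps : simpl never.

Lemma steps_cons a x (s : seq R) : steps a (x :: s) = (a, x) :: steps x s.
Proof. by []. Qed.

Lemma stepsP a b (s : seq R) : itv_partition a b s ->
  [/\ itvs_in a b (steps a s), nonoverlap (steps a s), len (steps a s) = b - a &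
     forall f, osc f (steps a s) = variation a b f s].
Proof.
move=> abs; split.
- move: abs => [/=]; elim: s a => [|x s IH] a /=; first by [].
  move=> /andP[ax xs] sb p; rewrite steps_cons inE => /orP[/eqP->|ps] /=.
    have : itv_partition x b s by [].
    by move=> /itv_partition_le; rewrite (ltW ax).
  have [h1 [h2 h3]] := IH _ xs sb _ ps.
  by rewrite (le_trans (ltW ax) h1).
- move: abs => [/=]; rewrite /nonoverlap; elim: s a => [|x s IH] a /=; first by [].
  move=> /andP[ax xs] sb; rewrite -/(steps x s) IH// andbT.
  apply/allP => p ps /=.
  suff -> : x <= p.1 by [].
  move: ps xs {sb IH ax}; elim: s x => [|y s IH] x //=.
  rewrite steps_cons inE => /orP[/eqP->//|ps] /andP[xy ys].
  by rewrite (le_trans (ltW xy))// IH.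
- move: abs => [_ /eqP <-] {b}; rewrite /len; elim: s a => [|x s IH] a /=.
    by rewrite big_nil subrr.
  rewrite steps_cons big_cons/= IH; ring.
- move=> f; rewrite variation_zip// /osc /steps.
  move: abs => _; elim: s a => [|x s IH] a /=; first by rewrite !big_nil.
  by rewrite !big_cons/= IH.
Qed.

Lemma nonoverlap_refine (F L : seq (R * R)) (p : R * R) (S : seq (R * R)) :
  itvs_in p.1 p.2 S -> nonoverlap S ->
  nonoverlap (F ++ p :: L) -> nonoverlap ((F ++ S) ++ L).
Proof.
move=> Sp nS; rewrite /nonoverlap -catA !pairwise_cat pairwise_cons allrel_catr allrel_consr.
move=> /and3P[/andP[Fp FL] -> /andP[pL ->]]; rewrite FL !andbT.
rewrite -/(nonoverlap S) nS andbT; apply/andP; split.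
- apply/allrelP => x y xF yS; have [h1 [h2 h3]] := Sp _ yS.
  move/allP : Fp => /(_ _ xF) /orP[h|h].
    by rewrite (le_trans h h1).
  by rewrite orbC (le_trans h3 h).
- apply/allrelP => x y xS yL; have [h1 [h2 h3]] := Sp _ xS.
  move/allP : pL => /(_ _ yL) /orP[h|h].
    by rewrite (le_trans h3 h).
  by rewrite orbC (le_trans h h1).
Qed.

(** Absolute continuity controls the total variations over a family of
    intervals, not only the increments: the intervals are replaced one at a
    time by an arbitrary partition, which keeps the total length, and F
    collects the partitions chosen so far. *)
Lemma osc_tv_le a b f (e d : R) :
  (forall s, itvs_in a b s -> nonoverlap s -> len s < d -> osc f s <= e) ->
  forall (L F : seq (R * R)), itvs_in a b (F ++ L) -> nonoverlap (F ++ L) ->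
    len (F ++ L) < d ->
    ((osc f F)%:E + \sum_(p <- L) total_variation p.1 p.2 f <= e%:E)%E.
Proof.
move=> H; elim => [|p L IH] F iF nF lF.
  by rewrite big_nil adde0 lee_fin; apply: H; rewrite ?cats0 in iF nF lF *.
rewrite big_cons addeCA.
have pab : a <= p.1 /\ p.1 <= p.2 /\ p.2 <= b.
  by apply: iF; rewrite mem_cat inE eqxx orbT.
have [ap [pp pb]] := pab.
set A := (_ + \sum_(j <- L) _)%E.
(* replacing p by the intervals of S keeps the total length *)
have step (S : seq (R * R)) : itvs_in p.1 p.2 S -> nonoverlap S -> len S = p.2 - p.1 ->
    ((osc f S)%:E + A <= e%:E)%E.
  move=> iS nS lS.
  have := IH (F ++ S); rewrite osc_cat EFinD addeAC addeC; apply.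
  - move=> q; rewrite -catA !mem_cat => /or3P[qF|qS|qL].
    + by apply: iF; rewrite mem_cat qF.
    + have [h1 [h2 h3]] := iS _ qS; split; first exact: le_trans h1.
      by split => //; exact: le_trans pb.
    + by apply: iF; rewrite mem_cat inE qL !orbT.
  - exact: nonoverlap_refine iS nS nF.
  - by move: lF; rewrite !len_cat lS /len big_cons addrA.
have [pe|pne] := eqVneq p.1 p.2.
  rewrite pe total_variationxx.
  have := step [::]; rewrite /osc /len !big_nil; apply => //.
  by rewrite pe subrr.
have plt : p.1 < p.2 by rewrite lt_neqAle pne pp.
have : A \is a fin_num.
  have A0 : (0 <= A)%E.
    rewrite /A adde_ge0 ?lee_fin//; first by apply: sumr_ge0.
    rewrite big_seq sume_ge0// => q qL; apply: total_variation_ge0.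
  have qF : q \in F ++ p :: L by rewrite mem_cat inE qL !orbT.
    by have [_ []] := iF q qF.
  rewrite ge0_fin_numE//; apply: (@le_lt_trans _ _ e%:E); last exact: ltry.
  have := step (steps p.1 [:: p.2]).
  have [h1 h2 h3 h4] := stepsP (itv_partition1 plt).
  move=> /(_ h1 h2 h3); apply: le_trans; rewrite leeDr// lee_fin.
  by apply: sumr_ge0.
move=> Afin; rewrite -leeBrDr//; apply: ge_ereal_sup => _ [_ [r pr <-] <-].
have [h1 h2 h3 h4] := stepsP pr.
by rewrite leeBrDr// -h4; exact: step.
Qed.

(** The total variation over an interval shorter than d is at most 1, and
    finitely many steps of length d / 2 exhaust [a, b]. *)
Lemma rAC_BV a b f : a <= b -> rAC a b f -> bounded_variation a b f.
Proof.
move=> ab /(_ 1 ltr01)[d d0 fd]; apply/bounded_variationP => //.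
have fd' s : itvs_in a b s -> nonoverlap s -> len s < d -> osc f s <= 1.
  by move=> ? ? ?; rewrite ltW// fd.
suff H n x : a <= x <= b -> x <= a + n%:R * (d / 2) -> (total_variation a x f < +oo)%E.
  rewrite ge0_fin_numE ?total_variation_ge0//.
  have d2 : 0 < d / 2 by rewrite divr_gt0.
  apply: (H (Num.bound ((b - a) / (d / 2)))); first by rewrite ab lexx.
  rewrite -lerBlDl -ler_pdivrMr//; apply: le_trans (ltW (archi_boundP _)) => //.
  by rewrite divr_ge0 ?subr_ge0// ltW.
elim: n x => [|n IH] x /andP[ax xb].
  rewrite mul0r addr0 => xa; have -> : x = a by apply/eqP; rewrite eq_le xa ax.
  by rewrite total_variationxx ltry.
move=> xn; have [xn'|xn'] := leP x (a + n%:R * (d / 2)); first by apply: IH; rewrite ?ax.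
set y := a + n%:R * (d / 2) in IH xn'.
have ay : a <= y by rewrite lerDl mulr_ge0 ?divr_ge0// ltW.
have yb : y <= b by rewrite (le_trans (ltW xn')).
rewrite (total_variationD f ay (ltW xn')).
rewrite lte_add_pinfty// ?IH ?ay ?yb//.
have := osc_tv_le fd' (L := [:: (y, x)]) (F := [::]).
rewrite /osc big_nil add0e big_seq1 /= => H; apply: (le_lt_trans (H _ _ _)).
- by move=> p; rewrite inE => /eqP->/=; split=> //; split=> //; exact: ltW.
- by [].
- rewrite /len big_seq1/=.
  have -> : x - y < d by move: xn; rewrite -natr1 mulrDl mul1r /y; lra.
  by [].
- exact: ltry.
Qed.

Definition tvf a f x := fine (total_variation a x f).

Lemma tvfD a b f x y : a <= x -> x <= y -> y <= b -> rAC a b f ->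
  total_variation x y f = (tvf a f y - tvf a f x)%:E.
Proof.
move=> ax xy yb fAC; have ay := le_trans ax xy; have ab := le_trans ay yb.
have bv : bounded_variation a b f := rAC_BV ab fAC.
have fy : total_variation a y f \is a fin_num.
  by apply/bounded_variationP => //; exact: bounded_variationl bv.
have xb := le_trans xy yb.
have fx : total_variation a x f \is a fin_num.
  by apply/bounded_variationP => //; exact: bounded_variationl bv.
have fxy : total_variation x y f \is a fin_num.
  apply/bounded_variationP => //; apply: (bounded_variationr ax xy).
  exact: bounded_variationl bv.
rewrite /tvf (total_variationD f ax xy) fineD// addrC addKr.
by rewrite fineK.
Qed.

Lemma tvf_ge a b f x y : a <= x -> x <= y -> y <= b -> rAC a b f ->
  `|f y - f x| <= tvf a f y - tvf a f x.
Proof.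
move=> ax xy yb fAC; rewrite -lee_fin -(tvfD ax xy yb fAC).
exact: total_variation_ge.
Qed.

(** With tvf_ge this writes f as a difference of two nondecreasing absolutely
    continuous functions, tvf f - (tvf f - f). *)
Lemma tvf_AC a b f : rAC a b f -> rAC a b (tvf a f).
Proof.
move=> fAC e e0; have e2 : 0 < e / 2 by rewrite divr_gt0.
have [d d0 fd] := fAC _ e2; exists d => // s si sn sd.
apply: (@le_lt_trans _ _ (e / 2)); last by rewrite ltr_pdivrMr// ltr_pMr// ltr1n.
have fd' r : itvs_in a b r -> nonoverlap r -> len r < d -> osc f r <= e / 2.
  by move=> ? ? ?; rewrite ltW// fd.
have := osc_tv_le fd' (L := s) (F := [::]) si sn sd.
rewrite {1}/osc big_nil add0e -lee_fin; apply: le_trans.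
rewrite /osc -sumEFin big_seq [leRHS]big_seq; apply: lee_sum => p ps.
have [h1 [h2 h3]] := si _ ps.
rewrite (tvfD h1 h2 h3 fAC) lee_fin ger0_norm//.
by apply: le_trans (tvf_ge h1 h2 h3 fAC).
Qed.

(** Common source of the closure properties: sums, products and inverses are
    all dominated by the oscillations of their arguments. *)
Lemma rAC_osc a b f g (h : R -> R) (M N : R) : 0 <= M -> 0 <= N -> rAC a b f -> rAC a b g ->
  (forall x y, a <= x <= b -> a <= y <= b ->
     `|h y - h x| <= M * `|f y - f x| + N * `|g y - g x|) -> rAC a b h.
Proof.
move=> M0 N0 fAC gAC H e e0.
have eM : 0 < e / 2 / (M + 1) by rewrite !divr_gt0// ltr_wpDl.
have eN : 0 < e / 2 / (N + 1) by rewrite !divr_gt0// ltr_wpDl.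
have [d1 d10 fd] := fAC _ eM; have [d2 d20 gd] := gAC _ eN.
exists (Num.min d1 d2); first by rewrite lt_min d10.
move=> s si sn; rewrite lt_min => /andP[s1 s2].
apply: (@le_lt_trans _ _ (M * osc f s + N * osc g s)).
  rewrite /osc !mulr_sumr -big_split/= big_seq [leRHS]big_seq; apply: ler_sum => p ps.
  have [h1 [h2 h3]] := si _ ps.
  by apply: H; rewrite ?h1 ?h3 ?(le_trans h1 h2) ?(le_trans h2 h3).
have := gd _ si sn s2; have := fd _ si sn s1.
rewrite !ltr_pdivlMr ?ltr_wpDl// => h1 h2.
have : 0 <= osc f s by apply: sumr_ge0.
have : 0 <= osc g s by apply: sumr_ge0.
lra.
Qed.

Lemma rAC_lin a b f g (c : R) : rAC a b f -> rAC a b g ->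
  rAC a b (fun x => c * f x + g x).
Proof.
move=> fAC gAC; apply: (rAC_osc (normr_ge0 c) ler01 fAC gAC) => x y _ _.
rewrite mul1r -normrM (_ : _ - _ = c * (f y - f x) + (g y - g x)); last by ring.
exact: ler_normD.
Qed.

Lemma rAC_continuous a b f : rAC a b f -> forall e, 0 < e ->
  exists2 d, 0 < d & forall x y, a <= x <= b -> a <= y <= b -> `|x - y| < d -> `|f x - f y| < e.
Proof.
move=> fAC e e0; have [d d0 H] := fAC e e0; exists d => // x y.
wlog xy : x y / x <= y.
  move=> W hx hy; case: (leP x y) => [xy|/ltW xy]; first exact: W.
  by rewrite distrC => ?; rewrite distrC; exact: W.
move=> /andP[ax xb] /andP[ay yb]; rewrite distrC ger0_norm ?subr_ge0// => xd.
have := H [:: (x, y)]; rewrite /len /osc !big_seq1/= distrC; apply => //.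
by move=> p; rewrite inE => /eqP->/=.
Qed.

(** Connected components of an open neighbourhood of a null set are cut down to
    subintervals of [a, b], the form in which absolute continuity applies to
    them. The pair (a, a) stands for an empty intersection. *)
Lemma component_hull a b (I : set R) : a <= b -> open I -> is_interval I ->
  exists p : R * R, [/\ [/\ a <= p.1, p.1 <= p.2 & p.2 <= b],
    `]p.1, p.2[ `<=` I `&` `]a, b], I `&` `]a, b] `<=` `]p.1, p.2] &
    p.1 < p.2 \/ p = (a, a)].
Proof.
move=> ab oI iI; have [[z [Iz zab]]|J0] := pselect (I `&` `]a, b] !=set0); last first.
  have {J0}-> : I `&` `]a, b] = set0 by apply/eqP/negPn/negP => /set0P.
  exists (a, a); split => //=; last by right.
  by rewrite set_itv_ge ?bnd_simp// ltxx.
set J := I `&` `]a, b].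
have Jz : J z by [].
have Jub : has_ubound J by exists b => x [_ /=]; rewrite in_itv/= => /andP[].
have Jlb : has_lbound J by exists a => x [_ /=]; rewrite in_itv/= => /andP[/ltW].
have [hi hs] : has_inf J /\ has_sup J by split; split => //; exists z.
have notinf x : J x -> inf J < x.
  move=> [Ix]; rewrite /= in_itv/= => /andP[ax xb].
  have /(_ x Ix) : forall y, I y -> nbhs y I by move=> y Iy; exact: open_nbhs_nbhs.
  move=> /nbhs_ballP[d /= d0 dI].
  set y := Num.max (x - d / 2) ((a + x) / 2).
  have yx : y < x by rewrite gt_max; apply/andP; split; lra.
  apply: le_lt_trans (yx); apply: ge_inf => //; split.
    apply: dI; rewrite /ball/= ltr_distlC.
    have h1 : x - d / 2 <= y by rewrite le_max lexx.
    by apply/andP; split; lra.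
  have h2 : (a + x) / 2 <= y by rewrite le_max lexx orbT.
  by rewrite /= in_itv/=; apply/andP; split; lra.
exists (inf J, sup J); split => //=.
- split.
  + by apply: lb_le_inf; [exists z|move=> x [_ /=]; rewrite in_itv/= => /andP[/ltW]].
  + by rewrite (le_trans (ltW (notinf _ Jz)))// ub_le_sup.
  + by apply: ge_sup; [exists z|move=> x [_ /=]; rewrite in_itv/= => /andP[]].
- move=> x; rewrite /= in_itv/= => /andP[ix xs].
  have [u Ju ux] := inf_lt hi.1 ix; have [v Jv xv] := sup_gt hs.1 xs.
  case: Ju => Iu; rewrite /= in_itv/= => /andP[au ub].
  case: Jv => Iv; rewrite /= in_itv/= => /andP[av vb].
  split; first by apply: (iI u v) => //; rewrite !ltW.
  by rewrite /= in_itv/=; apply/andP; split; lra.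
- move=> x Jx; rewrite /= in_itv/= notinf//=.
  exact: ub_le_sup.
- left; exact: lt_le_trans (notinf _ Jz) (ub_le_sup Jub Jz).
Qed.

Lemma LS_itv (F : cumulative R R) x y : x <= y ->
  lebesgue_stieltjes_measure F `]x, y]%classic = (F y - F x)%:E.
Proof.
move=> xy; rewrite /lebesgue_stieltjes_measure/= /measure_extension.
rewrite measurable_mu_extE/=; last exact: is_ocitv.
by rewrite wlength_itv_bnd.
Qed.

(** Absolute continuity of F is absolute continuity of its Stieltjes measure:
    a null set lies in an open set of length less than d, a countable disjoint
    union of intervals, over any finitely many of which F oscillates by less
    than e. *)
Lemma LS_null (F : cumulative R R) a b (A : set R) : a <= b -> rAC a b F ->
  measurable A -> A `<=` `]a, b] -> mu A = 0 -> lebesgue_stieltjes_measure F A = 0.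
Proof.
move=> ab FAC mA Aab A0.
have Fnd x y : x <= y -> F x <= F y by exact: cumulative_is_nondecreasing.
apply/eqP; rewrite eq_le measure_ge0 andbT; apply/lee_addgt0Pr => e e0.
rewrite add0e.
have [d d0 Fd] := FAC _ e0.
have d2 : 0 < d / 2 by rewrite divr_gt0.
have [U [oU AU]] := outer_measure_open_le A d2.
have -> : ((wlength idfun)^*%mu A = 0)%E by exact: A0.
rewrite add0e => Ud.
pose I := open_disjoint_itv oU.
have Iint q : is_interval (I q) by exact: open_disjoint_itv_is_interval.
have Iop q : open (I q) by exact: open_disjoint_itv_open.
have Itriv : trivIset setT I by exact: open_disjoint_itv_trivIset.
have UE : U = \bigcup_q I q by exact: open_disjoint_itv_bigcup.
have /choice[p pP] q := component_hull ab (Iop q) (Iint q).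
have mI q : measurable (I q) by exact: open_measurable.
have mJ q : measurable (I q `&` `]a, b]%classic) by apply: measurableI.
pose s n := [seq p q | q <- iota 0 n].
have sin n : itvs_in a b (s n).
  by move=> _ /mapP[q _ ->]; have [[? ? ?] _ _ _] := pP q.
have sno n : nonoverlap (s n).
  rewrite /nonoverlap pairwise_map.
  apply: (@sub_pairwise _ (SimplRel (fun x y : nat => x != y))); last first.
    by rewrite -uniq_pairwise iota_uniq.
  move=> i j /= ij; have [[ai ii ib] Ii _ ei] := pP i; have [[aj jj jb] Ij _ ej] := pP j.
  case: ei => [ei|->/=]; last by rewrite aj.
  case: ej => [ej|->/=]; last by rewrite ai orbT.
  apply/negPn/negP; rewrite negb_or -!ltNge => /andP[h1 h2].
  pose m := (Num.max (p i).1 (p j).1 + Num.min (p i).2 (p j).2) / 2.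
  have m1 : Num.max (p i).1 (p j).1 < Num.min (p i).2 (p j).2.
    by rewrite gt_max !lt_min ei ej h1 h2.
  have h3 : Num.max (p i).1 (p j).1 < m by rewrite /m; lra.
  have h4 : m < Num.min (p i).2 (p j).2 by rewrite /m; lra.
  move: h3 h4; rewrite gt_max lt_min => /andP[i1 j1] /andP[i2 j2].
  have [Iim _] : (I i `&` `]a, b]) m by apply: Ii; rewrite /= in_itv/= i1.
  have [Ijm _] : (I j `&` `]a, b]) m by apply: Ij; rewrite /= in_itv/= j1.
  move/trivIsetP : Itriv => /(_ i j Logic.I Logic.I ij).
  by rewrite -subset0 => /(_ m); apply.
have slen n : len (s n) < d.
  apply: (@le_lt_trans _ _ (d / 2)); last by lra.
  rewrite -lee_fin; apply: le_trans Ud; rewrite UE measure_semi_bigcup//; last first.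
    by rewrite -UE; exact: open_measurable.
  apply: le_trans (nneseries_lim_ge n _) => //.
  rewrite /len big_map -sumEFin /index_iota subn0; apply: lee_sum => q _.
  have [[ai ii ib] Ii _ ei] := pP q.
  apply: (@le_trans _ _ (mu `](p q).1, (p q).2[%classic)).
    rewrite lebesgue_measure_itv/= lte_fin; case: ltP => h; first by rewrite EFinB.
    by rewrite lee_fin subr_le0.
  apply: le_measure; rewrite ?inE//; first exact: mI.
  by move=> x /Ii[].
have small n : (\sum_(0 <= q < n) lebesgue_stieltjes_measure F (I q `&` `]a, b]%classic) <= e%:E)%E.
  apply: (@le_trans _ _ (osc F (s n))%:E); last by rewrite lee_fin ltW// Fd.
  rewrite /osc big_map -sumEFin /index_iota subn0; apply: lee_sum => q _.
  have [[ai ii ib] _ Ii ei] := pP q.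
  rewrite ger0_norm ?subr_ge0 ?Fnd// -LS_itv//.
  by apply: le_measure; rewrite ?inE//; exact: mJ.
apply: (@le_trans _ _ (\sum_(0 <= q <oo) lebesgue_stieltjes_measure F (I q `&` `]a, b]%classic))%E).
  apply: measure_sigma_subadditive => //.
  move=> x Ax; have := AU _ Ax; rewrite UE => -[q _ Iqx].
  by exists q => //; split => //; exact: Aab.
apply: lime_le; first exact: is_cvg_nneseries.
by apply: nearW => n; exact: small.
Qed.

Definition clamp a b x := Num.min b (Num.max a x).

Lemma clampP a b x : a <= b -> a <= clamp a b x <= b.
Proof. by move=> ab; rewrite /clamp le_min ab le_max lexx ge_min lexx. Qed.

Lemma clamp_id a b x : a <= x <= b -> clamp a b x = x.
Proof. by move=> /andP[ax xb]; rewrite /clamp (max_idPr ax) (min_idPr xb). Qed.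

Lemma clamp_nd a b x y : x <= y -> clamp a b x <= clamp a b y.
Proof.
by move=> xy; rewrite /clamp le_min !ge_min !ge_max !le_max !lexx xy !orbT.
Qed.

Lemma clamp_lip a b x y : `|clamp a b x - clamp a b y| <= `|x - y|.
Proof.
wlog xy : x y / x <= y.
  by move=> W; case: (leP x y) => [/W//|/ltW/W]; rewrite distrC => h; rewrite (distrC x).
rewrite ler0_norm ?subr_le0 ?clamp_nd// ler0_norm ?subr_le0// !opprB /clamp.
rewrite /Num.max /Num.min.
by case: (ltP a x); case: (ltP a y) => ? ?; do 2 case: ltP => ?; lra.
Qed.

Lemma rAC_eq a b f g : (forall x, a <= x <= b -> f x = g x) -> rAC a b f -> rAC a b g.
Proof.
move=> fg fAC e e0; have [d d0 H] := fAC e e0; exists d => // s si sn sl.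
have := H s si sn sl; congr (_ < _); apply: eq_big_seq => p ps.
have [h1 [h2 h3]] := si _ ps.
by rewrite !fg// ?h1 ?h3 ?(le_trans h1 h2) ?(le_trans h2 h3).
Qed.

(** The density is the Radon-Nikodym derivative of the Stieltjes measure of f,
    which LS_null makes absolutely continuous. *)
Lemma mono_rAC_density a b f : a <= b -> rAC a b f ->
  (forall x y, a <= x -> x <= y -> y <= b -> f x <= f y) ->
  exists g, mu.-integrable setT (EFin \o g) /\
    forall x, a <= x <= b -> f x - f a = \int[mu]_(t in `[a, x]) g t.
Proof.
move=> ab fAC fnd.
pose G x := f (clamp a b x).
have Gnd : {homo G : x y / x <= y}.
  move=> x y xy; have /andP[? ?] := clampP x ab; have /andP[? ?] := clampP y ab.
  by apply: fnd => //; exact: clamp_nd.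
have Gc : continuous G.
  move=> x; apply/cvgrPdist_lt => e e0.
  have [d d0 fd] := rAC_continuous fAC e0.
  near=> y; apply: fd; rewrite ?clampP//; apply: le_lt_trans (clamp_lip _ _ _ _) _.
  by near: y; apply: cvgr_dist_lt.
have Grc : right_continuous G by exact: right_continuousW.
pose Gm := isCumulative.Build R _ R G Gnd Grc.
pose GC : cumulative R R := HB.pack G Gm.
have GAC : rAC a b GC.
  by apply: rAC_eq fAC => x xab; rewrite /GC/= /G clamp_id.
pose D : set (measurableTypeR R) := `]a, b]%classic.
have mD : measurable D by exact: measurable_itv.
have Doo : (lebesgue_stieltjes_measure GC D < +oo)%E by rewrite LS_itv// ltry.
pose nu : {finite_measure set (measurableTypeR R) -> \bar R} := mfrestr mD Doo.
have numu : nu `<< mu.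
  apply/null_content_dominatesP => A mA muA0.
  rewrite /nu/= /mfrestr /mrestr; apply: (LS_null ab GAC).
  - by apply: measurableI => //; exact: measurable_itv.
  - by move=> x [].
  - apply/eqP; rewrite eq_le measure_ge0 andbT -muA0; apply: le_measure; rewrite ?inE//.
    by apply: measurableI => //; exact: measurable_itv.
have [h [h0 hfin hint hnu]] := radon_nikodym_sigma_finite numu.
have gint : mu.-integrable setT (EFin \o (fine \o h)).
  by apply: eq_integrable hint => // x _ /=; rewrite fineK.
exists (fine \o h); split => //.
move=> x /andP[ax xb].
rewrite -Rintegral_itv_obnd_cbnd; last first.
  exact: integrableS gint.
rewrite /Rintegral.
under eq_integral do rewrite /= fineK//.
rewrite -(hnu `]a, x]%classic)//.
rewrite /nu/= /mfrestr /mrestr /D.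
have -> : `]a, x] `&` `]a, b] = `]a, x]%classic.
  apply/seteqP; split => [y []//|y /=]; rewrite !in_itv/= => /andP[ay yx].
  by rewrite ay yx (le_trans yx xb).
by rewrite LS_itv//= /G !clamp_id// ?lexx ?ab// ax xb.
Unshelve. all: by end_near. Qed.

(** The Jordan decomposition of f reduces this to nondecreasing functions. *)
Theorem rAC_density a b f : a <= b -> rAC a b f ->
  exists g, mu.-integrable setT (EFin \o g) /\
    forall x, a <= x <= b -> f x = f a + \int[mu]_(t in `[a, x]) g t.
Proof.
move=> ab fAC; pose V := tvf a f.
have VAC : rAC a b V by exact: tvf_AC.
have [g1 [ig1 g1E]] : exists g, mu.-integrable setT (EFin \o g) /\
    forall x, a <= x <= b -> V x - V a = \int[mu]_(t in `[a, x]) g t.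
  apply: mono_rAC_density => // x y ax xy yb.
  by rewrite -subr_ge0; apply: le_trans (tvf_ge ax xy yb fAC).
have WAC : rAC a b (fun x => -1 * f x + V x) by exact: rAC_lin.
have [g2 [ig2 g2E]] : exists g, mu.-integrable setT (EFin \o g) /\
    forall x, a <= x <= b -> (-1 * f x + V x) - (-1 * f a + V a) = \int[mu]_(t in `[a, x]) g t.
  apply: mono_rAC_density => // x y ax xy yb.
  have := tvf_ge ax xy yb fAC; have := ler_norm (f y - f x); rewrite -/V; lra.
exists (fun x => g1 x - g2 x); split.
  by rewrite (_ : _ \o _ = (EFin \o g1) \- (EFin \o g2))%E//; exact: integrableB.
move=> x xab; rewrite RintegralB//; last 2 first.
- exact: integrableS ig1.
- exact: integrableS ig2.
by rewrite -g1E// -g2E//; ring.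
Qed.

Lemma aeS (P Q : R -> Prop) : (forall x, P x -> Q x) ->
  (\forall x \ae mu, P x) -> \forall x \ae mu, Q x.
Proof. by move=> PQ; apply: filterS PQ; exact: (ae_filter_ringOfSetsType mu). Qed.

Lemma aeS2 (P Q S : R -> Prop) : (forall x, P x -> Q x -> S x) ->
  (\forall x \ae mu, P x) -> (\forall x \ae mu, Q x) -> \forall x \ae mu, S x.
Proof.
by move=> PQS; apply: filterS2 PQS; exact: (ae_filter_ringOfSetsType mu).
Qed.

Lemma RintE (D : set R) g : measurable D -> mu.-integrable D (EFin \o g) ->
  ((\int[mu]_(t in D) g t)%:E = \int[mu]_(t in D) (g t)%:E)%E.
Proof. by move=> mD ig; rewrite /Rintegral fineK//; exact: integrable_fin_num. Qed.

(** The increments of an indefinite integral over disjoint intervals are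
    bounded by one integral over their union, to which the absolute continuity
    of the integral applies. *)
Lemma int_union (g : R -> R) a b s : itvs_in a b s -> nonoverlap s ->
  mu.-integrable `[a, b] (EFin \o g) ->
  exists A : set R, [/\ measurable A, A `<=` `[a, b],
    (mu A <= (len s)%:E)%E &
    ((osc (fun x => \int[mu]_(t in `[a, x]) g t) s)%:E <= \int[mu]_(t in A) (`|g t|%:E))%E] /\
    (forall x, A x -> exists2 p, p \in s & p.1 < x <= p.2).
Proof.
move=> si sn ig; elim: s si sn => [|p s IH] si sn.
  exists set0; split; last by [].
  by split => //; rewrite ?measure0 ?/len ?/osc ?big_nil ?integral_set0.
have pi : a <= p.1 /\ p.1 <= p.2 /\ p.2 <= b by apply: si; rewrite inE eqxx.
have si' : itvs_in a b s by move=> q qs; apply: si; rewrite inE qs orbT.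
move: sn; rewrite /nonoverlap/= => /andP[/allP ps sn].
have [A [[mA Aab Al Ao] As]] := IH si' sn.
have [h1 [h2 h3]] := pi.
have pab : `]p.1, p.2] `<=` `[a, b].
  move=> x /=; rewrite !in_itv/= => /andP[px xp].
  by rewrite (le_trans h1 (ltW px)) (le_trans xp h3).
have dis : [disjoint `]p.1, p.2]%classic & A].
  apply/disj_setPRL => x Ax /=; rewrite in_itv/= => /andP[px xp].
  have [q qs /andP[qx xq]] := As _ Ax.
  by have := ps _ qs => /= /orP[]h; [move: (le_trans xp h)|move: (le_trans xq h)];
    rewrite leNgt ?qx ?px.
have mg : measurable_fun `[a, b] g by have /measurable_EFinP := measurable_int mu ig.
exists (`]p.1, p.2] `|` A); split; last first.
  move=> x [|/As[q qs ?]]; last by exists q => //; rewrite inE qs orbT.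
  by rewrite /= in_itv/= => ?; exists p => //; rewrite inE eqxx.
split.
- exact: measurableU.
- by rewrite subUset.
- rewrite measureU//; last exact/eqP.
  have mup : (mu `]p.1, p.2]%classic <= (p.2 - p.1)%:E)%E.
    rewrite lebesgue_measure_itv/= lte_fin.
    by case: ltP => h; [rewrite EFinB|rewrite lee_fin subr_ge0].
  by rewrite /len big_cons EFinD; apply: leeD.
- rewrite ge0_integral_setU//=; last first.
    apply/measurable_EFinP; apply: measurableT_comp => //.
    by apply: measurable_funS mg => //; rewrite subUset.
  rewrite /osc big_cons EFinD; apply: leeD => //.
  have ga : mu.-integrable `[a, p.2] (EFin \o g).
    by apply: integrableS ig => //; apply: subset_itvl; rewrite bnd_simp.
  have -> : \int[mu]_(t in `[a, p.2]) g t - \int[mu]_(t in `[a, p.1]) g t = \int[mu]_(t in `]p.1, p.2]) g t.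
    by rewrite (Rintegral_itvB ga) ?bnd_simp.
  have gp : mu.-integrable `]p.1, p.2] (EFin \o g) by exact: integrableS ig.
  rewrite EFin_normr_Rintegral//; apply: le_abse_integral => //.
  exact: measurable_int gp.
Qed.

Lemma int_rAC (g : R -> R) a b : mu.-integrable `[a, b] (EFin \o g) ->
  rAC a b (fun x => \int[mu]_(t in `[a, x]) g t).
Proof.
move=> ig e e0.
have ig' : mu.-integrable setT (EFin \o (g \_ `[a, b])).
  by rewrite -restrict_EFin; apply/integrable_restrict => //=; rewrite setTI.
have [d [d0 H]] := integral_normr_continuous ig' e0.
exists d => // s si sn sl.
have [A [[mA Aab Al Ao] _]] := int_union si sn ig.
have := H A mA; rewrite (le_lt_trans Al) ?lte_fin// => /(_ isT).
apply: le_lt_trans; rewrite -lee_fin; apply: (le_trans Ao).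
rewrite RintE//; last first.
  by apply: integrable_norm; exact: integrableS ig'.
rewrite le_eqVlt; apply/orP; left; apply/eqP.
by apply: eq_integral => x; rewrite inE => xA; rewrite patchE mem_set//; exact: Aab.
Qed.

Lemma is_derive_near (f g : R -> R) x d : (\forall y \near x, f y = g y) ->
  is_derive x 1 f d -> is_derive x 1 g d.
Proof.
move=> fg [df <-]; have gf : {near x, g =1 f} by near=> y; apply/esym; near: y.
split; last by apply: near_eq_derive => //; rewrite oner_neq0.
apply: near_eq_derivable df => //; exact: oner_neq0.
Unshelve. all: by end_near. Qed.

Lemma near_oo a b x : a < x < b -> \forall y \near x, a < y < b.
Proof.
move=> /andP[ax xb]; near=> y; apply/andP; split.
- by near: y; exact: lt_nbhsr.
- by near: y; exact: lt_nbhsl.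
Unshelve. all: by end_near. Qed.

(** Lebesgue's differentiation theorem, transferred from the integral of g
    extended by 0 to f, which agrees with it only on [a, b]. *)
Lemma int_derive (f g : R -> R) a b : mu.-integrable `[a, b] (EFin \o g) ->
  (forall x, a <= x <= b -> f x = f a + \int[mu]_(t in `[a, x]) g t) ->
  {ae mu, forall x, a < x < b -> is_derive x 1 f (g x)}.
Proof.
move=> ig fE; pose h := g \_ `[a, b].
have ih : mu.-integrable setT (EFin \o h).
  by rewrite -restrict_EFin; apply/integrable_restrict => //=; rewrite setTI.
have lh : locally_integrable setT h by apply: open_integrable_locally => //; exact: openT.
have ihy y : mu.-integrable [set` Interval (BLeft a) (BRight y)] (EFin \o h).
  by apply: integrableS ih => //; exact: measurable_itv.
have := FTC1 ihy lh.
apply: aeS => x H xab; have /andP[ax xb] := xab.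
have aBx : (BLeft a < BRight x)%E by rewrite lte_fin.
have [dH HE] := H aBx.
have hx : h x = g x by rewrite /h patchE mem_set//= in_itv/= !ltW.
have Hd : is_derive x 1 (fun y => \int[mu]_(t in `[a, y]) h t) (g x).
  by split => //; rewrite -derive1E HE.
have : is_derive x 1 (fun y => f a + \int[mu]_(t in `[a, y]) h t) (g x).
  by have := is_deriveD (is_derive_cst (f a) x 1) Hd; rewrite add0r.
apply: is_derive_near; near=> y.
have /andP[ay yb] : a < y < b by near: y; exact: near_oo.
rewrite (fE y) ?ltW//; congr (_ + _); apply: eq_Rintegral => t.
rewrite inE/= in_itv/= => /andP[at_ ty]; rewrite /h patchE mem_set//= in_itv/=.
by rewrite at_ (le_trans ty (ltW yb)).
Unshelve. all: by end_near. Qed.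

End RealAC.

(** * Complex-valued functions in Lebesgue spaces *)

Local Notation Rez := (@complex.Re _).
Local Notation Imz := (@complex.Im _).

Section ComplexBasics.
Variable R : realType.
Local Notation C := R[i].
Implicit Types (z w : C) (r : R).

Lemma ReM z w : Rez (z * w) = Rez z * Rez w - Imz z * Imz w.
Proof. by case: z; case: w. Qed.
Lemma ImM z w : Imz (z * w) = Rez z * Imz w + Imz z * Rez w.
Proof. by case: z; case: w. Qed.

Lemma cmodE z : cmod z = Num.sqrt (Rez z ^+ 2 + Imz z ^+ 2).
Proof. by case: z. Qed.

Lemma cmod_sq z : cmod z ^+ 2 = Rez z ^+ 2 + Imz z ^+ 2.
Proof. by rewrite cmodE sqr_sqrtr// addr_ge0// sqr_ge0. Qed.

Lemma cmod_ge0 z : 0 <= cmod z.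
Proof. by rewrite cmodE sqrtr_ge0. Qed.

Lemma cmodD z w : cmod (z + w) <= cmod z + cmod w.
Proof. exact: le_normcD. Qed.

Lemma cmodN z : cmod (- z) = cmod z.
Proof. exact: normcN. Qed.

Lemma cmodB z w : cmod (z - w) = cmod (w - z).
Proof. by rewrite -cmodN opprB. Qed.

Lemma cmodM z w : cmod (z * w) = cmod z * cmod w.
Proof. exact: ComplexField.Normc.normcM. Qed.

Lemma cmod0 : cmod (0 : C) = 0. Proof. exact: ComplexField.Normc.normc0. Qed.

Lemma cmod_eq0 z : cmod z = 0 -> z = 0.
Proof. exact: ComplexField.Normc.eq0_normc. Qed.

Lemma cmodR r : cmod (r%:C)%C = `|r|.
Proof. by rewrite cmodE/= expr0n/= addr0 sqrtr_sqr. Qed.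

Lemma cmod_i : cmod ('i%C : C) = 1.
Proof. by rewrite cmodE/= expr0n/= add0r expr1n sqrtr1. Qed.

Lemma Re_le_cmod z : `|Rez z| <= cmod z.
Proof. by rewrite cmodE -sqrtr_sqr ler_wsqrtr// lerDl sqr_ge0. Qed.
Lemma Im_le_cmod z : `|Imz z| <= cmod z.
Proof. by rewrite cmodE -sqrtr_sqr ler_wsqrtr// lerDr sqr_ge0. Qed.

Lemma cmod_le_ReIm z : cmod z <= `|Rez z| + `|Imz z|.
Proof.
rewrite cmodE -[leRHS]ger0_norm ?addr_ge0// -sqrtr_sqr ler_wsqrtr//.
rewrite sqrrD !real_normK ?num_real//.
have : 0 <= `|Rez z| * `|Imz z| by rewrite mulr_ge0.
lra.
Qed.

Lemma cmodD_sq z w : cmod (z + w) ^+ 2 <= 2 * cmod z ^+ 2 + 2 * cmod w ^+ 2.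
Proof.
rewrite !cmod_sq; case: z => a b; case: w => c d /=.
have := sqr_ge0 (a - c); have := sqr_ge0 (b - d); rewrite !expr2; lra.
Qed.

Lemma cmod_sum (I : Type) (s : seq I) (F : I -> C) :
  cmod (\sum_(i <- s) F i) <= \sum_(i <- s) cmod (F i).
Proof.
elim: s => [|i s IH]; first by rewrite !big_nil cmod0.
by rewrite !big_cons (le_trans (cmodD _ _))// lerD2l.
Qed.

Lemma ceqP z w : Rez z = Rez w -> Imz z = Imz w -> z = w.
Proof. by case: z; case: w => /= ? ? ? ? -> ->. Qed.

End ComplexBasics.

Section AeOnInterval.
Variable R : realType.
Local Notation mu := (@lebesgue_measure R).
Implicit Types (a b x : R) (P Q S : R -> Prop).

Definition aein a b P := \forall x \ae mu, a < x < b -> P x.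

Lemma aein_imp a b P Q : (forall x, a < x < b -> P x -> Q x) -> aein a b P -> aein a b Q.
Proof. by move=> PQ; apply: aeS => x H xab; apply: PQ => //; exact: H. Qed.

Lemma aein_all a b P : (forall x, a < x < b -> P x) -> aein a b P.
Proof. by move=> H; apply: aeW. Qed.

Lemma aein_imp2 a b P Q S : (forall x, a < x < b -> P x -> Q x -> S x) ->
  aein a b P -> aein a b Q -> aein a b S.
Proof. by move=> PQ; apply: aeS2 => x H1 H2 xab; apply: PQ => //; [exact: H1|exact: H2]. Qed.

Lemma aein_and a b P Q : aein a b P -> aein a b Q -> aein a b (fun x => P x /\ Q x).
Proof. by apply: aein_imp2. Qed.

Lemma aein_imp3 a b P Q S T : (forall x, a < x < b -> P x -> Q x -> S x -> T x) ->
  aein a b P -> aein a b Q -> aein a b S -> aein a b T.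
Proof.
move=> H p q s; apply: (aein_imp2 _ (aein_and p q) s) => x xab [p' q'] s'.
exact: H.
Qed.

Lemma ae_pt a : \forall x \ae mu, x <> a.
Proof.
exists [set a]; split => //; first exact: lebesgue_measure_set1.
by move=> x /= /contrapT ->.
Qed.

(** The endpoints form a null set; the open interval is the form used for
    derivatives and the closed one for integrals. *)
Lemma aein_cc a b P : aein a b P <-> {ae mu, forall x, `[a, b]%classic x -> P x}.
Proof.
split; last first.
  by apply: aeS => x H /andP[xa xb]; apply: H; rewrite /= in_itv/= !ltW.
move=> H; have ab : \forall x \ae mu, x <> a /\ x <> b by apply: (aeS2 _ (ae_pt a) (ae_pt b)).
apply: (aeS2 _ H ab) => x {}H [/= xa xb]; rewrite in_itv/= => /andP[ax xb'].
by apply: H; rewrite !lt_neqAle ax xb'; apply/andP; split; rewrite ?andbT; apply/eqP => // /esym.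
Qed.

End AeOnInterval.

Section Lspaces.
Variable R : realType.
Local Notation C := R[i].
Local Notation mu := (@lebesgue_measure R).
Implicit Types (a b c x : R) (f g : R -> C) (h : R -> R).

Lemma mitv a b : measurable (`[a, b]%classic : set R).
Proof. exact: measurable_itv. Qed.
Hint Resolve mitv : core.

Lemma cmeas_eq a b f g : (forall x, a <= x <= b -> f x = g x) ->
  cmeasurable a b f -> cmeasurable a b g.
Proof.
move=> fg [mr mi]; split; [move: mr|move: mi]; apply: eq_measurable_fun => x;
  by rewrite inE/= in_itv/= => /fg ->.
Qed.

Lemma cmeas_cst a b (z : C) : cmeasurable a b (fun=> z).
Proof. by split; exact: measurable_cst. Qed.

Lemma cmeasD a b f g : cmeasurable a b f -> cmeasurable a b g ->
  cmeasurable a b (fun x => f x + g x).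
Proof.
move=> [fr fi] [gr gi]; split.
  have -> : (fun x => Rez (f x + g x)) = (fun x => Rez (f x)) \+ (fun x => Rez (g x)).
    by apply/funext => x; rewrite raddfD.
  exact: measurable_funD.
have -> : (fun x => Imz (f x + g x)) = (fun x => Imz (f x)) \+ (fun x => Imz (g x)).
  by apply/funext => x; rewrite raddfD.
exact: measurable_funD.
Qed.

Lemma cmeasM a b f g : cmeasurable a b f -> cmeasurable a b g ->
  cmeasurable a b (fun x => f x * g x).
Proof.
move=> [fr fi] [gr gi]; split.
  have -> : (fun x => Rez (f x * g x)) =
      ((fun x => Rez (f x)) \* (fun x => Rez (g x))) \-
      ((fun x => Imz (f x)) \* (fun x => Imz (g x))).
    by apply/funext => x; rewrite ReM.
  by apply: measurable_funB; exact: measurable_funM.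
have -> : (fun x => Imz (f x * g x)) =
    ((fun x => Rez (f x)) \* (fun x => Imz (g x))) \+
    ((fun x => Imz (f x)) \* (fun x => Rez (g x))).
  by apply/funext => x; rewrite ImM.
by apply: measurable_funD; exact: measurable_funM.
Qed.

Lemma cmeasR a b h : measurable_fun `[a, b] h -> cmeasurable a b (fun x => (h x)%:C%C).
Proof. by move=> mh; split => //; exact: measurable_cst. Qed.

Lemma cmeasZ a b (z : C) f : cmeasurable a b f -> cmeasurable a b (fun x => z * f x).
Proof. by move=> mf; apply: cmeasM => //; exact: cmeas_cst. Qed.

Lemma cmeasN a b f : cmeasurable a b f -> cmeasurable a b (fun x => - f x).
Proof.
by move=> /(cmeasZ (-1)); apply: cmeas_eq => x _; rewrite mulN1r.
Qed.

Lemma cmeasB a b f g : cmeasurable a b f -> cmeasurable a b g ->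
  cmeasurable a b (fun x => f x - g x).
Proof. by move=> mf /cmeasN; exact: cmeasD. Qed.

Lemma cmeas_sum a b (I : Type) (s : seq I) (F : I -> R -> C) :
  (forall i, cmeasurable a b (F i)) -> cmeasurable a b (fun x => \sum_(i <- s) F i x).
Proof.
move=> mF; elim: s => [|i s IH].
  by apply: (cmeas_eq _ (cmeas_cst a b 0)) => x _; rewrite big_nil.
by apply: (cmeas_eq _ (cmeasD (mF i) IH)) => x _; rewrite big_cons.
Qed.

Lemma cmeas_sub a b a' b' f : a <= a' -> b' <= b -> cmeasurable a b f -> cmeasurable a' b' f.
Proof.
move=> aa bb [fr fi].
have s : (`[a', b']%classic : set R) `<=` `[a, b].
  by move=> x /=; rewrite !in_itv/= => /andP[h1 h2]; rewrite (le_trans aa) ?(le_trans h2).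
by split; [apply: measurable_funS fr|apply: measurable_funS fi].
Qed.

Lemma meas_cmod a b f : cmeasurable a b f -> measurable_fun `[a, b] (fun x => cmod (f x)).
Proof.
move=> [fr fi].
have -> : (fun x => cmod (f x)) =
    Num.sqrt \o (fun x => Rez (f x) ^+ 2 + Imz (f x) ^+ 2).
  by apply/funext => x; rewrite cmodE.
have ms : measurable_fun [set: R] (@Num.sqrt R).
  by apply: continuous_measurable_fun; exact: sqrt_continuous.
apply: (measurableT_comp ms).
by apply: measurable_funD; exact: measurable_funX.
Qed.

Lemma meas_cmod2 a b f : cmeasurable a b f ->
  measurable_fun `[a, b] (fun x => cmod (f x) ^+ 2).
Proof. by move=> /meas_cmod mf; exact: measurable_funX. Qed.

Lemma integrable_dom (D : set R) h k : measurable D -> measurable_fun D h ->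
  (forall x, D x -> `|h x| <= k x) -> mu.-integrable D (EFin \o k) ->
  mu.-integrable D (EFin \o h).
Proof.
move=> mD mh hk; apply: le_integrable => //; first exact/measurable_EFinP.
move=> x Dx; rewrite /= lee_fin (le_trans (hk _ Dx))//; exact: ler_norm.
Qed.

Lemma in_L1_dom a b f h : cmeasurable a b f ->
  (forall x, a <= x <= b -> cmod (f x) <= h x) ->
  mu.-integrable `[a, b] (EFin \o h) -> in_L1 a b f.
Proof.
move=> mf fh ih; split => //.
apply: (integrable_dom _ _ _ ih) => //; first exact: meas_cmod.
by move=> x /=; rewrite in_itv/= => /fh; rewrite ger0_norm// cmod_ge0.
Qed.

Lemma in_L2_dom a b f h : cmeasurable a b f ->
  (forall x, a <= x <= b -> cmod (f x) ^+ 2 <= h x) ->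
  mu.-integrable `[a, b] (EFin \o h) -> in_L2 a b f.
Proof.
move=> mf fh ih; split => //.
apply: (integrable_dom _ _ _ ih) => //; first exact: meas_cmod2.
by move=> x /=; rewrite in_itv/= => /fh; rewrite ger0_norm// sqr_ge0.
Qed.

Lemma itgD (D : set R) h k : measurable D -> mu.-integrable D (EFin \o h) ->
  mu.-integrable D (EFin \o k) -> mu.-integrable D (EFin \o (fun x => h x + k x)).
Proof.
move=> mD ih ik.
by rewrite (_ : _ \o _ = (EFin \o h) \+ (EFin \o k))%E//; exact: integrableD.
Qed.

Lemma itgZ (D : set R) c h : measurable D -> mu.-integrable D (EFin \o h) ->
  mu.-integrable D (EFin \o (fun x => c * h x)).
Proof.
move=> mD ih; rewrite (_ : _ \o _ = (fun x => c%:E * (EFin \o h) x)%E)//.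
exact: integrableZl.
Qed.

Lemma itg_cst a b c : mu.-integrable `[a, b] (EFin \o (fun=> c)).
Proof.
apply: continuous_compact_integrable; first exact: segment_compact.
by apply: continuous_subspaceT => x; exact: cst_continuous.
Qed.

Lemma in_L1_ReIm a b f : in_L1 a b f <->
  mu.-integrable `[a, b] (EFin \o (fun x => Rez (f x))) /\
  mu.-integrable `[a, b] (EFin \o (fun x => Imz (f x))).
Proof.
split => [[mf fi]|[fr fi]].
  split; apply: (integrable_dom _ _ _ fi) => //.
  - by case: mf.
  - by move=> x _; exact: Re_le_cmod.
  - by case: mf.
  - by move=> x _; exact: Im_le_cmod.
have mr : measurable_fun `[a, b] (fun x => Rez (f x)) by have /measurable_EFinP := measurable_int _ fr.
have mi : measurable_fun `[a, b] (fun x => Imz (f x)) by have /measurable_EFinP := measurable_int _ fi.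
apply: (in_L1_dom (h := fun x => `|Rez (f x)| + `|Imz (f x)|)) => //.
  by move=> x _; exact: cmod_le_ReIm.
by apply: itgD => //; [exact: (integrable_norm fr)|exact: (integrable_norm fi)].
Qed.

Lemma in_L1D a b f g : in_L1 a b f -> in_L1 a b g -> in_L1 a b (fun x => f x + g x).
Proof.
move=> [mf fi] [mg gi]; apply: (in_L1_dom (h := fun x => cmod (f x) + cmod (g x))).
- exact: cmeasD.
- by move=> x _; exact: cmodD.
- exact: itgD.
Qed.

Lemma in_L1_bdM a b f g c : cmeasurable a b f ->
  (forall x, a <= x <= b -> cmod (f x) <= c) -> in_L1 a b g ->
  in_L1 a b (fun x => f x * g x).
Proof.
move=> mf fc [mg gi]; apply: (in_L1_dom (h := fun x => c * cmod (g x))).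
- exact: cmeasM.
- by move=> x xab; rewrite cmodM ler_wpM2r ?cmod_ge0// fc.
- exact: itgZ.
Qed.

Lemma in_L1Z a b (z : C) f : in_L1 a b f -> in_L1 a b (fun x => z * f x).
Proof. by apply: (in_L1_bdM (c := cmod z)); [exact: cmeas_cst|]. Qed.

Lemma in_L2D a b f g : in_L2 a b f -> in_L2 a b g -> in_L2 a b (fun x => f x + g x).
Proof.
move=> [mf fi] [mg gi].
apply: (in_L2_dom (h := fun x => 2 * cmod (f x) ^+ 2 + 2 * cmod (g x) ^+ 2)).
- exact: cmeasD.
- by move=> x _; exact: cmodD_sq.
- by apply: itgD => //; exact: itgZ.
Qed.

Lemma in_L2_bdM a b f g c : cmeasurable a b f ->
  (forall x, a <= x <= b -> cmod (f x) <= c) -> in_L2 a b g ->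
  in_L2 a b (fun x => f x * g x).
Proof.
move=> mf fc [mg gi]; apply: (in_L2_dom (h := fun x => c ^+ 2 * cmod (g x) ^+ 2)).
- exact: cmeasM.
- move=> x xab; rewrite cmodM exprMn ler_wpM2r ?sqr_ge0//.
  by rewrite lerXn2r ?nnegrE ?cmod_ge0 ?(le_trans (cmod_ge0 (f x)))// fc.
- exact: itgZ.
Qed.

Lemma in_L2Z a b (z : C) f : in_L2 a b f -> in_L2 a b (fun x => z * f x).
Proof. by apply: (@in_L2_bdM _ _ _ _ (cmod z)) => //; exact: cmeas_cst. Qed.

Lemma in_L2_bd a b f c : cmeasurable a b f ->
  (forall x, a <= x <= b -> cmod (f x) <= c) -> in_L2 a b f.
Proof.
move=> mf fc; apply: (in_L2_dom (h := fun=> c ^+ 2)) => //; last exact: itg_cst.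
move=> x xab.
by rewrite lerXn2r ?nnegrE ?cmod_ge0 ?(le_trans (cmod_ge0 (f x)))// fc.
Qed.

Lemma in_L2_L1 a b f : in_L2 a b f -> in_L1 a b f.
Proof.
move=> [mf fi]; apply: (in_L1_dom (h := fun x => 1 + cmod (f x) ^+ 2)) => //.
  by move=> x _; have := sqr_ge0 (cmod (f x) - 1); have := cmod_ge0 (f x); rewrite !expr2; lra.
by apply: itgD => //; exact: itg_cst.
Qed.

Lemma in_L2_eq a b f g : (forall x, a <= x <= b -> f x = g x) -> in_L2 a b f -> in_L2 a b g.
Proof.
move=> fg [mf fi]; split; first exact: cmeas_eq mf.
apply: eq_integrable fi => // x; rewrite inE/= in_itv/= => xab.
by rewrite (fg _ xab).
Qed.

Lemma in_L1_eq a b f g : (forall x, a <= x <= b -> f x = g x) -> in_L1 a b f -> in_L1 a b g.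
Proof.
move=> fg [mf fi]; split; first exact: cmeas_eq mf.
apply: eq_integrable fi => // x; rewrite inE/= in_itv/= => xab.
by rewrite (fg _ xab).
Qed.

Lemma in_L2B a b f g :
  in_L2 a b f -> in_L2 a b g -> in_L2 a b (fun x => f x - g x).
Proof.
move=> hf hg; have := in_L2D hf (in_L2Z (-1) hg).
by apply: in_L2_eq => x _; rewrite mulN1r.
Qed.

Lemma itg_ae a b h k : measurable_fun `[a, b] k -> mu.-integrable `[a, b] (EFin \o h) ->
  aein a b (fun x => h x = k x) -> mu.-integrable `[a, b] (EFin \o k).
Proof.
move=> mk ih hk; apply/integrableP; split; first exact/measurable_EFinP.
have mh := measurable_int _ ih.
have /integrableP[_] := ih; congr (_ < _)%E; apply: ge0_ae_eq_integral => //.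
- exact: measurableT_comp.
- by apply: measurableT_comp => //; exact/measurable_EFinP.
- by move/aein_cc : hk; apply: aeS => x H /H /= ->.
Qed.

Lemma in_L2_ae a b f g : cmeasurable a b g -> aein a b (fun x => f x = g x) ->
  in_L2 a b f -> in_L2 a b g.
Proof.
move=> mg fg [mf fi]; split => //; apply: (itg_ae _ fi); first exact: meas_cmod2.
by apply: aein_imp fg => x _ ->.
Qed.

Lemma in_L1_ae a b f g : cmeasurable a b g -> aein a b (fun x => f x = g x) ->
  in_L1 a b f -> in_L1 a b g.
Proof.
move=> mg fg [mf fi]; split => //; apply: (itg_ae _ fi); first exact: meas_cmod.
by apply: aein_imp fg => x _ ->.
Qed.

Lemma Rint_ae a b h k : measurable_fun `[a, b] h -> measurable_fun `[a, b] k ->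
  aein a b (fun x => h x = k x) ->
  \int[mu]_(x in `[a, b]) h x = \int[mu]_(x in `[a, b]) k x.
Proof.
move=> mh mk hk; rewrite /Rintegral; congr fine; apply: ae_eq_integral => //.
- exact/measurable_EFinP.
- exact/measurable_EFinP.
- by move/aein_cc : hk; apply: aeS => x H /H /= ->.
Qed.

Lemma Rint_le a b h k : mu.-integrable `[a, b] (EFin \o h) ->
  mu.-integrable `[a, b] (EFin \o k) -> aein a b (fun x => h x <= k x) ->
  \int[mu]_(x in `[a, b]) h x <= \int[mu]_(x in `[a, b]) k x.
Proof.
move=> ih ik hk; have mh : measurable_fun `[a, b] h by have /measurable_EFinP := measurable_int _ ih.
have mk : measurable_fun `[a, b] k by have /measurable_EFinP := measurable_int _ ik.
rewrite -subr_ge0 -RintegralB// (Rint_ae (k := fun x => `|k x - h x|)).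
- by apply: Rintegral_ge0.
- exact: measurable_funB.
- by apply: measurableT_comp => //; exact: measurable_funB.
- by apply: aein_imp hk => x _ hk; rewrite ger0_norm ?subr_ge0.
Qed.

End Lspaces.
#[global] Hint Resolve mitv : core.

(** * Calculus of absolutely continuous functions *)

Section RealACMore.
Variable R : realType.
Implicit Types (a b c : R) (f g : R -> R).

Lemma rAC_bounded a b f : a <= b -> rAC a b f ->
  exists M, forall x, a <= x <= b -> `|f x| <= M.
Proof.
move=> ab fAC; exists (`|f a| + (tvf a f b - tvf a f a)) => x /andP[ax xb].
have -> : f x = f a + (f x - f a) by ring.
apply: le_trans (ler_normD _ _) _; rewrite lerD2l.
apply: (le_trans (tvf_ge (lexx a) ax xb fAC)); rewrite lerD2r -subr_ge0.
exact: le_trans (tvf_ge ax xb (lexx b) fAC).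
Qed.

Lemma rACM a b f g : a <= b -> rAC a b f -> rAC a b g -> rAC a b (fun x => f x * g x).
Proof.
move=> ab fAC gAC.
have [M HM] := rAC_bounded ab fAC; have [N HN] := rAC_bounded ab gAC.
have M0 : 0 <= M by apply: le_trans (HM a _); rewrite ?lexx.
have N0 : 0 <= N by apply: le_trans (HN a _); rewrite ?lexx.
apply: (rAC_osc N0 M0 fAC gAC) => x y xab yab.
have -> : f y * g y - f x * g x = (f y - f x) * g y + f x * (g y - g x) by ring.
apply: le_trans (ler_normD _ _) _; rewrite !normrM lerD//.
  by rewrite mulrC ler_wpM2r// HN.
by rewrite ler_wpM2r// HM.
Qed.

Lemma rAC_inv a b f c : 0 < c -> (forall x, a <= x <= b -> c <= f x) -> rAC a b f ->
  rAC a b (fun x => (f x)^-1).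
Proof.
move=> c0 fc fAC; have ci : 0 <= c^-1 ^+ 2 by rewrite sqr_ge0.
apply: (rAC_osc ci (lexx 0) fAC fAC) => x y xab yab; rewrite mul0r addr0.
have fx := lt_le_trans c0 (fc _ xab); have fy := lt_le_trans c0 (fc _ yab).
have -> : (f y)^-1 - (f x)^-1 = (f y)^-1 * (f x)^-1 * - (f y - f x).
  by field; rewrite !gt_eqF.
rewrite normrM normrN ler_wpM2r// normrM !gtr0_norm ?invr_gt0// expr2.
by apply: ler_pM; rewrite ?invr_ge0 ?(ltW fx) ?(ltW fy)// lef_pV2 ?posrE// fc.
Qed.

Lemma rAC_cst a b c : rAC a b (fun=> c).
Proof.
move=> e e0; exists 1 => // s _ _ _; rewrite /osc big1// => p _.
by rewrite subrr normr0.
Qed.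

Lemma rAC_comp a b a' b' f (phi : R -> R) (M : R) : 0 < M ->
  (forall x, a <= x <= b -> a' <= phi x <= b') ->
  (forall x y, a <= x -> x <= y -> y <= b -> 0 <= phi y - phi x <= M * (y - x)) ->
  rAC a' b' f -> rAC a b (fun x => f (phi x)).
Proof.
move=> M0 phiab phiL fAC e e0; have [d d0 H] := fAC e e0.
exists (d / M); first by rewrite divr_gt0.
move=> s si sn; rewrite ltr_pdivlMr// => sl.
pose s' := [seq (phi p.1, phi p.2) | p <- s].
have -> : osc (fun x => f (phi x)) s = osc f s' by rewrite /osc big_map.
have phi_nd x y : a <= x -> x <= y -> y <= b -> phi x <= phi y.
  by move=> ax xy yb; rewrite -subr_ge0; have /andP[] := phiL x y ax xy yb.
apply: H.
- move=> _ /mapP[p ps ->]/=; have [h1 [h2 h3]] := si _ ps.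
  have /andP[-> _] : a' <= phi p.1 <= b' by rewrite phiab// h1 (le_trans h2).
  have /andP[_ ->] : a' <= phi p.2 <= b' by rewrite phiab// h3 (le_trans h1).
  by rewrite phi_nd.
- rewrite /nonoverlap pairwise_map.
  apply: (@sub_in_pairwise _ (mem s) _ _ _ s _ sn); last exact/allP.
  move=> p q /= ps qs; have [p1 [p2 p3]] := si _ ps; have [q1 [q2 q3]] := si _ qs.
  move=> /orP[h|h]; apply/orP; [left|right]; apply: phi_nd => //.
  - exact: le_trans p2.
  - exact: le_trans q3.
  - exact: le_trans q2.
  - exact: le_trans p3.
- apply: le_lt_trans sl; rewrite /len big_map mulr_suml big_seq [leRHS]big_seq.
  apply: ler_sum => p ps /=; have [h1 [h2 h3]] := si _ ps.
  by rewrite [leRHS]mulrC; have /andP[] := phiL _ _ h1 h2 h3.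
Qed.

End RealACMore.

Section ComplexDeriv.
Variable R : realType.
Local Notation C := R[i].
Implicit Types (x : R) (f g : R -> C) (d e z : C) (phi : R -> R).

(** A derivative of a complex-valued function of a real variable, taken
    componentwise as in the definition of is_aederiv. *)
Definition cder f x d :=
  is_derive x 1 (fun s => Rez (f s)) (Rez d) /\ is_derive x 1 (fun s => Imz (f s)) (Imz d).

Lemma cder_uniq f x d e : cder f x d -> cder f x e -> d = e.
Proof.
move=> [fr fi] [gr gi]; apply: ceqP.
  by rewrite -[LHS](@derive_val _ _ _ _ _ _ _ fr) -[RHS](@derive_val _ _ _ _ _ _ _ gr).
by rewrite -[LHS](@derive_val _ _ _ _ _ _ _ fi) -[RHS](@derive_val _ _ _ _ _ _ _ gi).
Qed.

Lemma cder_near f g x d : (\forall y \near x, f y = g y) -> cder f x d -> cder g x d.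
Proof.
move=> fg [fr fi]; split; [apply: is_derive_near fr|apply: is_derive_near fi];
  by apply: filterS fg => y ->.
Qed.

Lemma cder_cst z x : cder (fun=> z) x 0.
Proof. by split; exact: is_derive_cst. Qed.

Lemma cderD f g x d e : cder f x d -> cder g x e -> cder (fun s => f s + g s) x (d + e).
Proof.
move=> [fr fi] [gr gi]; split; rewrite raddfD.
  have := is_deriveD fr gr; congr is_derive; apply/funext => s /=.
  by rewrite raddfD.
have := is_deriveD fi gi; congr is_derive; apply/funext => s /=.
by rewrite raddfD.
Qed.

Lemma cderM f g x d e : cder f x d -> cder g x e ->
  cder (fun s => f s * g s) x (d * g x + f x * e).
Proof.
move=> [fr fi] [gr gi]; split.
  have ED : Rez (d * g x + f x * e) = (Rez (f x) *: Rez e + Rez (g x) *: Rez d) -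
     (Imz (f x) *: Imz e + Imz (g x) *: Imz d).
    by case: d {fr fi gr gi} => ? ?; case: e => ? ?; case: (f x) => ? ?;
      case: (g x) => ? ?; rewrite /GRing.scale/=; ring.
  rewrite ED; have := is_deriveB (is_deriveM fr gr) (is_deriveM fi gi).
  by congr is_derive; apply/funext => s /=; rewrite ReM.
have ED : Imz (d * g x + f x * e) = (Rez (f x) *: Imz e + Imz (g x) *: Rez d) +
   (Imz (f x) *: Rez e + Rez (g x) *: Imz d).
  by case: d {fr fi gr gi} => ? ?; case: e => ? ?; case: (f x) => ? ?;
    case: (g x) => ? ?; rewrite /GRing.scale/=; ring.
rewrite ED; have := is_deriveD (is_deriveM fr gi) (is_deriveM fi gr).
by congr is_derive; apply/funext => s /=; rewrite ImM.
Qed.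

Lemma cderZ f x d z : cder f x d -> cder (fun s => z * f s) x (z * d).
Proof.
by move=> fd; have := cderM (cder_cst z x) fd; rewrite mul0r add0r.
Qed.

Lemma cderN f x d : cder f x d -> cder (fun s => - f s) x (- d).
Proof.
move=> /(cderZ (-1)); rewrite mulN1r.
by have -> : (fun s => -1 * f s) = (fun s => - f s) by apply/funext => s; rewrite mulN1r.
Qed.

Lemma cderB f g x d e : cder f x d -> cder g x e -> cder (fun s => f s - g s) x (d - e).
Proof. by move=> fd /cderN; exact: cderD. Qed.

Lemma cder_comp f phi x d (k : R) : cder f (phi x) d -> is_derive x 1 phi k ->
  cder (fun s => f (phi s)) x (d * (k%:C)%C).
Proof.
move=> [fr fi] pk; split.
  rewrite ReM/= mulr0 subr0.
  exact: (is_derive1_comp fr pk).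
rewrite ImM/= mulr0 add0r.
exact: (is_derive1_comp fi pk).
Qed.

End ComplexDeriv.

Section ComplexAC.
Variable R : realType.
Local Notation C := R[i].
Local Notation mu := (@lebesgue_measure R).
Implicit Types (a b c x : R) (f g : R -> C).

Lemma in_ACE a b f : in_AC a b f <->
  rAC a b (fun x => Rez (f x)) /\ rAC a b (fun x => Imz (f x)).
Proof.
split => [fAC|[fr fi]].
  split => e e0; have [d d0 H] := fAC e e0; exists d => // s si sn sl;
    apply: le_lt_trans (H s si sn sl); apply: ler_sum => p _; rewrite -raddfB.
    exact: Re_le_cmod.
  exact: Im_le_cmod.
move=> e e0; have e2 : 0 < e / 2 by rewrite divr_gt0.
have [d1 d10 H1] := fr _ e2; have [d2 d20 H2] := fi _ e2.
exists (Num.min d1 d2); first by rewrite lt_min d10.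
move=> s si sn; rewrite lt_min => /andP[s1 s2].
have := H1 s si sn s1; have := H2 s si sn s2.
suff : \sum_(p <- s) cmod (f p.2 - f p.1) <=
   osc (fun x => Rez (f x)) s + osc (fun x => Imz (f x)) s by lra.
rewrite /osc -big_split/=; apply: ler_sum => p _; rewrite -!raddfB.
exact: cmod_le_ReIm.
Qed.

Lemma in_AC_eq a b f g : (forall x, a <= x <= b -> f x = g x) -> in_AC a b f -> in_AC a b g.
Proof.
move=> fg /in_ACE[fr fi]; apply/in_ACE; split.
  by apply: rAC_eq fr => x /fg ->.
by apply: rAC_eq fi => x /fg ->.
Qed.

Lemma in_ACD a b f g : in_AC a b f -> in_AC a b g -> in_AC a b (fun x => f x + g x).
Proof.
move=> /in_ACE[fr fi] /in_ACE[gr gi]; apply/in_ACE; split.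
  by apply: rAC_eq (rAC_lin 1 fr gr) => x _; rewrite mul1r raddfD.
by apply: rAC_eq (rAC_lin 1 fi gi) => x _; rewrite mul1r raddfD.
Qed.

Lemma in_ACM a b f g : a <= b -> in_AC a b f -> in_AC a b g -> in_AC a b (fun x => f x * g x).
Proof.
move=> ab /in_ACE[fr fi] /in_ACE[gr gi]; apply/in_ACE; split.
  apply: rAC_eq (rAC_lin (-1) (rACM ab fi gi) (rACM ab fr gr)) => x _.
  by rewrite ReM; ring.
apply: rAC_eq (rAC_lin 1 (rACM ab fr gi) (rACM ab fi gr)) => x _.
by rewrite ImM; ring.
Qed.

Lemma in_AC_cst a b (z : C) : in_AC a b (fun=> z).
Proof. by apply/in_ACE; split; exact: rAC_cst. Qed.

Lemma in_ACZ a b (z : C) f : a <= b -> in_AC a b f -> in_AC a b (fun x => z * f x).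
Proof. by move=> ab fAC; apply: in_ACM => //; exact: in_AC_cst. Qed.

Lemma in_ACN a b f : a <= b -> in_AC a b f -> in_AC a b (fun x => - f x).
Proof. by move=> ab /(in_ACZ (-1) ab); apply: in_AC_eq => x _; rewrite mulN1r. Qed.

Lemma in_ACB a b f g : a <= b -> in_AC a b f -> in_AC a b g -> in_AC a b (fun x => f x - g x).
Proof. by move=> ab fAC /(in_ACN ab); exact: in_ACD. Qed.

Lemma in_ACR a b (h : R -> R) : in_AC a b (fun x => (h x)%:C%C) <-> rAC a b h.
Proof.
by split => [/in_ACE[]//|hAC]; apply/in_ACE; split => //; exact: rAC_cst.
Qed.

Lemma in_AC_comp a b a' b' f (phi : R -> R) (M : R) : 0 < M ->
  (forall x, a <= x <= b -> a' <= phi x <= b') ->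
  (forall x y, a <= x -> x <= y -> y <= b -> 0 <= phi y - phi x <= M * (y - x)) ->
  in_AC a' b' f -> in_AC a b (fun x => f (phi x)).
Proof.
move=> M0 pab pL /in_ACE[fr fi]; apply/in_ACE; split.
  exact: (rAC_comp M0 pab pL fr).
exact: (rAC_comp M0 pab pL fi).
Qed.

Lemma in_AC_bd a b f : a <= b -> in_AC a b f ->
  exists M, forall x, a <= x <= b -> cmod (f x) <= M.
Proof.
move=> ab /in_ACE[fr fi].
have [M HM] := rAC_bounded ab fr; have [N HN] := rAC_bounded ab fi.
by exists (M + N) => x xab; rewrite (le_trans (cmod_le_ReIm _))// lerD ?HM ?HN.
Qed.

Lemma rAC_meas a b (h : R -> R) : rAC a b h -> measurable_fun `[a, b] h.
Proof.
move=> hAC; apply: subspace_continuous_measurable_fun => //.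
apply/subspace_continuousP => x /=; rewrite in_itv/= => xab.
apply/cvgrPdist_lt => e e0; have [d d0 H] := rAC_continuous hAC e0.
rewrite near_withinE; near=> y; rewrite /= in_itv/= => yab; apply: (H _ _ xab yab).
by near: y; exact: nbhsx_ballx.
Unshelve. all: by end_near. Qed.

Lemma in_AC_meas a b f : in_AC a b f -> cmeasurable a b f.
Proof. by move=> /in_ACE[? ?]; split; exact: rAC_meas. Qed.

Definition cint a b g : C :=
  Complex (\int[mu]_(x in `[a, b]) Rez (g x)) (\int[mu]_(x in `[a, b]) Imz (g x)).

Lemma aederiv_uniq a b f g g' : is_aederiv a b f g -> is_aederiv a b f g' ->
  aein a b (fun x => g x = g' x).
Proof. by move=> [_ H] [_]; apply: aein_imp2 H => x _; exact: cder_uniq. Qed.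

Lemma aederiv_eq a b f f' g g' : (forall x, a <= x <= b -> f x = f' x) ->
  cmeasurable a b g' -> aein a b (fun x => g x = g' x) ->
  is_aederiv a b f g -> is_aederiv a b f' g'.
Proof.
move=> ff mg' gg [mg H]; split => //; apply: aein_imp2 gg H => x xab ->.
apply: cder_near; near=> y; apply: ff.
by have /andP[? ?] : a < y < b; [near: y; exact: near_oo|rewrite !ltW].
Unshelve. all: by end_near. Qed.

(** Integrals of L1 functions are the absolutely continuous functions whose
    derivative is known, which is how solutions are constructed below. *)
Lemma int_AC a b f g : in_L1 a b g ->
  (forall x, a <= x <= b -> f x = f a + cint a x g) ->
  in_AC a b f /\ is_aederiv a b f g.
Proof.
move=> gL1 fE; have [mg _] := gL1; have [gr gi] := (in_L1_ReIm a b g).1 gL1.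
have fEr x : a <= x <= b -> Rez (f x) = Rez (f a) + \int[mu]_(t in `[a, x]) Rez (g t).
  by move=> /fE ->; rewrite raddfD.
have fEi x : a <= x <= b -> Imz (f x) = Imz (f a) + \int[mu]_(t in `[a, x]) Imz (g t).
  by move=> /fE ->; rewrite raddfD.
split; last first.
  by split => //; apply: aein_imp2 (int_derive gr fEr) (int_derive gi fEi).
apply/in_ACE; split.
  apply: rAC_eq (rAC_lin 1 (rAC_cst a b (Rez (f a))) (int_rAC gr)) => x /fEr ->.
  by rewrite mul1r.
apply: rAC_eq (rAC_lin 1 (rAC_cst a b (Imz (f a))) (int_rAC gi)) => x /fEi ->.
by rewrite mul1r.
Qed.

Lemma cint_ae a b g g' : cmeasurable a b g -> cmeasurable a b g' ->
  aein a b (fun x => g x = g' x) -> cint a b g = cint a b g'.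
Proof.
move=> [mr mi] [mr' mi'] gg; rewrite /cint; congr Complex; apply: Rint_ae => //;
  by apply: aein_imp gg => x _ ->.
Qed.

Lemma aein_sub a b a' b' (P : R -> Prop) : a <= a' -> b' <= b -> aein a b P -> aein a' b' P.
Proof.
move=> aa bb; apply: aeS => x H /andP[ax xb]; apply: H.
by rewrite (le_lt_trans aa) ?(lt_le_trans xb).
Qed.

(** The representative chosen by aederiv is the derivative, because a
    derivative exists: rAC_density provides one for the real and imaginary
    parts. *)
Lemma AC_aederiv a b f : a <= b -> in_AC a b f ->
  [/\ is_aederiv a b f (aederiv a b f), in_L1 a b (aederiv a b f) &
    forall x, a <= x <= b -> f x = f a + cint a x (aederiv a b f)].
Proof.
move=> ab /in_ACE[fr fi].
have [g1 [ig1 g1E]] := rAC_density ab fr; have [g2 [ig2 g2E]] := rAC_density ab fi.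
pose g x : C := Complex (g1 x) (g2 x).
have gL1 : in_L1 a b g.
  by apply/in_L1_ReIm; split; [exact: integrableS ig1|exact: integrableS ig2].
have fE x : a <= x <= b -> f x = f a + cint a x g.
  move=> xab; apply: ceqP; rewrite raddfD/=; [exact: g1E|exact: g2E].
have [_ fg] := int_AC gL1 fE.
have fd : is_aederiv a b f (aederiv a b f).
  by rewrite /aederiv; apply: xgetPex; exists g.
have gd := aederiv_uniq fg fd.
split => //; first by apply: in_L1_ae gL1 => //; case: fd.
move=> x xab; rewrite fE//; congr (_ + _); have /andP[ax xb] := xab.
apply: cint_ae.
- by apply: (@cmeas_sub _ a b) => //; case: gL1.
- by apply: (@cmeas_sub _ a b) => //; case: fd.
- exact: aein_sub gd.
Qed.

(** Passage from any derivative to the chosen representative. *)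
Lemma AC_aederivE a b f g : is_aederiv a b f g -> is_aederiv a b f (aederiv a b f) /\
  aein a b (fun x => aederiv a b f x = g x).
Proof.
move=> fg; have fd : is_aederiv a b f (aederiv a b f).
  by rewrite /aederiv; apply: xgetPex; exists g.
by split => //; exact: aederiv_uniq fg.
Qed.

(** Uniqueness for the initial value problem of the trivial equation: it
    identifies functions by their derivative and one value. *)
Lemma AC_eq a b f f' g : a <= b -> in_AC a b f -> in_AC a b f' -> f a = f' a ->
  is_aederiv a b f g -> is_aederiv a b f' g ->
  forall x, a <= x <= b -> f x = f' x.
Proof.
move=> ab fAC fAC' ff fg fg' x xab; have /andP[ax xb] := xab.
have [h1 _ ->//] := AC_aederiv ab fAC; have [h2 _ ->//] := AC_aederiv ab fAC'.
rewrite ff; congr (_ + _); apply: cint_ae.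
- by apply: (@cmeas_sub _ a b) => //; case: h1.
- by apply: (@cmeas_sub _ a b) => //; case: h2.
- apply: (aein_sub (lexx a) xb).
  by apply: aein_imp2 (aederiv_uniq h1 fg) (aederiv_uniq h2 fg') => y _ -> ->.
Qed.

Lemma L1_sub a b a' b' g : a <= a' -> b' <= b -> in_L1 a b g -> in_L1 a' b' g.
Proof.
move=> aa bb [mg ig]; split; first exact: cmeas_sub mg.
apply: integrableS ig => // x /=; rewrite !in_itv/= => /andP[h1 h2].
by rewrite (le_trans aa) ?(le_trans h2).
Qed.

(** The factor 2 comes from estimating real and imaginary parts separately. *)
Lemma cmod_cint a b g : in_L1 a b g ->
  cmod (cint a b g) <= 2 * \int[mu]_(x in `[a, b]) cmod (g x).
Proof.
move=> gL1; have [gr gi] := (in_L1_ReIm a b g).1 gL1; have [mg ig] := gL1.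
apply: (le_trans (cmod_le_ReIm _)); rewrite /= mulr2n mulrDl mul1r; apply: lerD.
  apply: (le_trans (le_normr_Rintegral _ gr)) => //.
  apply: Rint_le => //; first exact: integrable_norm gr.
  by apply: aein_all => x _; exact: Re_le_cmod.
apply: (le_trans (le_normr_Rintegral _ gi)) => //.
apply: Rint_le => //; first exact: integrable_norm gi.
by apply: aein_all => x _; exact: Im_le_cmod.
Qed.

Lemma cintB a b g g' : in_L1 a b g -> in_L1 a b g' ->
  cint a b g - cint a b g' = cint a b (fun x => g x - g' x).
Proof.
move=> /in_L1_ReIm[gr gi] /in_L1_ReIm[gr' gi'].
apply: ceqP; rewrite raddfB/= -RintegralB//; apply: eq_Rintegral => x _; by rewrite raddfB.
Qed.

Lemma AC_incr a b f s t : a <= s -> s <= t -> t <= b -> in_AC a b f ->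
  cmod (f t - f s) <= 2 * \int[mu]_(x in `[s, t]) cmod (aederiv a b f x).
Proof.
move=> as_ st tb fAC; have ab := le_trans as_ (le_trans st tb).
have [fd dL1 fE] := AC_aederiv ab fAC.
have -> : f t - f s = cint s t (aederiv a b f).
  have tab : a <= t <= b by rewrite (le_trans as_ st).
  have sab : a <= s <= b by rewrite as_ (le_trans st tb).
  rewrite (fE _ tab) (fE _ sab) opprD addrACA subrr add0r.
  have [gr gi] := (in_L1_ReIm a t _).1 (L1_sub (lexx a) tb dL1).
  have [gr' gi'] := (in_L1_ReIm s t _).1 (L1_sub as_ tb dL1).
  apply: ceqP; rewrite raddfB/= -?Rintegral_itvB ?bnd_simp//.
  - rewrite (Rintegral_itvB gr) ?bnd_simp// Rintegral_itv_obnd_cbnd//.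
    by apply: integrableS gr' => //; exact: subset_itv_oc_cc.
  - rewrite (Rintegral_itvB gi) ?bnd_simp// Rintegral_itv_obnd_cbnd//.
    by apply: integrableS gi' => //; exact: subset_itv_oc_cc.
apply: cmod_cint; exact: L1_sub dL1.
Qed.

Lemma aederD a b f g f' g' : is_aederiv a b f f' -> is_aederiv a b g g' ->
  is_aederiv a b (fun x => f x + g x) (fun x => f' x + g' x).
Proof.
move=> [mf df] [mg dg]; split; first exact: cmeasD.
by apply: aein_imp2 df dg => x _; exact: cderD.
Qed.

Lemma aederM a b f g f' g' : in_AC a b f -> in_AC a b g ->
  is_aederiv a b f f' -> is_aederiv a b g g' ->
  is_aederiv a b (fun x => f x * g x) (fun x => f' x * g x + f x * g' x).
Proof.
move=> fAC gAC [mf df] [mg dg]; split.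
  by apply: cmeasD; apply: cmeasM => //; exact: in_AC_meas.
by apply: aein_imp2 df dg => x _; exact: cderM.
Qed.

Lemma aederZ a b (z : C) f f' : is_aederiv a b f f' ->
  is_aederiv a b (fun x => z * f x) (fun x => z * f' x).
Proof.
move=> [mf df]; split; first exact: cmeasZ.
by apply: aein_imp df => x _; exact: cderZ.
Qed.

Lemma aederB a b f g f' g' : is_aederiv a b f f' -> is_aederiv a b g g' ->
  is_aederiv a b (fun x => f x - g x) (fun x => f' x - g' x).
Proof.
move=> [mf df] [mg dg]; split; first exact: cmeasB.
by apply: aein_imp2 df dg => x _; exact: cderB.
Qed.

End ComplexAC.

(** * Bi-Lipschitz changes of variable *)

Section MeasureComparison.
Import HBNNSimple.
Context d (T : measurableType d) (R : realType).
Local Open Scope ereal_scope.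

(** Simple functions reduce the comparison of integrals to that of the
    measures of level sets. *)
Lemma ge0_integral_measure_le (nu mu : {measure set T -> \bar R}) (M : R)
    (f : T -> \bar R) : (0 <= M)%R ->
  (forall A, measurable A -> nu A <= M%:E * mu A) -> (forall x, 0 <= f x) ->
  \int[nu]_x f x <= M%:E * \int[mu]_x f x.
Proof.
move=> M0 numu f0; rewrite !ge0_integralTE//.
apply: ge_ereal_sup => _ [h hf <-].
have step : M%:E * sintegral mu h <= M%:E * ereal_sup [set sintegral mu h |
    h in [set h : {nnsfun T >-> R} | forall x, (h x)%:E <= f x]].
  by apply: lee_wpmul2l; rewrite ?lee_fin//; apply: ereal_sup_ubound; exists h.
refine (le_trans _ step); rewrite !sintegralE.
rewrite !fsbig_finite//= ge0_sume_distrr; last first.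
  by move=> x _; case: (ltP x 0%R) => x0; [rewrite preimage_nnfun0 ?measure0 ?mule0|rewrite mule_ge0].
apply: lee_sum => x _; case: (ltP x 0%R) => x0.
  by rewrite preimage_nnfun0// !measure0 !mule0.
by rewrite muleCA; apply: lee_wpmul2l => //; rewrite ?lee_fin//; apply: numu.
Qed.

End MeasureComparison.

Section GlobalChange.
Variable R : realType.
Local Notation mu := (@lebesgue_measure R).
Variables (phi psi : R -> R) (M : R).
Hypothesis M0 : 0 < M.
Hypothesis phiK : cancel phi psi.
Hypothesis psiK : cancel psi phi.
Hypothesis phi_lip : forall x y, x <= y -> 0 <= phi y - phi x <= M * (y - x).
Hypothesis psi_lip : forall x y, x <= y -> 0 <= psi y - psi x <= M * (y - x).

Let phi_le x y : x <= y -> phi x <= phi y.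
Proof. by move=> /phi_lip /andP[]; rewrite subr_ge0. Qed.
Let psi_le x y : x <= y -> psi x <= psi y.
Proof. by move=> /psi_lip /andP[]; rewrite subr_ge0. Qed.

Let phi_lt x y : (x < phi y) = (psi x < y).
Proof.
apply/idP/idP => h; rewrite ltNge; apply/negP => h'.
  by move: (phi_le h'); rewrite psiK leNgt h.
by move: (psi_le h'); rewrite phiK leNgt h.
Qed.
Let phi_gt x y : (phi y <= x) = (y <= psi x).
Proof. by rewrite !leNgt phi_lt. Qed.

Let phi_cont : continuous phi.
Proof.
move=> x; apply/cvgrPdist_lt => e e0; near=> y.
have : `|x - y| < e / M by near: y; apply: cvgr_dist_lt => //; rewrite divr_gt0.
rewrite ltr_pdivlMr// => h; apply: le_lt_trans h.
case: (leP x y) => [xy|/ltW xy]; have /andP[h1 h2] := phi_lip xy.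
  by rewrite distrC (distrC x) !ger0_norm ?subr_ge0// ?phi_le// mulrC.
by rewrite !ger0_norm ?subr_ge0// ?phi_le// mulrC.
Unshelve. all: by end_near. Qed.

Lemma glob_meas : measurable_fun [set: R] phi.
Proof. exact: continuous_measurable_fun. Qed.

(** For a half-open interval the preimage is the interval between the images
    under psi, so the bound is the Lipschitz bound on psi; outer regularity
    extends it to Borel sets. This replaces a substitution formula. *)
Lemma glob_preimage_le (A : set R) : measurable A -> (mu (phi @^-1` A) <= M%:E * mu A)%E.
Proof.
move=> mA; rewrite -lee_pdivrMl//.
apply: le_ereal_inf_tmp => _ [F [mF AF] <-].
rewrite lee_pdivrMl//.
have mpre (B : set R) : measurable B -> measurable (phi @^-1` B).
  by move=> mB; rewrite -[X in measurable X]setTI; exact: glob_meas.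
have mFm k : measurable (F k : set R) by apply: sub_sigma_algebra; exact: mF.
apply: (@le_trans _ _ (\sum_(k <oo) mu (phi @^-1` F k))%E).
  apply: measure_sigma_subadditive.
  - by move=> k; exact: (mpre _ (mFm k)).
  - exact: mpre.
  - by move=> t /AF [k _ ?]; exists k.
rewrite -nneseriesZl; last first.
  by move=> k _; exact: wlength_ge0.
apply: lee_nneseries => [k _ //|k _].
have [[x y] _ <-] := mF k.
have -> : phi @^-1` (`]x, y]%classic) = `]psi x, psi y]%classic.
  by apply/seteqP; split => t /=; rewrite !in_itv/= phi_lt phi_gt.
case: (leP x y) => xy; last first.
  rewrite set_itv_ge ?measure0; last by rewrite bnd_simp -leNgt psi_le// ltW.
  by apply: mule_ge0; [rewrite lee_fin ltW|exact: wlength_ge0].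
rewrite [X in (_ <= _ * X)%E](_ : _ = (y - x)%:E); last first.
  exact: (wlength_itv_bnd idfun false false xy).
rewrite lebesgue_measure_itv/= lte_fin.
have /andP[h1 h2] := psi_lip xy.
by case: ltP => _; rewrite -?EFinD -?EFinM lee_fin// (le_trans h1).
Qed.

End GlobalChange.

Section LocalChange.
Variable R : realType.
Local Notation mu := (@lebesgue_measure R).
Local Notation C := R[i].

(** Both maps are constrained on their intervals only: the inverse of the
    change of variable of the theorem is arbitrary elsewhere. *)
Definition bilip (M a b c d : R) (phi psi : R -> R) : Prop :=
  [/\ forall x, a <= x <= b -> c <= phi x <= d /\ psi (phi x) = x,
      forall x, c <= x <= d -> a <= psi x <= b /\ phi (psi x) = x,
      forall x y, a <= x -> x <= y -> y <= b -> 0 <= phi y - phi x <= M * (y - x) &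
      forall x y, c <= x -> x <= y -> y <= d -> 0 <= psi y - psi x <= M * (y - x)].

Lemma bilip_sym M a b c d phi psi : bilip M a b c d phi psi -> bilip M c d a b psi phi.
Proof. by case. Qed.

Variables (M a b c d : R) (phi psi : R -> R).
Hypotheses (M0 : 0 < M) (ab : a <= b) (cd : c <= d) (H : bilip M a b c d phi psi).

Let phi_le x y : a <= x -> x <= y -> y <= b -> phi x <= phi y.
Proof. by case: H => _ _ h _ ax xy yb; rewrite -subr_ge0; have /andP[] := h x y ax xy yb. Qed.

Lemma bilip_a : phi a = c.
Proof.
have [h1 h2 h3 h4] := H.
have [/andP[pa pb] _] := h1 a (introT andP (conj (lexx a) ab)).
have [/andP[qa qb] qK] := h2 c (introT andP (conj (lexx c) cd)).
by apply/eqP; rewrite eq_le pa andbT -[leRHS]qK phi_le.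
Qed.

Lemma bilip_b : phi b = d.
Proof.
have [h1 h2 h3 h4] := H.
have [/andP[pa pb] _] := h1 b (introT andP (conj ab (lexx b))).
have [/andP[qa qb] qK] := h2 d (introT andP (conj cd (lexx d))).
by apply/eqP; rewrite eq_le pb/= -[leLHS]qK phi_le.
Qed.

Lemma bilip_oo x : a < x < b -> c < phi x < d.
Proof.
move=> /andP[ax xb]; have [h1 h2 h3 h4] := H.
have xab : a <= x <= b by rewrite !ltW.
have [/andP[pa pb] pK] := h1 x xab.
have [_ aK] := h1 a (introT andP (conj (lexx a) ab)).
have [_ bK] := h1 b (introT andP (conj ab (lexx b))).
rewrite !lt_neqAle pa pb !andbT; apply/andP; split; apply/eqP => e.
  by move: ax; rewrite -pK -e -bilip_a aK ltxx.
by move: xb; rewrite -pK e -bilip_b bK ltxx.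
Qed.

End LocalChange.

Section Extension.
Variable R : realType.
Local Notation mu := (@lebesgue_measure R).
Local Notation C := R[i].

(** Continuation with slope 1 outside [a, b], so that a change of variable
    between intervals becomes one of the whole line, where preimages of Borel
    sets need no restriction. *)
Definition extend (a b : R) (phi : R -> R) x := phi (clamp a b x) + (x - clamp a b x).

Lemma extend_id a b phi x : a <= x <= b -> extend a b phi x = phi x.
Proof. by move=> xab; rewrite /extend clamp_id// subrr addr0. Qed.

Lemma clamp_lt (a b x : R) : a <= b -> x <= a -> clamp a b x = a.
Proof. by move=> ab xa; rewrite /clamp (max_idPl xa) (min_idPr ab). Qed.
Lemma clamp_gt (a b x : R) : a <= b -> b <= x -> clamp a b x = b.
Proof. by move=> ab xb; rewrite /clamp (max_idPr (le_trans ab xb)) (min_idPl xb). Qed.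

Lemma extend_lip M a b phi x y : 0 < M -> a <= b ->
  (forall x y, a <= x -> x <= y -> y <= b -> 0 <= phi y - phi x <= M * (y - x)) ->
  x <= y -> 0 <= extend a b phi y - extend a b phi x <= (M + 1) * (y - x).
Proof.
move=> M0 ab h xy.
have /andP[ax xb] := clampP x ab; have /andP[ay yb] := clampP y ab.
have cxy := clamp_nd a b xy.
have /andP[h1 h2] := h _ _ ax cxy yb.
have := clamp_lip a b y x; rewrite !ger0_norm ?subr_ge0// => h3.
rewrite /extend; set p := phi _ in h1 h2 *; set q := phi _ in h1 h2 *.
set u := clamp _ _ _ in h2 h3 cxy *; set v := clamp _ _ _ in h2 h3 cxy *.
apply/andP; split; first by lra.
have : M * (u - v) <= M * (y - x) by rewrite ler_pM2l.
by nra.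
Qed.

(** The slope-1 continuations of inverse maps are inverse to each other
    because the endpoints correspond. *)
Lemma extendK M a b c d phi psi : 0 < M -> a <= b -> c <= d -> bilip M a b c d phi psi ->
  cancel (extend a b phi) (extend c d psi).
Proof.
move=> M0 ab cd H x.
have pa : phi a = c := bilip_a ab cd H.
have pb : phi b = d := bilip_b ab cd H.
have qa : psi c = a := bilip_a cd ab (bilip_sym H).
have qb : psi d = b := bilip_b cd ab (bilip_sym H).
have [h1 _ _ _] := H.
rewrite /extend; case: (leP x a) => xa.
  rewrite (clamp_lt ab xa) pa (@clamp_lt c d)//; last by lra.
  by rewrite qa; ring.
case: (leP x b) => xb; last first.
  rewrite (clamp_gt ab (ltW xb)) pb (@clamp_gt c d)//; last by lra.
  by rewrite qb; ring.
have xab : a <= x <= b by rewrite (ltW xa).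
have [pcd pK] := h1 _ xab.
by rewrite (clamp_id xab) subrr addr0 (clamp_id pcd) pK subrr addr0.
Qed.

Section Use.
Variables (M a b c d : R) (phi psi : R -> R).
Hypotheses (M0 : 0 < M) (ab : a <= b) (cd : c <= d) (H : bilip M a b c d phi psi).

Let P := extend a b phi.
Let Q := extend c d psi.
Let M1 : 0 < M + 1. Proof. by rewrite ltr_wpDr. Qed.
Let PK : cancel P Q := extendK M0 ab cd H.
Let QK : cancel Q P := extendK M0 cd ab (bilip_sym H).
Let Plip x y : x <= y -> 0 <= P y - P x <= (M + 1) * (y - x).
Proof. by apply: extend_lip => //; case: H. Qed.
Let Qlip x y : x <= y -> 0 <= Q y - Q x <= (M + 1) * (y - x).
Proof. by apply: extend_lip => //; case: H. Qed.

Let mP : measurable_fun [set: R] P := glob_meas M1 Plip.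

Let Pin x : (c <= P x <= d) = (a <= x <= b).
Proof.
have [h1 h2 _ _] := H.
apply/idP/idP => h.
  have [ha _] := h2 _ h; move: ha.
  by rewrite -(extend_id psi h) -/Q PK.
by rewrite /P extend_id//; have [] := h1 _ h.
Qed.

(** Nullity is transferred by glob_preimage_le for the extended map. *)
Lemma cov_ae (S : R -> Prop) : aein c d S -> aein a b (fun t => S (phi t)).
Proof.
move=> [N [mN N0 NS]]; exists (P @^-1` N); split.
- by rewrite -[X in measurable X]setTI; exact: mP.
- apply/eqP; rewrite eq_le measure_ge0 andbT.
  apply: (le_trans (glob_preimage_le M1 PK QK Plip Qlip mN)).
  by rewrite [mu N]N0 mule0.
- move=> t /= h; apply: NS => /= h'; apply: h => tab.
  have tab' : a <= t <= b by case/andP: tab => ? ?; rewrite !ltW.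
  move: h'; rewrite /P extend_id//; apply.
  exact: (bilip_oo ab cd H tab).
Qed.

Lemma cov_meas (f : R -> R) : measurable_fun `[c, d] f ->
  measurable_fun `[a, b] (fun t => f (phi t)).
Proof.
move=> mf; apply: (eq_measurable_fun (f \o P)) => [x|].
  by rewrite inE/= in_itv/= => xab; rewrite /P extend_id.
apply: (@measurable_comp _ _ _ _ _ _ `[c, d]%classic) => //.
  by move=> _ [x /= + <-]; rewrite !in_itv/= Pin.
exact: measurable_funTS.
Qed.

Lemma cov_cmeas (f : R -> C) : cmeasurable c d f -> cmeasurable a b (fun t => f (phi t)).
Proof. by move=> [fr fi]; split; [exact: (cov_meas fr)|exact: (cov_meas fi)]. Qed.

Lemma cov_int (f : R -> R) : measurable_fun `[c, d] f ->
  (\int[mu]_(t in `[a, b]) `|f (phi t)|%:E <= (M + 1)%:E * \int[mu]_(x in `[c, d]) `|f x|%:E)%E.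
Proof.
move=> mf; rewrite integral_mkcond [X in (_ * X)%E]integral_mkcond.
set h := ((fun x => `|f x|%:E) \_ `[c, d])%E.
have h0 x : (0 <= h x)%E by rewrite /h patchE; case: ifP; rewrite ?lee_fin.
have mh : measurable_fun setT h.
  apply/(measurable_restrictT _ _).1 => //; apply/measurable_EFinP.
  exact: measurableT_comp.
have -> : (\int[mu]_x ((fun t => `|f (phi t)|%:E) \_ `[a, b]) x =
    \int[mu]_x (h \o P) x)%E.
  apply: eq_integral => x _; rewrite /h /= !patchE !mem_setE !in_itv/= Pin.
  by case: ifP => // xab; rewrite /P extend_id.
pose RT := measurableTypeR R.
pose PM : {mfun RT >-> RT} := HB.pack P (isMeasurableFun.Build _ _ RT RT P mP).
pose nu : {measure set RT -> \bar R} := pushforward mu PM.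
have -> : (\int[mu]_x (h \o P) x = \int[nu mP]_x h x)%E.
  by rewrite (@ge0_integral_pushforward _ _ RT RT _ PM mP mu setT h).
apply: ge0_integral_measure_le => //; first exact: ltW.
by move=> A mA; exact: (glob_preimage_le M1 PK QK Plip Qlip).
Qed.

Lemma cov_itg (f : R -> R) : mu.-integrable `[c, d] (EFin \o f) ->
  mu.-integrable `[a, b] (EFin \o (fun t => f (phi t))).
Proof.
move=> /integrableP[mf fi]; have mf' : measurable_fun `[c, d] f by exact/measurable_EFinP.
apply/integrableP; split; first by apply/measurable_EFinP; exact: cov_meas.
apply: le_lt_trans (cov_int mf') _.
by apply: lte_mul_pinfty => //; rewrite lee_fin ltW.
Qed.

Lemma cov_Rint (f : R -> R) : mu.-integrable `[c, d] (EFin \o f) ->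
  (forall x, c <= x <= d -> 0 <= f x) ->
  \int[mu]_(t in `[a, b]) f (phi t) <= (M + 1) * \int[mu]_(x in `[c, d]) f x.
Proof.
move=> fi f0; have mf : measurable_fun `[c, d] f by have /measurable_EFinP := measurable_int _ fi.
rewrite -lee_fin EFinM !RintE//; last exact: cov_itg.
have := cov_int mf; congr (_ <= _ * _)%E.
  apply: eq_integral => t; rewrite inE/= in_itv/= => tab; rewrite ger0_norm//.
  by apply: f0; have [h1 _ _ _] := H; have [] := h1 _ tab.
by apply: eq_integral => t; rewrite inE/= in_itv/= => tab; rewrite ger0_norm// f0.
Qed.

Lemma cov_L1 (f : R -> C) : in_L1 c d f -> in_L1 a b (fun t => f (phi t)).
Proof.
by move=> [mf fi]; split; [exact: cov_cmeas|exact: cov_itg fi].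
Qed.

Lemma cov_L2 (f : R -> C) : in_L2 c d f -> in_L2 a b (fun t => f (phi t)).
Proof.
by move=> [mf fi]; split; [exact: cov_cmeas|exact: cov_itg fi].
Qed.

Lemma cov_AC (f : R -> C) : in_AC c d f -> in_AC a b (fun t => f (phi t)).
Proof.
have [h1 _ h3 _] := H; apply: (in_AC_comp M0) => //.
by move=> x /h1[].
Qed.

End Use.
End Extension.

(** * A Gronwall estimate *)

Section RealTools.
Variable R : realType.
Local Notation mu := (@lebesgue_measure R).
Implicit Types (a b : R) (h k g U : R -> R).

Lemma itg_meas a b h : mu.-integrable `[a, b] (EFin \o h) -> measurable_fun `[a, b] h.
Proof. by move=> ih; have /measurable_EFinP := measurable_int _ ih. Qed.

Lemma itg_sub a b a' b' h : a <= a' -> b' <= b -> mu.-integrable `[a, b] (EFin \o h) ->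
  mu.-integrable `[a', b'] (EFin \o h).
Proof.
move=> aa bb ih; apply: integrableS ih => // x /=; rewrite !in_itv/= => /andP[h1 h2].
by rewrite (le_trans aa) ?(le_trans h2).
Qed.

Lemma Rint_sub a b a' b' h : a <= a' -> b' <= b -> mu.-integrable `[a, b] (EFin \o h) ->
  (forall x, a <= x <= b -> 0 <= h x) ->
  \int[mu]_(x in `[a', b']) h x <= \int[mu]_(x in `[a, b]) h x.
Proof.
move=> aa bb ih h0; rewrite -lee_fin !RintE//; last exact: itg_sub ih.
apply: ge0_subset_integral => //.
- exact: measurable_int ih.
- move=> x /=; rewrite !in_itv/= => /andP[h1 h2].
  by rewrite (le_trans aa) ?(le_trans h2).
Qed.

Lemma itg_sum a b (I : Type) (s : seq I) (F : I -> R -> R) :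
  (forall i, mu.-integrable `[a, b] (EFin \o F i)) ->
  mu.-integrable `[a, b] (EFin \o (fun x => \sum_(i <- s) F i x)).
Proof.
move=> iF; elim: s => [|i s IH].
  apply: eq_integrable (itg_cst a b 0) => // x _.
  by rewrite /= big_nil.
apply: eq_integrable (itgD (mitv a b) (iF i) IH) => // x _.
by rewrite /= big_cons.
Qed.

Lemma itg_bdM a b h k (M : R) : measurable_fun `[a, b] h ->
  (forall x, a <= x <= b -> `|h x| <= M) -> mu.-integrable `[a, b] (EFin \o k) ->
  mu.-integrable `[a, b] (EFin \o (fun x => h x * k x)).
Proof.
move=> mh hM ik; apply: (integrable_dom (k := fun x => M * `|k x|)) => //.
- by apply: measurable_funM => //; exact: itg_meas.
- by move=> x /=; rewrite in_itv/= => /hM hx; rewrite normrM ler_wpM2r.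
- by apply: itgZ => //; exact: integrable_norm ik.
Qed.

Lemma Rint_cst01 (c : R) : \int[mu]_(x in `[(0:R), (1:R)]) c = c.
Proof.
have E : mu `[(0:R), (1:R)]%classic = 1%E.
  by rewrite lebesgue_measure_itv/= lte_fin ltr01 oppr0 adde0.
rewrite Rintegral_cst// [X in _ * fine X](_ : _ = 1%E) ?mulr1//.
Qed.

Lemma L2_abs_itg h : measurable_fun `[(0:R), (1:R)] h ->
  mu.-integrable `[(0:R), (1:R)] (EFin \o (fun x => h x ^+ 2)) ->
  mu.-integrable `[(0:R), (1:R)] (EFin \o (fun x => `|h x|)).
Proof.
move=> mh ih; apply: (integrable_dom (k := fun x => 1 + h x ^+ 2)) => //.
- exact: measurableT_comp.
- move=> x _; rewrite normr_id -(real_normK (num_real (h x))).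
  by have := sqr_ge0 (`|h x| - 1); have := normr_ge0 (h x); rewrite !expr2; lra.
- by apply: itgD => //; exact: itg_cst.
Qed.

Lemma L1_le_L2 h : measurable_fun `[(0:R), (1:R)] h ->
  mu.-integrable `[(0:R), (1:R)] (EFin \o (fun x => h x ^+ 2)) ->
  \int[mu]_(x in `[(0:R), (1:R)]) `|h x| <= Num.sqrt (\int[mu]_(x in `[(0:R), (1:R)]) h x ^+ 2).
Proof.
move=> mh ih.
have iah := L2_abs_itg mh ih; set m := \int[mu]_(x in _) `|h x|.
have m0 : 0 <= m by apply: Rintegral_ge0.
rewrite -[leLHS]ger0_norm// -sqrtr_sqr ler_wsqrtr//.
have : \int[mu]_(x in `[(0:R), (1:R)]) ((2 * m) * `|h x|) <=
    \int[mu]_(x in `[(0:R), (1:R)]) (m ^+ 2 + h x ^+ 2).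
  apply: Rint_le.
  - exact: itgZ.
  - by apply: itgD => //; exact: itg_cst.
  - apply: aein_all => x _; rewrite -(real_normK (num_real (h x))).
    by have := sqr_ge0 (`|h x| - m); rewrite !expr2; lra.
rewrite RintegralZl// RintegralD ?Rint_cst01//; last exact: itg_cst.
rewrite -/m expr2; nra.
Qed.

(** Used to identify limits from an estimate with a vanishing right-hand side. *)
Lemma le_cvg0_eq0 (c K : R) (e : nat -> R) : 0 <= c -> e @ \oo --> (0 : R) ->
  (forall n, c <= K * e n) -> c = 0.
Proof.
move=> c0 e0 H; apply/eqP; rewrite eq_le c0 andbT.
have h0 : (fun n => K * e n) @ \oo --> (0 : R).
  by rewrite -(mulr0 K); apply: cvgM => //; exact: cvg_cst.
rewrite -(cvg_lim _ h0)//; apply: limr_ge; last exact: nearW.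
by apply/cvg_ex; exists 0.
Qed.

(** The limit is produced together with its rate, as the supremum of the lower
    bounds u n - e n. *)
Lemma cauchy_lim (u e : nat -> R) :
  (forall n m, `|u n - u m| <= e n + e m) -> exists l, forall n, `|u n - l| <= e n.
Proof.
move=> H; pose E := [set u n - e n | n in setT].
have Eub n : ubound E (u n + e n).
  move=> _ [m _ <-]; have := H m n; rewrite ler_norml => /andP[_]; lra.
have E0 : E !=set0 by exists (u 0%N - e 0%N); exists 0%N.
exists (sup E) => n; rewrite ler_norml.
have h1 : sup E <= u n + e n by apply: ge_sup.
have h2 : u n - e n <= sup E.
  by apply: ub_le_sup; [exists (u 0%N + e 0%N); exact: Eub|exists n].
by apply/andP; split; lra.
Qed.

(** The inequality is only integral, so U is not differentiated. On an
    interval over which k integrates to less than 1/2, the supremum of U is at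
    most 2 (U s + G) for every s in it, where G is the integral of g.  By
    uniform continuity of the integral of k, N such intervals cover [0, 1],
    whence the constant 3 ^ N.  It depends on k alone, and the estimate runs in
    both directions from s. *)
Lemma gronwall k : mu.-integrable `[(0:R), (1:R)] (EFin \o k) -> (forall x, 0 <= k x) ->
  exists2 M, 0 <= M & forall U g, measurable_fun `[(0:R), (1:R)] U ->
    (exists B, forall x, 0 <= x <= 1 -> 0 <= U x <= B) ->
    mu.-integrable `[(0:R), (1:R)] (EFin \o g) -> (forall x, 0 <= g x) ->
    (forall s t, 0 <= s -> s <= t -> t <= 1 ->
      `|U t - U s| <= \int[mu]_(x in `[s, t]) (g x + k x * U x)) ->
    forall s t, 0 <= s <= 1 -> 0 <= t <= 1 ->
      U t <= M * (U s + \int[mu]_(x in `[(0:R), (1:R)]) g x).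
Proof.
move=> ik k0.
pose K x := \int[mu]_(t in `[0, x]) k t.
have h2 : 0 < 2^-1 :> R by rewrite invr_gt0.
have [d d0 Kd] := rAC_continuous (int_rAC ik) h2.
have Kint p q : 0 <= p -> p <= q -> q <= 1 -> \int[mu]_(x in `[p, q]) k x = K q - K p.
  move=> p0 pq q1; rewrite /K.
  have ikq : mu.-integrable `[0, q] (EFin \o k) by exact: itg_sub ik.
  rewrite (Rintegral_itvB ikq) ?bnd_simp// Rintegral_itv_obnd_cbnd//.
  apply: (integrableS _ _ _ (itg_sub p0 q1 ik)) => //; exact: subset_itv_oc_cc.
(* with steps of length 1 / N < d, each factor 3 bounds 2 (U + G) + G *)
pose N := Num.bound (2 / d).
have N0 : 0 < N%:R :> R.
  by apply: lt_trans (archi_boundP _); rewrite ?divr_gt0// ltW// divr_gt0.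
have Nd : N%:R^-1 < d.
  have : 2 / d < N%:R by apply: archi_boundP; rewrite ltW// divr_gt0.
  rewrite ltr_pdivrMr// => h; rewrite -[ltLHS]mul1r ltr_pdivrMr//; lra.
exists (3 ^+ N); first by rewrite exprn_ge0.
move=> U g mU [B UB] ig g0 HU; set G := \int[mu]_(x in _) g x.
have G0 : 0 <= G by apply: Rintegral_ge0.
have U0 x : 0 <= x <= 1 -> 0 <= U x by move=> /UB /andP[].
have ikU : mu.-integrable `[(0:R), (1:R)] (EFin \o (fun x => k x * U x)).
  have := itg_bdM mU _ ik => /(_ B) h.
  apply: eq_integrable (h _) => // [x _|x /UB /andP[Ux0 UxB]]; first by rewrite /= mulrC.
  by rewrite ger0_norm.
have local p q s t : 0 <= p -> p <= q -> q <= 1 -> q - p < d -> p <= s <= q -> p <= t <= q ->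
    U t <= 2 * (U s + G).
  move=> p0 pq q1 pqd spq tpq.
  have in01 x : p <= x <= q -> 0 <= x <= 1.
    by move=> /andP[h3 h4]; rewrite (le_trans p0)//= (le_trans h4).
  pose E := [set U x | x in `[p, q]%classic].
  have Eub : has_ubound E.
    by exists B => _ [x /= xpq <-]; rewrite in_itv/= in xpq; have /andP[] := UB _ (in01 _ xpq).
  have Um x : p <= x <= q -> U x <= sup E.
    by move=> xpq; apply: ub_le_sup => //; exists x => //=; rewrite in_itv.
  have m0 : 0 <= sup E by apply: le_trans (U0 _ (in01 _ spq)) (Um _ spq).
  have Kpq : K q - K p <= 2^-1.
    apply: le_trans (ler_norm _) _; apply: ltW; apply: Kd.
    - by rewrite (le_trans p0).
    - by rewrite p0 (le_trans pq).
    - by rewrite ger0_norm ?subr_ge0.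
  have est lo hi : p <= lo -> lo <= hi -> hi <= q ->
      `|U hi - U lo| <= G + sup E / 2.
    move=> plo lohi hiq; have lo0 := le_trans p0 plo; have hi1 := le_trans hiq q1.
    apply: (le_trans (HU _ _ lo0 lohi hi1)).
    apply: (@le_trans _ _ (\int[mu]_(x in `[lo, hi]) (g x + sup E * k x))).
      apply: Rint_le.
      - by apply: itgD => //; [exact: itg_sub ig|exact: itg_sub ikU].
      - by apply: itgD => //; [exact: itg_sub ig|apply: itgZ => //; exact: itg_sub ik].
      - apply: aein_all => x /andP[lx xh]; rewrite lerD2l mulrC ler_wpM2r// Um//.
        by rewrite (le_trans plo (ltW lx)) (le_trans (ltW xh) hiq).
    rewrite RintegralD//; last 2 first.
    - exact: itg_sub ig.
    - by apply: itgZ => //; exact: itg_sub ik.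
    apply: lerD; first by apply: Rint_sub.
    rewrite RintegralZl//; last exact: itg_sub ik.
    apply: ler_wpM2l => //; apply: le_trans Kpq; rewrite -Kint//.
    by apply: Rint_sub => //; exact: itg_sub ik.
  have ptw x : p <= x <= q -> U x <= U s + G + sup E / 2.
    move=> /andP[px xq]; move: spq => /andP[ps sq].
    have : `|U x - U s| <= G + sup E / 2.
      by case: (leP s x) => [sx|/ltW xs]; [exact: est|rewrite distrC; exact: est].
    by rewrite ler_norml => /andP[_]; lra.
  have : sup E <= U s + G + sup E / 2.
    apply: ge_sup; first by exists (U s), s => //=; rewrite in_itv.
    by move=> _ [x /= xpq <-]; apply: ptw; rewrite in_itv/= in xpq.
  have := Um _ tpq; lra.
have chain j s t : 0 <= s <= 1 -> 0 <= t <= 1 -> `|t - s| <= j%:R / N%:R ->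
    U t + G <= 3 ^+ j * (U s + G).
  elim: j t => [|j IH] t s01 t01.
    by rewrite mul0r normr_le0 subr_eq0 => /eqP ->; rewrite expr0 mul1r.
  move=> tsj.
  have [tsj'|tsj'] := leP `|t - s| (j%:R / N%:R).
    apply: (le_trans (IH _ s01 t01 tsj')); rewrite exprS -mulrA ler_peMl//.
      by rewrite mulr_ge0 ?exprn_ge0// addr_ge0// U0.
    by rewrite ler1n.
  have jn0 : 0 <= j%:R / N%:R :> R by rewrite divr_ge0// ltW.
  have Nj : j.+1%:R / N%:R = j%:R / N%:R + N%:R^-1 :> R.
    by rewrite -natr1 mulrDl mul1r.
  rewrite {}Nj in tsj.
  move: s01 t01 => /andP[s0 s1] /andP[t0 t1].
  pose r := if s <= t then s + j%:R / N%:R else s - j%:R / N%:R.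
  have [rs rt r01] : [/\ `|r - s| <= j%:R / N%:R, `|t - r| <= N%:R^-1 & 0 <= r <= 1].
    rewrite /r; move: tsj tsj'; case: (leP s t) => st.
      rewrite ger0_norm ?subr_ge0// => tsj tsj'; split.
      - by rewrite addrAC subrr add0r ger0_norm.
      - by rewrite ger0_norm; lra.
      - by apply/andP; split; lra.
    rewrite ltr0_norm ?subr_lt0// => tsj tsj'; split.
    - by rewrite addrAC subrr add0r normrN ger0_norm.
    - by rewrite ler0_norm; lra.
    - by apply/andP; split; lra.
  have := IH r; rewrite s0 s1 => /(_ isT r01 rs) Vr.
  have : U t <= 2 * (U r + G).
    move: rt r01 => rt /andP[r0 r1].
    case: (leP r t) rt => rt; [rewrite ger0_norm ?subr_ge0// => h|rewrite ltr0_norm ?subr_lt0// => h].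
      by apply: (local r t) => //; rewrite ?lexx ?rt//; lra.
    by apply: (local t r) => //; rewrite ?lexx ?(ltW rt)//; lra.
  have : 0 <= U r by apply: U0.
  by rewrite exprS; nra.
move=> s t s01 t01.
have : U t + G <= 3 ^+ N * (U s + G).
  apply: chain => //; rewrite divff ?gt_eqF//.
  move: s01 t01 => /andP[s0 s1] /andP[t0 t1].
  by rewrite ler_norml; apply/andP; split; lra.
by lra.
Qed.

End RealTools.

(** * Closedness of Dirac-type operators *)

Section MatrixNorms.
Variable R : realType.
Local Notation C := R[i].

Definition mnorm m n (A : 'M[C]_(m, n)) : R := \sum_i \sum_j cmod (A i j).

Lemma mnorm_ge0 m n (A : 'M[C]_(m, n)) : 0 <= mnorm A.
Proof. by apply: sumr_ge0 => i _; apply: sumr_ge0 => j _; exact: cmod_ge0. Qed.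

Lemma vnormE n (v : 'cV[C]_n) : mnorm v = \sum_i cmod (v i 0).
Proof. by apply: eq_bigr => i _; rewrite big_ord1. Qed.

Lemma vnorm_ge n (v : 'cV[C]_n) i : cmod (v i 0) <= mnorm v.
Proof.
rewrite vnormE (bigD1 i)//= lerDl; apply: sumr_ge0 => j _; exact: cmod_ge0.
Qed.

Lemma mnormD m n (A B : 'M[C]_(m, n)) : mnorm (A + B) <= mnorm A + mnorm B.
Proof.
rewrite /mnorm -big_split/=; apply: ler_sum => i _; rewrite -big_split/=.
by apply: ler_sum => j _; rewrite mxE cmodD.
Qed.

Lemma mnormZ m n (z : C) (A : 'M[C]_(m, n)) : mnorm (z *: A) = cmod z * mnorm A.
Proof.
rewrite /mnorm mulr_sumr; apply: eq_bigr => i _; rewrite mulr_sumr.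
by apply: eq_bigr => j _; rewrite mxE cmodM.
Qed.

Lemma mnormN m n (A : 'M[C]_(m, n)) : mnorm (- A) = mnorm A.
Proof. by apply: eq_bigr => i _; apply: eq_bigr => j _; rewrite mxE cmodN. Qed.

Lemma mnormM m n (A : 'M[C]_(m, n)) (v : 'cV[C]_n) : mnorm (A *m v) <= mnorm A * mnorm v.
Proof.
rewrite (vnormE (A *m v)) /mnorm mulr_suml; apply: ler_sum => i _.
rewrite mxE (le_trans (cmod_sum _ _))// mulr_suml; apply: ler_sum => j _.
by rewrite cmodM ler_wpM2l ?cmod_ge0// vnorm_ge.
Qed.

End MatrixNorms.

(** Components of a vector are handled one at a time; a finite union of null
    sets is null. *)
Lemma aein_forall (R : realType) (I : finType) (a b : R) (P : I -> R -> Prop) :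
  (forall i, aein a b (P i)) -> aein a b (fun x => forall i, P i x).
Proof.
move=> H; have h : forall s : seq I, aein a b (fun x => forall i, i \in s -> P i x).
  elim => [|i s IH]; first exact: aein_all.
  apply: aein_imp2 (H i) IH => x _ Pi Ps j; rewrite inE => /orP[/eqP -> //|]; exact: Ps.
by apply: aein_imp (h (enum I)) => x _ Px i; apply: Px; rewrite mem_enum.
Qed.

Section L2.
Variables (R : realType) (n : nat).
Local Notation C := R[i].
Local Notation mu := (@lebesgue_measure R).
Implicit Types (x y : R -> 'cV[C]_n).

Lemma sqrt_quasi (A B S : R) : 0 <= A -> 0 <= B -> S <= 2 * A + 2 * B ->
  Num.sqrt S <= 2 * (Num.sqrt A + Num.sqrt B).
Proof.
move=> A0 B0 h; have sA := sqrtr_ge0 A; have sB := sqrtr_ge0 B.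
rewrite -[leRHS]ger0_norm; last by rewrite mulr_ge0// addr_ge0.
rewrite -sqrtr_sqr ler_wsqrtr//; apply: (le_trans h).
rewrite -{1}(sqr_sqrtr A0) -{1}(sqr_sqrtr B0) !expr2; nra.
Qed.

Definition L2sq y := \int[mu]_(t in `[0%R, 1%R]) \sum_i cmod (y t i 0) ^+ 2.

Lemma L2_itg y : snvec (y : L2space R n) ->
  mu.-integrable `[(0:R), (1:R)] (EFin \o (fun t => \sum_i cmod (y t i 0) ^+ 2)).
Proof. by move=> hy; apply: itg_sum => i; have [_] := hy i. Qed.

Lemma L2sq_ge0 y : 0 <= L2sq y.
Proof.
by apply: Rintegral_ge0 => t _; apply: sumr_ge0 => i _; exact: sqr_ge0.
Qed.

Lemma L2_qsn : quasi_seminormed (L2space R n).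
Proof.
split.
- move=> i; have h : in_L2 0 1 (fun _ : R => 0 : C).
    by apply: (@in_L2_bd _ _ _ _ 0) => [|t _]; [exact: cmeas_cst|rewrite cmod0].
  by apply: (in_L2_eq _ h) => t _; rewrite /coordf mxE.
- move=> c x y hx hy i.
  apply: (in_L2_eq _ (in_L2D (in_L2Z c (hx i)) (hy i))) => t _.
  by rewrite /coordf !mxE.
- by move=> x; exact: sqrtr_ge0.
- rewrite /snorm/= (_ : Rintegral _ _ _ = 0) ?sqrtr0//.
  under eq_Rintegral => t _.
    under eq_bigr => i _ do rewrite mxE cmod0 expr0n/=.
    rewrite big1//; over.
  exact: Rint_cst01.
- move=> x hx; rewrite /snorm/=; congr Num.sqrt; apply: eq_Rintegral => t _.
  by apply: eq_bigr => i _; rewrite mxE cmodN.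
- move=> x y hx hy; apply: sqrt_quasi; [exact: L2sq_ge0|exact: L2sq_ge0|].
  have ix := L2_itg hx; have iy := L2_itg hy.
  rewrite -RintegralZl// -RintegralZl// -RintegralD//; [|exact: itgZ..].
  apply: Rint_le.
  + apply: itg_sum => i.
    have [_ h] := in_L2D (hx i) (hy i).
    by apply: eq_integrable h => // t _; rewrite /coordf /= mxE.
  + by apply: itgD => //; exact: itgZ.
  + apply: aein_all => t _; rewrite !mulr_sumr -big_split/=; apply: ler_sum => i _.
    by rewrite mxE cmodD_sq.
Qed.

Lemma L2_eqv x y : snvec (x : L2space R n) -> snvec (y : L2space R n) ->
  aein 0 1 (fun t => x t = y t) -> @eqv _ (L2space R n) x y.
Proof.
move=> hx hy xy; split => //; rewrite /snorm/= (_ : Rintegral _ _ _ = 0) ?sqrtr0//.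
have hxy : snvec (x - y : L2space R n) := qsn_vecB L2_qsn hx hy.
rewrite -[RHS](Rint_cst01 0); apply: Rint_ae.
- exact: itg_meas (L2_itg hxy).
- exact: measurable_cst.
- apply: aein_imp xy => t _ xy; rewrite big1// => i _.
  by rewrite !mxE xy subrr cmod0 expr0n.
Qed.

Lemma mnorm_meas x : (forall i, cmeasurable 0 1 (coordf x i)) ->
  measurable_fun `[(0:R), (1:R)] (fun t => mnorm (x t)).
Proof.
move=> mx; have -> : (fun t => mnorm (x t)) = (fun t => \sum_i cmod (x t i 0)).
  by apply/funext => t; rewrite vnormE.
by apply: measurable_sum => i; exact: meas_cmod (mx i).
Qed.

Lemma mnorm_itg x : (forall i, in_L1 0 1 (coordf x i)) ->
  mu.-integrable `[(0:R), (1:R)] (EFin \o (fun t => mnorm (x t))).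
Proof.
move=> hx; have -> : (fun t => mnorm (x t)) = (fun t => \sum_i cmod (x t i 0)).
  by apply/funext => t; rewrite vnormE.
by apply: itg_sum => i; have [_] := hx i.
Qed.

(** The sum of moduli is at most n times the Euclidean norm, whose L1 norm on
    [0, 1] is at most its L2 norm. *)
Lemma mnorm_L2 x : snvec (x : L2space R n) ->
  \int[mu]_(t in `[0%R, 1%R]) mnorm (x t) <= n%:R * snorm (x : L2space R n).
Proof.
move=> hx; pose e (t : R) : R := Num.sqrt (\sum_i cmod (x t i 0) ^+ 2).
have e2 t : e t ^+ 2 = \sum_i cmod (x t i 0) ^+ 2.
  by rewrite sqr_sqrtr//; apply: sumr_ge0 => i _; exact: sqr_ge0.
have e0 t : 0 <= e t by exact: sqrtr_ge0.
have me : measurable_fun `[(0:R), (1:R)] e.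
  have ms : measurable_fun [set: R] (@Num.sqrt R).
    by apply: continuous_measurable_fun; exact: sqrt_continuous.
  by apply: (measurableT_comp ms); exact: itg_meas (L2_itg hx).
have ie : mu.-integrable `[(0:R), (1:R)] (EFin \o (fun t => e t ^+ 2)).
  by apply: eq_integrable (L2_itg hx) => // t _; rewrite /= e2.
have h := L1_le_L2 me ie.
have ie1 := L2_abs_itg me ie.
apply: (@le_trans _ _ (\int[mu]_(t in `[0%R, 1%R]) (n%:R * `|e t|))); last first.
  rewrite RintegralZl//; apply: ler_wpM2l => //; apply: (le_trans h).
  by rewrite le_eqVlt; apply/orP; left; apply/eqP; congr Num.sqrt; apply: eq_Rintegral.
apply: Rint_le.
- by apply: mnorm_itg => i; exact: in_L2_L1.
- exact: itgZ.
- apply: aein_all => t _; rewrite ger0_norm// vnormE.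
  have -> : n%:R * e t = \sum_(i < n) e t by rewrite sumr_const card_ord mulr_natl.
  apply: ler_sum => i _; rewrite -[leLHS]ger0_norm ?cmod_ge0// -sqrtr_sqr ler_wsqrtr//.
  rewrite (bigD1 i)//= lerDl; apply: sumr_ge0 => j _; exact: sqr_ge0.
Qed.

End L2.

Lemma cvg0Z (R : realType) (c : R) (u : nat -> R) : u @ \oo --> (0 : R) ->
  (fun k => c * u k) @ \oo --> (0 : R).
Proof. by move=> u0; rewrite -(mulr0 c); apply: cvgM => //; exact: cvg_cst. Qed.

Lemma cvg0D (R : realType) (u v : nat -> R) : u @ \oo --> (0 : R) -> v @ \oo --> (0 : R) ->
  (fun k => u k + v k) @ \oo --> (0 : R).
Proof. by move=> u0 v0; rewrite -[0]addr0; exact: cvgD. Qed.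

Lemma lin_combine (R : realType) (I J c N a b : R) : I <= N * a -> J <= N * b ->
  0 <= c -> 0 <= N -> 0 <= a -> 0 <= b -> I + c * J <= (N + c * N) * (a + b).
Proof.
move=> hI hJ c0 N0 a0 b0.
have h1 : c * J <= c * (N * b) by apply: ler_wpM2l.
have h2 : 0 <= N * b by apply: mulr_ge0.
have h3 : 0 <= c * (N * a) by apply: mulr_ge0 => //; exact: mulr_ge0.
have -> : (N + c * N) * (a + b) = N * a + N * b + c * (N * a) + c * (N * b) by ring.
lra.
Qed.

Section Dirac.
Variables (R : realType) (n : nat).
Local Notation C := R[i].
Local Notation mu := (@lebesgue_measure R).
Implicit Types (u w : R -> 'cV[C]_n).
Variables (B C0 D : 'M[C]_n) (Q : R -> 'M[C]_n).
Hypothesis Bu : B \in unitmx.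
Hypothesis QL1 : forall i j, in_L1 0 1 (fun t => Q t i j).

Definition dirac_rhs u w t : 'cV[C]_n := 'i%C *: (B *m (w t - Q t *m u t)).

(** The relation [w = -i B^-1 u' + Q u] solved for [u'].  It determines [w] only
    almost everywhere, so unlike the graph of the operator it is stable under a
    change of representative of [w]. *)
Definition dirac_ode u w : Prop :=
  [/\ forall i, in_AC 0 1 (coordf u i), snvec (w : L2space R n) &
    forall i, is_aederiv 0 1 (coordf u i) (coordf (dirac_rhs u w) i)].

Definition dirac_expr u t := (- 'i%C) *: (invmx B *m vderiv 0 1 u t) + Q t *m u t.

Lemma rhs_expr u t : dirac_rhs u (dirac_expr u) t = vderiv 0 1 u t.
Proof.
rewrite /dirac_rhs /dirac_expr addrK -scalemxAr mulmxA mulmxV// mul1mx scalerA.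
by rewrite mulrN -expr2 sqr_i opprK scale1r.
Qed.

Lemma expr_rhs u w t : vderiv 0 1 u t = dirac_rhs u w t -> dirac_expr u t = w t.
Proof.
rewrite /dirac_expr => ->; rewrite /dirac_rhs -scalemxAr mulmxA mulVmx// mul1mx scalerA.
by rewrite mulNr -expr2 sqr_i opprK scale1r subrK.
Qed.

Lemma rhs_meas u w : (forall i, cmeasurable 0 1 (coordf u i)) ->
  (forall i, cmeasurable 0 1 (coordf w i)) ->
  forall i, cmeasurable 0 1 (coordf (dirac_rhs u w) i).
Proof.
move=> mu_ mw i.
have mQu j : cmeasurable 0 1 (fun t => \sum_k Q t j k * u t k 0).
  apply: (@cmeas_sum _ _ _ _ _ (fun k t => Q t j k * u t k 0)) => k.
  by apply: cmeasM; [have [] := QL1 j k|exact: mu_].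
apply: (@cmeas_eq _ _ _ (fun t => 'i%C * \sum_j B i j * (w t j 0 - \sum_k Q t j k * u t k 0))).
  by move=> t _; rewrite /coordf !mxE; congr (_ * _); apply: eq_bigr => j _; rewrite !mxE.
apply: cmeasZ; apply: (@cmeas_sum _ _ _ _ _ (fun j t => B i j * _)) => j.
by apply: cmeasZ; apply: cmeasB => //; exact: mw.
Qed.

Lemma expr_meas u : (forall i, in_AC 0 1 (coordf u i)) ->
  forall i, cmeasurable 0 1 (coordf (dirac_expr u) i).
Proof.
move=> uAC i.
apply: (@cmeas_eq _ _ _ (fun t => (- 'i%C) * \sum_j invmx B i j * aederiv 0 1 (coordf u j) t
   + \sum_j Q t i j * u t j 0)).
  move=> t _; rewrite /coordf !mxE; congr (_ * _ + _).
  by apply: eq_bigr => j _; rewrite !mxE.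
apply: cmeasD.
  apply: cmeasZ; apply: (@cmeas_sum _ _ _ _ _ (fun j t => invmx B i j * _)) => j.
  by apply: cmeasZ; have [[]] := AC_aederiv ler01 (uAC j).
apply: (@cmeas_sum _ _ _ _ _ (fun k t => Q t i k * u t k 0)) => k.
by apply: cmeasM; [have [] := QL1 i k|exact: in_AC_meas (uAC k)].
Qed.

Lemma ode_of_dirac u w : dirac_operator B C0 D Q u w -> dirac_ode u w.
Proof.
move=> [uW wL2 _ ->]; split => //; first by move=> i; have [] := uW i.
move=> i; have [uAC _] := uW i; have [ud _ _] := AC_aederiv ler01 uAC.
have -> : coordf (dirac_rhs u (dirac_expr u)) i = aederiv 0 1 (coordf u i) => //.
by apply/funext => t; rewrite /coordf rhs_expr mxE.
Qed.

Lemma dirac_of_ode u w : dirac_ode u w -> C0 *m u 0 + D *m u 1 = 0 ->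
  exists w', dirac_operator B C0 D Q u w' /\ @eqv _ (L2space R n) w w'.
Proof.
move=> [uAC wL2 ud] bc; exists (dirac_expr u).
have E : aein 0 1 (fun t => w t = dirac_expr u t).
  have : aein 0 1 (fun t => forall i, aederiv 0 1 (coordf u i) t = coordf (dirac_rhs u w) i t).
    by apply: aein_forall => i; exact: (AC_aederivE (ud i)).2.
  apply: aein_imp => t _ ht; apply/esym/expr_rhs.
  by apply/colP => i; rewrite mxE ht.
have h2 : snvec (dirac_expr u : L2space R n).
  move=> i; apply: in_L2_ae (wL2 i); first exact: expr_meas.
  by apply: aein_imp E => t _; rewrite /coordf => ->.
split; last exact: L2_eqv.
split => // i; split => //.
by have [_] := AC_aederiv ler01 (uAC i).
Qed.

Let cQ t := mnorm B * mnorm (Q t).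

Lemma cQ_itg : mu.-integrable `[(0:R), (1:R)] (EFin \o cQ).
Proof.
apply: itgZ => //; apply: itg_sum => i; apply: itg_sum => j.
by have [_] := QL1 i j.
Qed.

Lemma rhs_le u w t : mnorm (dirac_rhs u w t) <= mnorm B * mnorm (w t) + cQ t * mnorm (u t).
Proof.
rewrite /dirac_rhs mnormZ cmod_i mul1r (le_trans (mnormM _ _))// /cQ -mulrA -mulrDr.
apply: ler_wpM2l; first exact: mnorm_ge0.
by rewrite (le_trans (mnormD _ _))// mnormN lerD2l mnormM.
Qed.

Lemma rhsB u w u' w' t :
  dirac_rhs (fun t => u t - u' t) (fun t => w t - w' t) t = dirac_rhs u w t - dirac_rhs u' w' t.
Proof.
rewrite /dirac_rhs -scalerBr -mulmxBr; congr (_ *: (_ *m _)).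
by rewrite mulmxBr !opprD !opprK !addrA; congr (_ + _); rewrite addrAC.
Qed.

Lemma dirac_ode_sub (u w u' w' : L2space R n) : dirac_ode u w -> dirac_ode u' w' ->
  dirac_ode (u - u') (w - w').
Proof.
move=> [uAC wL2 ud] [uAC' wL2' ud']; split.
- move=> i; have := in_ACB ler01 (uAC i) (uAC' i); apply: in_AC_eq => t _.
  by rewrite /coordf !mxE.
- exact: (qsn_vecB (L2_qsn R n)).
- move=> i; have := aederB (ud i) (ud' i).
  congr is_aederiv; apply/funext => t.
    by rewrite /coordf !mxE.
  have -> : coordf (dirac_rhs (u - u') (w - w')) i t = (dirac_rhs u w t - dirac_rhs u' w' t) i 0.
    by rewrite -rhsB.
  by rewrite /coordf !mxE.
Qed.

(** Gronwall bounds every value of u by any other one plus the L1 norm of w;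
    integrating over the other point gives the L1 norm of u, and on [0, 1] L1
    norms are controlled by L2 norms. *)
Lemma dirac_sup : exists2 M, 0 <= M & forall u w, dirac_ode u w ->
  forall t, 0 <= t <= 1 ->
    mnorm (u t) <= M * (snorm (u : L2space R n) + snorm (w : L2space R n)).
Proof.
(* 2 from the real and imaginary parts, n from the sum over the components *)
pose k t := 2 * n%:R * cQ t.
have ik : mu.-integrable `[(0:R), (1:R)] (EFin \o k) by apply: itgZ => //; exact: cQ_itg.
have k0 t : 0 <= k t by rewrite !mulr_ge0// mnorm_ge0.
have [M M0 HM] := gronwall ik k0.
exists (M * (n%:R + 2 * n%:R * mnorm B * n%:R)).
  by rewrite mulr_ge0// addr_ge0// !mulr_ge0// mnorm_ge0.
move=> u w [uAC wL2 ud] t t01.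
have uL2 : snvec (u : L2space R n).
  move=> i; have [b ub] := in_AC_bd ler01 (uAC i).
  by apply: in_L2_bd ub; exact: in_AC_meas.
pose U t := mnorm (u t); pose g t := 2 * n%:R * mnorm B * mnorm (w t).
have mU : measurable_fun `[(0:R), (1:R)] U by apply: mnorm_meas => i; exact: in_AC_meas.
have iU : mu.-integrable `[(0:R), (1:R)] (EFin \o U) by apply: mnorm_itg => i; exact: in_L2_L1.
have iw : mu.-integrable `[(0:R), (1:R)] (EFin \o (fun t => mnorm (w t))).
  by apply: mnorm_itg => i; exact: in_L2_L1.
have ig : mu.-integrable `[(0:R), (1:R)] (EFin \o g) by exact: itgZ.
have g0 s : 0 <= g s by rewrite !mulr_ge0// mnorm_ge0.
have bU : exists b, forall x, 0 <= x <= 1 -> 0 <= U x <= b.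
  have /choice[b bP] i := in_AC_bd ler01 (uAC i).
  exists (\sum_i b i) => x x01; rewrite mnorm_ge0/= /U vnormE.
  by apply: ler_sum => i _; exact: bP.
have icQU : mu.-integrable `[(0:R), (1:R)] (EFin \o (fun t => cQ t * mnorm (u t))).
  have [b Hb] := bU; have := itg_bdM mU _ cQ_itg => /(_ b) h.
  apply: eq_integrable (h _) => // [x _|x /Hb /andP[Ux0 UxB]]; first by rewrite /= mulrC.
  by rewrite ger0_norm.
have HU s r : 0 <= s -> s <= r -> r <= 1 ->
   `|U r - U s| <= \int[mu]_(x in `[s, r]) (g x + k x * U x).
  move=> s0 sr r1; apply: (@le_trans _ _ (\sum_i cmod (coordf u i r - coordf u i s))).
    have h (a b : 'cV[C]_n) : mnorm a - mnorm b <= \sum_i cmod (a i 0 - b i 0).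
      have -> : \sum_i cmod (a i 0 - b i 0) = mnorm (a - b).
        by rewrite vnormE; apply: eq_bigr => i _; rewrite !mxE.
      by rewrite lerBlDr -{1}(subrK b a) mnormD.
    rewrite ler_norml h andbT lerNl opprB (le_trans (h _ _))// le_eqVlt.
    by apply/orP; left; apply/eqP; apply: eq_bigr => i _; rewrite cmodB.
  pose hh x := mnorm B * mnorm (w x) + cQ x * mnorm (u x).
  have ihh : mu.-integrable `[s, r] (EFin \o hh).
    by apply: itgD => //; [apply: itgZ => //; exact: itg_sub iw|exact: itg_sub icQU].
  apply: (@le_trans _ _ (\sum_(i < n) 2 * \int[mu]_(x in `[s, r]) hh x)).
    apply: ler_sum => i _.
    apply: (le_trans (AC_incr s0 sr r1 (uAC i))); apply: ler_wpM2l => //.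
    have [_ dL1 _] := AC_aederiv ler01 (uAC i).
    apply: Rint_le => //; first by have [_] := L1_sub s0 r1 dL1.
    apply: aein_imp (aein_sub s0 r1 (AC_aederivE (ud i)).2) => x _ ->.
    exact: le_trans (vnorm_ge _ _) (rhs_le _ _ _).
  rewrite sumr_const card_ord -[leLHS]mulr_natr mulrAC -RintegralZl//.
  rewrite le_eqVlt; apply/orP; left; apply/eqP; apply: eq_Rintegral => x _.
  by rewrite /hh /g /k /U; ring.
have key s : 0 <= s <= 1 -> U t <= M * (U s + \int[mu]_(x in `[(0:R), (1:R)]) g x).
  by move=> s01; apply: (HM U g).
have : \int[mu]_(s in `[(0:R), (1:R)]) U t <=
    \int[mu]_(s in `[(0:R), (1:R)]) (M * (U s + \int[mu]_(x in `[(0:R), (1:R)]) g x)).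
  apply: Rint_le; [exact: itg_cst| |].
    by apply: itgZ => //; apply: itgD => //; exact: itg_cst.
  by apply: aein_all => s /andP[? ?]; apply: key; rewrite !ltW.
rewrite Rint_cst01 RintegralZl//; last by apply: itgD => //; exact: itg_cst.
rewrite RintegralD//; last exact: itg_cst.
rewrite Rint_cst01 [\int[mu]_(x in _) g x]RintegralZl// => h; apply: (le_trans h).
rewrite -[leRHS]mulrA; apply: ler_wpM2l => //.
have := mnorm_L2 uL2; have := mnorm_L2 wL2.
have su : 0 <= snorm (u : L2space R n) by exact: sqrtr_ge0.
have sw : 0 <= snorm (w : L2space R n) by exact: sqrtr_ge0.
move=> hw hu.
have c0 : 0 <= 2 * n%:R * mnorm B by rewrite !mulr_ge0// mnorm_ge0.
exact: lin_combine.
Qed.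

(** Graph convergence gives, through dirac_sup applied to differences, a
    uniform Cauchy estimate with explicit rate for the absolutely continuous
    representatives. Their pointwise limit fb satisfies the integrated
    equation, hence is absolutely continuous and solves the equation,
    satisfies the boundary conditions because they involve point values only,
    and represents the given L2 limit. *)
Lemma dirac_closed : closed_operator (dirac_operator B C0 D Q).
Proof.
have q2 : quasi_seminormed (L2space R n) := L2_qsn R n.
move=> u v x y Guv hx hy ux vy.
have /choice[p pP] k : exists p : (R -> 'cV[C]_n) * (R -> 'cV[C]_n),
    [/\ @eqv _ (L2space R n) (u k) p.1, @eqv _ (L2space R n) (v k) p.2 & dirac_operator B C0 D Q p.1 p.2].
  by have [a [b ?]] := Guv k; exists (a, b).
pose f k := (p k).1; pose g k := (p k).2.
have fo k : dirac_ode (f k) (g k) by apply: ode_of_dirac; have [] := pP k.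
have bc k : C0 *m f k 0 + D *m f k 1 = 0 by have [_ _ []] := pP k.
have fL2 k : snvec (f k : L2space R n) by have [[]] := pP k.
have gL2 k : snvec (g k : L2space R n) by have [_ []] := pP k.
have sn0 (z : L2space R n) : 0 <= snorm z by exact: sqrtr_ge0.
have [a aE] : exists a : nat -> R, forall k, snorm (f k - x : L2space R n) = a k.
  by exists (fun k => snorm (f k - x : L2space R n)).
have [b bE] : exists b : nat -> R, forall k, snorm (g k - y : L2space R n) = b k.
  by exists (fun k => snorm (g k - y : L2space R n)).
have a0 k : 0 <= a k by rewrite -aE sn0.
have b0 k : 0 <= b k by rewrite -bE sn0.
pose e k := a k + b k.
have e0 k : 0 <= e k by rewrite addr_ge0.
have ecvg : e @ \oo --> (0 : R).
  have h : (fun k => 2 * snorm (u k - x) + 2 * snorm (v k - y)) @ \oo --> (0 : R).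
    by apply: cvg0D; [exact: (cvg0Z 2 ux)|exact: (cvg0Z 2 vy)].
  apply: (squeeze_cvgr _ (cvg_cst (0 : R)) h); apply: nearW => k; rewrite e0/=.
  have [[hu hf uf] [hv hg vg] _] := pP k.
  have := qsn_dist q2 hf hu hx; have := qsn_dist q2 hg hv hy.
  rewrite (qsn_distC q2 hf hu) uf add0r (qsn_distC q2 hg hv) vg add0r.
  by move=> h1 h2; rewrite /e -aE -bE; exact: (lerD h2 h1).
have [M M0 HM] := dirac_sup.
have [E EE] : exists E : nat -> R, forall k, E k = 2 * M * e k by exists (fun k => 2 * M * e k).
have E0 k : 0 <= E k by rewrite EE !mulr_ge0.
have diff j k t : 0 <= t <= 1 -> mnorm (f j t - f k t) <= E j + E k.
  move=> t01; apply: (le_trans (HM _ _ (dirac_ode_sub (fo j) (fo k)) t t01)).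
  have := qsn_dist q2 (fL2 j) hx (fL2 k); have := qsn_dist q2 (gL2 j) hy (gL2 k).
  rewrite (qsn_distC q2 hx (fL2 k)) (qsn_distC q2 hy (gL2 k)) !aE !bE.
  set S := snorm _; set S' := snorm _ => h1 h2.
  have -> : E j + E k = M * (2 * (a j + a k) + 2 * (b j + b k)).
    by rewrite !EE /e; clear; ring.
  by apply: ler_wpM2l => //; exact: lerD.
have /choice[fb fbP] t : exists z : 'cV[C]_n, 0 <= t <= 1 ->
    forall k i, cmod (f k t i 0 - z i 0) <= 2 * E k.
  have [t01|] := boolP (0 <= t <= 1); last by exists 0.
  have /choice[z zP] i : exists z : C, forall k, cmod (f k t i 0 - z) <= 2 * E k.
    have cd j k : cmod (f j t i 0 - f k t i 0) <= E j + E k.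
      apply: le_trans (diff j k t t01); have := vnorm_ge (f j t - f k t) i.
      by rewrite !mxE.
    have reP j k : `|Rez (f j t i 0) - Rez (f k t i 0)| <= E j + E k.
      by rewrite -raddfB (le_trans (Re_le_cmod _)).
    have imP j k : `|Imz (f j t i 0) - Imz (f k t i 0)| <= E j + E k.
      by rewrite -raddfB (le_trans (Im_le_cmod _)).
    have [zr zrP] := cauchy_lim reP; have [zi ziP] := cauchy_lim imP.
    exists (Complex zr zi) => k; apply: (le_trans (cmod_le_ReIm _)).
    rewrite !raddfB/= mulr2n mulrDl mul1r; exact: lerD.
  by exists (\col_i z i) => _ k i; rewrite mxE.
have fbn k t : 0 <= t <= 1 -> mnorm (f k t - fb t) <= n%:R * (2 * E k).
  move=> t01; rewrite vnormE; have -> : n%:R * (2 * E k) = \sum_(i < n) 2 * E k.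
    by rewrite sumr_const card_ord mulr_natl.
  by apply: ler_sum => i _; rewrite !mxE; exact: fbP.
have fAC k i : in_AC 0 1 (coordf (f k) i) by have [] := fo k.
have Ecvg : E @ \oo --> (0 : R).
  by rewrite (_ : E = (fun k => 2 * M * e k)); [exact: cvg0Z|apply/funext => k; rewrite EE].
have fbm i : cmeasurable 0 1 (coordf fb i).
  have mf k := in_AC_meas (fAC k i).
  have cv (F : C -> R) t : (forall z1 z2 : C, `|F z1 - F z2| <= cmod (z1 - z2)) -> 0 <= t <= 1 ->
      (fun k => F (coordf (f k) i t)) @ \oo --> F (coordf fb i t).
    move=> HF t01; apply/cvgrPdist_le => d d0.
    have := cvg0Z 2 Ecvg; move/cvgrPdist_le => /(_ d d0); apply: filterS => k.
    rewrite sub0r normrN ger0_norm ?mulr_ge0// => hk.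
    by rewrite (le_trans (HF _ _))// cmodB (le_trans _ hk)//; exact: fbP.
  split.
    apply: (@measurable_fun_cvg _ _ _ _ (fun k t => Rez (coordf (f k) i t))) => [k|t].
      by case: (mf k).
    rewrite /= in_itv/= => t01; apply: cv => // z1 z2; rewrite -raddfB; exact: Re_le_cmod.
  apply: (@measurable_fun_cvg _ _ _ _ (fun k t => Imz (coordf (f k) i t))) => [k|t].
    by case: (mf k).
  rewrite /= in_itv/= => t01; apply: cv => // z1 z2; rewrite -raddfB; exact: Im_le_cmod.
have fbL2 : snvec (fb : L2space R n).
  move=> i; have [c cP] := in_AC_bd ler01 (fAC 0%N i).
  apply: (@in_L2_bd _ _ _ _ (c + 2 * E 0%N)) => // t t01.
  rewrite -(subrK (f 0%N t i 0) (coordf fb i t)) addrC.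
  by rewrite (le_trans (cmodD _ _))// lerD ?cP// cmodB fbP.
pose gb i := coordf (dirac_rhs fb y) i.
have ir z w : snvec (z : L2space R n) -> snvec (w : L2space R n) ->
    (exists c, forall t, 0 <= t <= 1 -> mnorm (z t) <= c) ->
    mu.-integrable `[(0:R), (1:R)] (EFin \o (fun t => mnorm B * mnorm (w t) + cQ t * mnorm (z t))).
  move=> hz hw [c cP]; apply: itgD => //.
    by apply: itgZ => //; apply: mnorm_itg => i; exact: in_L2_L1.
  have mz : measurable_fun `[(0:R), (1:R)] (fun t => mnorm (z t)).
    by apply: mnorm_meas => i; have [] := hz i.
  have := itg_bdM mz _ cQ_itg => /(_ c) h.
  apply: eq_integrable (h _) => // [t _|t /cP]; first by rewrite /= mulrC.
  by rewrite ger0_norm// mnorm_ge0.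
have gbL1 i : in_L1 0 1 (gb i).
  have cfb : exists c, forall t, 0 <= t <= 1 -> mnorm (fb t) <= c.
    have /choice[c cP] j := in_AC_bd ler01 (fAC 0%N j).
    exists (\sum_j c j + n%:R * (2 * E 0%N)) => t t01.
    rewrite -(subrK (f 0%N t) (fb t)) addrC (le_trans (mnormD _ _))// lerD//.
      by rewrite vnormE; apply: ler_sum => j _; exact: cP.
    by rewrite -mnormN opprB fbn.
  apply: in_L1_dom (ir _ _ fbL2 hy cfb).
    by apply: rhs_meas => // j; have [] := hy j.
  by move=> t _; exact: le_trans (vnorm_ge _ _) (rhs_le _ _ _).
have rL1 k i : in_L1 0 1 (coordf (dirac_rhs (f k) (g k)) i).
  have [_ _ fd] := fo k; have [_ h] := AC_aederivE (fd i).
  have [_ dL1 _] := AC_aederiv ler01 (fAC k i).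
  by apply: in_L1_ae dL1 => //; case: (fd i).
have fbE i t : 0 <= t <= 1 -> coordf fb i t = coordf fb i 0 + cint 0 t (gb i).
  move=> t01; apply/eqP; rewrite -subr_eq0; apply/eqP/cmod_eq0.
  set z := _ - _.
  pose K := 8 * M + 2 * (mnorm B * n%:R + n%:R * (4 * M) * \int[mu]_(s in `[(0:R), (1:R)]) cQ s).
  apply: (@le_cvg0_eq0 _ _ K e) => // [|k]; first exact: cmod_ge0.
  have fE : coordf (f k) i t = coordf (f k) i 0 + cint 0 t (coordf (dirac_rhs (f k) (g k)) i).
    have [_ _ fd] := fo k; have [hd h] := AC_aederivE (fd i).
    have [_ dL1 ->//] := AC_aederiv ler01 (fAC k i); congr (_ + _).
    have /andP[_ t1] := t01; apply: cint_ae.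
    - by apply: (@cmeas_sub _ 0 1) => //; case: dL1.
    - by apply: (@cmeas_sub _ 0 1) => //; case: (rL1 k i).
    - exact: aein_sub h.
  have -> : z = (coordf fb i t - coordf (f k) i t) + (coordf (f k) i 0 - coordf fb i 0) +
     (cint 0 t (coordf (dirac_rhs (f k) (g k)) i) - cint 0 t (gb i)).
    rewrite fE /z; move: (coordf _ _ _) (cint _ _ _) (coordf _ _ _) (cint _ _ _) (coordf _ _ _).
    by clear => A1 A2 A3 A4 A5; ring.
  have h1 : cmod (coordf fb i t - coordf (f k) i t) <= 2 * E k by rewrite cmodB; exact: fbP.
  have h2 : cmod (coordf (f k) i 0 - coordf fb i 0) <= 2 * E k by apply: fbP; rewrite lexx ler01.
  have /andP[t0 t1] := t01.
  have h3 : cmod (cint 0 t (coordf (dirac_rhs (f k) (g k)) i) - cint 0 t (gb i)) <=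
     2 * (mnorm B * (n%:R * b k) + (n%:R * (2 * E k)) * \int[mu]_(s in `[(0:R), (1:R)]) cQ s).
    have gbt := L1_sub (lexx 0) t1 (gbL1 i); have rt := L1_sub (lexx 0) t1 (rL1 k i).
    rewrite (cintB rt gbt).
    have dL1 : in_L1 0 t (fun s => coordf (dirac_rhs (f k) (g k)) i s - gb i s).
      have := in_L1D rt (in_L1_bdM (cmeas_cst 0 t (-1 : C)) (fun s _ => lexx _) gbt).
      by apply: in_L1_eq => s _; rewrite mulN1r.
    apply: (le_trans (cmod_cint dL1)); apply: ler_wpM2l => //.
    have iB : mu.-integrable `[(0:R), (1:R)] (EFin \o (fun s => mnorm B * mnorm (g k s - y s))).
      apply: itgZ => //; apply: mnorm_itg => j; apply: in_L2_L1.
      exact: (qsn_vecB q2 (gL2 k) hy).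
    have iE : mu.-integrable `[(0:R), (1:R)] (EFin \o (fun s => n%:R * (2 * E k) * cQ s)).
      by apply: itgZ => //; exact: cQ_itg.
    apply: (@le_trans _ _ (\int[mu]_(s in `[0, t])
       (mnorm B * mnorm (g k s - y s) + n%:R * (2 * E k) * cQ s))).
      apply: Rint_le.
      - by case: dL1.
      - by apply: itgD => //; [exact: itg_sub iB|exact: itg_sub iE].
      - apply: aein_all => s /andP[s0 st].
        have -> : coordf (dirac_rhs (f k) (g k)) i s - gb i s =
            dirac_rhs (fun t => f k t - fb t) (fun t => g k t - y t) s i 0.
          by rewrite rhsB /gb /coordf !mxE.
        apply: (le_trans (vnorm_ge _ _)); apply: (le_trans (rhs_le _ _ _)).
        rewrite lerD2l mulrC ler_wpM2r//; first by rewrite mulr_ge0// mnorm_ge0.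
        by apply: fbn; rewrite (ltW s0) (le_trans (ltW st)).
    apply: (@le_trans _ _ (\int[mu]_(s in `[(0:R), (1:R)])
       (mnorm B * mnorm (g k s - y s) + n%:R * (2 * E k) * cQ s))).
      apply: Rint_sub => //; first exact: itgD.
      by move=> s _; rewrite addr_ge0// !mulr_ge0// ?mnorm_ge0// E0.
    rewrite RintegralD// RintegralZl//; last first.
      by apply: mnorm_itg => j; apply: in_L2_L1; exact: (qsn_vecB q2 (gL2 k) hy).
    rewrite RintegralZl//; last exact: cQ_itg.
    rewrite lerD2r ler_wpM2l ?mnorm_ge0//.
    by rewrite -bE; exact: (mnorm_L2 (qsn_vecB q2 (gL2 k) hy)).
  apply: (le_trans (cmodD _ _)); apply: (le_trans (lerD (cmodD _ _) (lexx _))).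
  apply: (le_trans (lerD (lerD h1 h2) h3)).
  have be : b k <= e k by rewrite /e lerDr.
  have : mnorm B * (n%:R * b k) <= mnorm B * (n%:R * e k).
    by rewrite ler_wpM2l ?mnorm_ge0// ler_wpM2l.
  rewrite /K EE; set W := mnorm B * (_ * b k); set I := \int[mu]_(s in _) _ => hW.
  have -> : (8 * M + 2 * (mnorm B * n%:R + n%:R * (4 * M) * I)) * e k =
    2 * (2 * M * e k) + 2 * (2 * M * e k) + 2 * (mnorm B * (n%:R * e k) + n%:R * (2 * (2 * M * e k)) * I).
    by move: (I) (mnorm B) (e k) => I' B' ek; clear; ring.
  by rewrite lerD2l ler_pM2l// lerD2r.
have fbode : dirac_ode fb y.
  have h i := int_AC (gbL1 i) (fbE i).
  by split => // i; have [] := h i.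
have fbbc : C0 *m fb 0 + D *m fb 1 = 0.
  suff : mnorm (C0 *m fb 0 + D *m fb 1) = 0.
    move=> h; apply/colP => i; rewrite [RHS]mxE; apply/cmod_eq0/eqP.
    by rewrite eq_le cmod_ge0 andbT -[leRHS]h vnorm_ge.
  apply: (@le_cvg0_eq0 _ _ ((mnorm C0 + mnorm D) * (n%:R * (4 * M))) e) => // [|k].
    exact: mnorm_ge0.
  have -> : C0 *m fb 0 + D *m fb 1 = C0 *m (fb 0 - f k 0) + D *m (fb 1 - f k 1).
    by rewrite !mulmxBr addrACA -opprD bc subr0.
  have -> : (mnorm C0 + mnorm D) * (n%:R * (4 * M)) * e k =
     mnorm C0 * (n%:R * (2 * E k)) + mnorm D * (n%:R * (2 * E k)).
    by rewrite EE; move: (mnorm C0) (mnorm D) (e k) => c1 c2 ek; clear; ring.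
  apply: (le_trans (mnormD _ _)); apply: lerD; apply: (le_trans (mnormM _ _));
    apply: ler_wpM2l; rewrite ?mnorm_ge0// -mnormN opprB fbn// ?lexx ?ler01//.
have xfb : @eqv _ (L2space R n) x fb.
  split => //; apply: (@le_cvg0_eq0 _ _ (2 * (1 + n%:R * (4 * M))) e) => // k.
  apply: (le_trans (qsn_dist q2 hx (fL2 k) fbL2)).
  rewrite -mulrA ler_pM2l// mulrDl mul1r; apply: lerD.
    by rewrite (qsn_distC q2 hx (fL2 k)) aE /e lerDl.
  have -> : n%:R * (4 * M) * e k = n%:R * (2 * E k).
    by rewrite EE; move: (e k) => ek; clear; ring.
  have nE0 : 0 <= n%:R * (2 * E k) by rewrite !mulr_ge0.
  rewrite -[leRHS]ger0_norm// -sqrtr_sqr ler_wsqrtr// -[leRHS]Rint_cst01.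
  apply: Rint_le.
  - exact: L2_itg (qsn_vecB q2 (fL2 k) fbL2).
  - exact: itg_cst.
  - apply: aein_all => t /andP[t0 t1]; have t01 : 0 <= t <= 1 by rewrite !ltW.
    apply: (@le_trans _ _ (mnorm (f k t - fb t) ^+ 2)); last first.
      by rewrite lerXn2r ?nnegrE ?mnorm_ge0// fbn.
    rewrite expr2 {1}vnormE mulr_suml; apply: ler_sum => i _.
    by rewrite expr2 ler_wpM2l ?cmod_ge0// vnorm_ge.
have [w [Lw yw]] := dirac_of_ode fbode fbbc.
by exists fb, w.
Qed.

End Dirac.

(** * Vectors of length four and the matrix of the potential *)

Local Open Scope complex_scope.

Section FourVectors.
Variable R : realType.
Local Notation C := R[i].

Lemma forall_ord4 (P : 'I_4 -> Prop) :
  P (ord4 0) -> P (ord4 1) -> P (ord4 2) -> P (ord4 3) -> forall i, P i.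
Proof.
move=> P0 P1 P2 P3 i.
have -> : i = ord4 i by apply/val_inj; rewrite /= inordK.
by case: i => [[|[|[|[|]]]]].
Qed.

Lemma col4E (z1 z2 z3 z4 : C) k : (k < 4)%N ->
  col4 z1 z2 z3 z4 (ord4 k) 0 = nth 0 [:: z1; z2; z3; z4] k.
Proof. by move=> k4; rewrite mxE inordK. Qed.

Lemma mx4E (s : seq (seq C)) j k : (j < 4)%N -> (k < 4)%N ->
  mx4 s (ord4 j) (ord4 k) = nth 0 (nth [::] s j) k.
Proof. by move=> j4 k4; rewrite mxE !inordK. Qed.

Lemma sum_ord4 (V : nmodType) (F : 'I_4 -> V) :
  \sum_i F i = F (ord4 0) + F (ord4 1) + F (ord4 2) + F (ord4 3).
Proof.
rewrite !big_ord_recr big_ord0 /= add0r.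
by congr (_ + _ + _ + _); congr F; apply/val_inj; rewrite /= inordK.
Qed.

Lemma mulmx4E (A : 'M[C]_4) (v : 'cV[C]_4) i :
  (A *m v) i 0 = A i (ord4 0) * v (ord4 0) 0 + A i (ord4 1) * v (ord4 1) 0 +
    A i (ord4 2) * v (ord4 2) 0 + A i (ord4 3) * v (ord4 3) 0.
Proof. by rewrite mxE sum_ord4. Qed.

(** The matrices B and Theta are of this form, and so are their inverses. *)
Definition diag4 (z1 z2 z3 z4 : C) : 'M[C]_4 :=
  mx4 [:: [:: z1; 0; 0; 0]; [:: 0; z2; 0; 0]; [:: 0; 0; z3; 0]; [:: 0; 0; 0; z4]].

Lemma diag4_mul z1 z2 z3 z4 w1 w2 w3 w4 :
  diag4 z1 z2 z3 z4 *m diag4 w1 w2 w3 w4 = diag4 (z1 * w1) (z2 * w2) (z3 * w3) (z4 * w4).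
Proof.
apply/matrixP => i j; rewrite mxE sum_ord4; move: i j.
by apply: forall_ord4; apply: forall_ord4; rewrite !mx4E//=; ring.
Qed.

Lemma diag4_1 : diag4 1 1 1 1 = 1%:M.
Proof.
apply/matrixP => i j; rewrite [RHS]mxE -val_eqE; move: i j.
by apply: forall_ord4; apply: forall_ord4; rewrite mx4E//= !inordK.
Qed.

Lemma diag4_unit z1 z2 z3 z4 : z1 != 0 -> z2 != 0 -> z3 != 0 -> z4 != 0 ->
  diag4 z1 z2 z3 z4 \in unitmx /\ invmx (diag4 z1 z2 z3 z4) = diag4 z1^-1 z2^-1 z3^-1 z4^-1.
Proof.
move=> n1 n2 n3 n4.
have E : diag4 z1 z2 z3 z4 *m diag4 z1^-1 z2^-1 z3^-1 z4^-1 = 1%:M.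
  by rewrite diag4_mul !divff// diag4_1.
have [u _] := mulmx1_unit E; split => //.
by rewrite -[RHS](mulKmx u) E mulmx1.
Qed.

Lemma diag4_col z1 z2 z3 z4 (v : 'cV[C]_4) :
  diag4 z1 z2 z3 z4 *m v =
  col4 (z1 * v (ord4 0) 0) (z2 * v (ord4 1) 0) (z3 * v (ord4 2) 0) (z4 * v (ord4 3) 0).
Proof.
apply/colP => i; rewrite mulmx4E; move: i.
by apply: forall_ord4; rewrite !mx4E// col4E//=; ring.
Qed.

End FourVectors.

Section DiracCoefficients.
Variable R : realType.
Local Notation C := R[i].
Variables (l : R) (EI Irho K rho : R -> R) (p1 p2 : R -> C) (b1 b2 : R).
Hypotheses (b1_gt0 : 0 < b1) (b2_gt0 : 0 < b2).

Lemma RC_neq0 (r : R) : r != 0 -> r%:C != 0 :> C.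
Proof. by move=> r0; rewrite -[0]/(0%:C) (inj_eq (@complexI _)). Qed.

Lemma invR (r : R) : (r%:C : C)^-1 = (r^-1)%:C.
Proof.
have [->|r0] := eqVneq r 0; first by rewrite !invr0.
by apply: (mulfI (RC_neq0 r0)); rewrite divff ?RC_neq0// -rmorphM/= divff.
Qed.

Lemma iC_neq0 : 'i%C != 0 :> C.
Proof.
by apply/eqP => /(congr1 (@cmod R)); rewrite cmod_i cmod0 => /eqP; rewrite oner_eq0.
Qed.

Lemma iV : ('i%C : C)^-1 = - 'i%C.
Proof.
by apply: (mulfI iC_neq0); rewrite divff ?iC_neq0// mulrN -expr2 sqr_i opprK.
Qed.

Lemma Bmx_unit : Bmx b1 b2 \in unitmx /\
  invmx (Bmx b1 b2) = diag4 (- (b1^-1)%:C) (b1^-1)%:C (- (b2^-1)%:C) (b2^-1)%:C.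
Proof.
have n1 := RC_neq0 (lt0r_neq0 b1_gt0); have n2 := RC_neq0 (lt0r_neq0 b2_gt0).
have [h1 h2] := @diag4_unit R (- b1%:C) b1%:C (- b2%:C) b2%:C
  (ltac:(by rewrite oppr_eq0)) n1 (ltac:(by rewrite oppr_eq0)) n2.
by split => //; rewrite /Bmx -/(diag4 _ _ _ _) h2 !invrN !invR.
Qed.

(** The two rows of each block of Q agree up to the sign of the coupling
    terms, which is why their sums and differences separate the four
    equations. *)
Lemma Qhat_mul x (v : 'cV[C]_4) : Irho x != 0 -> rho x != 0 ->
  let dh1 := aederiv 0 l (fun s => (h1f EI Irho s)%:C) x in
  let dh2 := aederiv 0 l (fun s => (h2f K rho s)%:C) x in
  let h2 := (h2f K rho x)%:C in
  let v1 := v (ord4 0) 0 in let v2 := v (ord4 1) 0 in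
  let v3 := v (ord4 2) 0 in let v4 := v (ord4 3) 0 in
  Qhat l EI Irho K rho p1 p2 x *m v =
  col4
   ('i%C * (((p1 x + dh1) * v1 + (p1 x - dh1) * v2 + h2 * v3 - h2 * v4) / (2 * (Irho x)%:C)))
   ('i%C * (((p1 x + dh1) * v1 + (p1 x - dh1) * v2 + h2 * v3 - h2 * v4) / (2 * (Irho x)%:C)))
   ('i%C * ((- h2 * v1 - h2 * v2 + (p2 x + dh2) * v3 + (p2 x - dh2) * v4) / (2 * (rho x)%:C)))
   ('i%C * ((h2 * v1 + h2 * v2 + (p2 x + dh2) * v3 + (p2 x - dh2) * v4) / (2 * (rho x)%:C))).
Proof.
move=> n1 n2 dh1 dh2 h2 v1 v2 v3 v4; have i0 := iC_neq0.
have m1 := RC_neq0 n1; have m2 := RC_neq0 n2.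
have two : (2 : C) != 0 by rewrite pnatr_eq0.
have ThE : Thetamx Irho rho x = diag4 (- 2%:R * 'i%C * (Irho x)%:C) (- 2%:R * 'i%C * (Irho x)%:C)
    (- 2%:R * 'i%C * (rho x)%:C) (- 2%:R * 'i%C * (rho x)%:C).
  apply/matrixP => i j; rewrite /Thetamx mxE; move: i j.
  by apply: forall_ord4; apply: forall_ord4; rewrite !mx4E//= ?mulr0.
have nn (r : R) : r%:C != 0 :> C -> (- 2%:R * 'i%C * r%:C : C) != 0.
  by move=> r0; rewrite !mulf_neq0// oppr_eq0.
have [ThU ThV] := diag4_unit (nn _ m1) (nn _ m1) (nn _ m2) (nn _ m2).
have inv (r : R) : r%:C != 0 :> C -> (- 2%:R * 'i%C * r%:C : C)^-1 = 'i%C / (2 * r%:C).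
  by move=> r0; rewrite !invfM iV invrN; ring.
rewrite /Qhat ThE ThV !inv// -mulmxA diag4_col.
by congr col4; rewrite mulmx4E !mx4E//= -/v1 -/v2 -/v3 -/v4 -/dh1 -/dh2 -/h2; ring.
Qed.

End DiracCoefficients.

(** * The energy space *)

Section H10.
Variables (R : realType) (l : R).
Hypothesis l0 : 0 <= l.
Local Notation C := R[i].
Local Notation mu := (@lebesgue_measure R).
Implicit Types (f g : R -> C).

Lemma H10I f g : in_AC 0 l f -> is_aederiv 0 l f g -> in_L2 0 l g -> f 0 = 0 -> in_H10 l f.
Proof.
move=> fAC fg gL2 f0; split => //; split => //.
have [[mf _] fE] := AC_aederivE fg.
by apply: in_L2_ae gL2 => //; apply: aein_imp fE => x _ ->.
Qed.

Lemma H10_lin (c : C) f g : in_H10 l f -> in_H10 l g -> in_H10 l (fun x => c * f x + g x).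
Proof.
move=> [[fAC fL2] f0] [[gAC gL2] g0].
have [fd _ _] := AC_aederiv l0 fAC; have [gd _ _] := AC_aederiv l0 gAC.
apply: (H10I _ (aederD (aederZ c fd) gd)).
- by apply: in_ACD => //; exact: in_ACZ.
- by apply: in_L2D => //; exact: in_L2Z.
- by rewrite f0 g0 mulr0 addr0.
Qed.

Lemma H10_aederiv_lin (c : C) f g : in_H10 l f -> in_H10 l g ->
  aein 0 l (fun x => aederiv 0 l (fun x => c * f x + g x) x =
     c * aederiv 0 l f x + aederiv 0 l g x).
Proof.
move=> [[fAC fL2] f0] [[gAC gL2] g0].
have [fd _ _] := AC_aederiv l0 fAC; have [gd _ _] := AC_aederiv l0 gAC.
exact: (AC_aederivE (aederD (aederZ c fd) gd)).2.
Qed.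

Lemma H10Z (c : C) f : in_H10 l f -> in_H10 l (fun x => c * f x).
Proof.
move=> [[fAC fL2] f0]; have [fd _ _] := AC_aederiv l0 fAC.
apply: (H10I _ (aederZ c fd)); [exact: in_ACZ|exact: in_L2Z|by rewrite f0 mulr0].
Qed.

Lemma H10_AC f : in_H10 l f -> in_AC 0 l f. Proof. by case=> -[]. Qed.

Lemma AC_L2 f : in_AC 0 l f -> in_L2 0 l f.
Proof.
move=> fAC; have [b fb] := in_AC_bd l0 fAC.
by apply: in_L2_bd fb; exact: in_AC_meas.
Qed.

Lemma H10_L2 f : in_H10 l f -> in_L2 0 l f.
Proof. by move=> /H10_AC; exact: AC_L2. Qed.

Lemma aederiv_eq0 f : (forall x, 0 <= x <= l -> f x = 0) ->
  aein 0 l (fun x => aederiv 0 l f x = 0).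
Proof.
move=> f0; have fd : is_aederiv 0 l f (fun=> 0).
  split; first exact: cmeas_cst.
  apply: aein_all => x xl; have h := cder_cst (0 : C) x.
  apply: cder_near h; near=> y; rewrite f0//.
  by have /andP[? ?] : 0 < y < l; [near: y; exact: near_oo|rewrite !ltW].
exact: (AC_aederivE fd).2.
Unshelve. all: by end_near. Qed.

End H10.

Section TimoSpace.
Variables (R : realType) (l c c' : R) (EI Irho K rho : R -> R).
Hypothesis l0 : 0 <= l.
Hypothesis c0 : 0 < c.
Hypothesis bd : forall x, 0 <= x <= l ->
  [/\ c <= EI x <= c', c <= Irho x <= c', c <= K x <= c' & c <= rho x <= c'].
Hypotheses (mEI : measurable_fun `[0, l] EI) (mI : measurable_fun `[0, l] Irho)
  (mK : measurable_fun `[0, l] K) (mrho : measurable_fun `[0, l] rho).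
Local Notation C := R[i].
Local Notation mu := (@lebesgue_measure R).
Local Notation X := (timo_space l EI Irho K rho).
Implicit Types (y : X) (x : R).

Definition dens y x : R :=
  EI x * cmod (aederiv 0 l (yc y 1) x) ^+ 2 + Irho x * cmod (yc y 2 x) ^+ 2
  + K x * cmod (aederiv 0 l (yc y 3) x - yc y 1 x) ^+ 2 + rho x * cmod (yc y 4 x) ^+ 2.

Lemma snormE y : snorm y = Num.sqrt (\int[mu]_(x in `[0%R, l]) dens y x).
Proof. by []. Qed.

Lemma snvec_lin (a : C) (y z : X) : snvec y -> snvec z -> snvec (a *: y + z).
Proof.
move=> [y1 y2 y3 y4] [z1 z2 z3 z4].
have E k : yc (a *: y + z) k = (fun x => a * yc y k x + yc z k x).
  by apply/funext => x; rewrite /yc /coordf !mxE.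
split; rewrite E; [exact: H10_lin|apply: in_L2D => //; exact: in_L2Z|
  exact: H10_lin|apply: in_L2D => //; exact: in_L2Z].
Qed.

Lemma itg_coef (k : R -> R) (f : R -> C) : measurable_fun `[0, l] k ->
  (forall x, 0 <= x <= l -> c <= k x <= c') -> in_L2 0 l f ->
  mu.-integrable `[0, l] (EFin \o (fun x => k x * cmod (f x) ^+ 2)).
Proof.
move=> mk kb [mf fi]; apply: (itg_bdM (M := c')) => // x /kb /andP[k1 k2].
by rewrite ger0_norm// (le_trans (ltW c0)).
Qed.

Lemma dens_itg y : snvec y -> mu.-integrable `[0, l] (EFin \o dens y).
Proof.
move=> [y1 y2 y3 y4]; have h3 : in_L2 0 l (fun x => aederiv 0 l (yc y 3) x - yc y 1 x).
  have h := in_L2D y3.1.2 (in_L2Z (-1) (H10_L2 l0 y1)).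
  by apply: in_L2_eq h => x _; rewrite mulN1r.
do 3?apply: itgD => //; apply: itg_coef => //; try (by move=> x /bd[]); exact: y1.1.2.
Qed.

Lemma dens_ge0 y x : 0 <= x <= l -> 0 <= dens y x.
Proof.
move=> /bd[/andP[h1 _] /andP[h2 _] /andP[h3 _] /andP[h4 _]].
by rewrite /dens !addr_ge0// mulr_ge0 ?sqr_ge0// (le_trans (ltW c0)).
Qed.

Lemma dens_int_ge0 y : 0 <= \int[mu]_(x in `[0%R, l]) dens y x.
Proof.
by apply: Rintegral_ge0 => x /=; rewrite in_itv/=; exact: dens_ge0.
Qed.

(** The derivatives entering the energy are linear only almost everywhere,
    since the representative chosen by aederiv is not linear. *)
Lemma timo_qsn : quasi_seminormed X.
Proof.
have z0 k : yc (0 : X) k = (fun=> 0 : C) by apply/funext => x; rewrite /yc /coordf mxE.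
have H0 : in_H10 l (fun=> 0 : C).
  apply: (@H10I _ _ _ (fun=> 0)) => //; first exact: in_AC_cst.
    by split; [exact: cmeas_cst|apply: aein_all => x _; exact: cder_cst].
  by apply: (@in_L2_bd _ _ _ _ 0) => [|x _]; [exact: cmeas_cst|rewrite cmod0].
have v0 : snvec (0 : X) by split; rewrite z0 => //; exact: H10_L2.
split => //.
- exact: snvec_lin.
- by move=> y; exact: sqrtr_ge0.
- rewrite snormE (_ : Rintegral _ _ _ = 0) ?sqrtr0//.
  transitivity (\int[mu]_(x in `[0%R, l]) (0 : R)); last first.
    by rewrite Rintegral_cst// mul0r.
  apply: Rint_ae; [exact: itg_meas (dens_itg v0)|exact: measurable_cst|].
  have h : aein 0 l (fun x => aederiv 0 l (fun=> 0 : C) x = 0) by exact: aederiv_eq0.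
  by apply: aein_imp h => x _ h; rewrite /dens !z0 h subrr cmod0 expr0n/= !mulr0 !addr0.
- move=> y hy; have hN : snvec (- y) by have := snvec_lin (-1) hy v0; rewrite scaleN1r addr0.
  have E k : yc (- y) k = (fun x => -1 * yc y k x + yc (0 : X) k x).
    by apply/funext => x; rewrite /yc /coordf !mxE mulN1r addr0.
  rewrite !snormE; congr Num.sqrt.
  apply: Rint_ae; [exact: itg_meas (dens_itg hN)|exact: itg_meas (dens_itg hy)|].
  have [y1 _ y3 _] := hy; have [q1 _ q3 _] := v0.
  have h : aein 0 l (fun x => aederiv 0 l (fun=> 0 : C) x = 0) by exact: aederiv_eq0.
  apply: aein_imp3 (H10_aederiv_lin l0 (-1) y1 q1) (H10_aederiv_lin l0 (-1) y3 q3) h => x _ h1 h3 h.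
  rewrite /dens !E h1 h3 !z0 h !addr0 !mulN1r !cmodN -opprD cmodN; congr (_ + _ * _ ^+ 2 + _).
- move=> y z hy hz; have hyz := snvec_lin 1 hy hz; rewrite scale1r in hyz.
  apply: sqrt_quasi; [exact: dens_int_ge0|exact: dens_int_ge0|].
  have iy := dens_itg hy; have iz := dens_itg hz.
  rewrite -RintegralZl// -RintegralZl// -RintegralD//; [|exact: itgZ..].
  apply: Rint_le; [exact: dens_itg hyz|by apply: itgD => //; exact: itgZ|].
  have E k : yc (y + z) k = (fun x => 1 * yc y k x + yc z k x).
    by apply/funext => x; rewrite /yc /coordf !mxE mul1r.
  have [y1 _ y3 _] := hy; have [q1 _ q3 _] := hz.
  apply: aein_imp2 (H10_aederiv_lin l0 1 y1 q1) (H10_aederiv_lin l0 1 y3 q3) => x /andP[x0 xl] h1 h3.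
  have /bd[/andP[k1 _] /andP[k2 _] /andP[k3 _] /andP[k4 _]] : 0 <= x <= l by rewrite !ltW.
  have up (k : R) (z1 z2 : C) : c <= k ->
     k * cmod (z1 + z2) ^+ 2 <= 2 * (k * cmod z1 ^+ 2) + 2 * (k * cmod z2 ^+ 2).
    move=> ck; have k0 : 0 <= k by rewrite (le_trans (ltW c0)).
    have -> : 2 * (k * cmod z1 ^+ 2) + 2 * (k * cmod z2 ^+ 2) = k * (2 * cmod z1 ^+ 2 + 2 * cmod z2 ^+ 2).
      by ring.
    by apply: ler_wpM2l => //; exact: cmodD_sq.
  rewrite /dens !E h1 h3 !mul1r opprD addrACA.
  have e1 := up _ (aederiv 0 l (yc y 1) x) (aederiv 0 l (yc z 1) x) k1.
  have e2 := up _ (yc y 2 x) (yc z 2 x) k2.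
  have e3 := up _ (aederiv 0 l (yc y 3) x - yc y 1 x) (aederiv 0 l (yc z 3) x - yc z 1 x) k3.
  have e4 := up _ (yc y 4 x) (yc z 4 x) k4.
  apply: (le_trans (lerD (lerD (lerD e1 e2) e3) e4)).
  by rewrite le_eqVlt; apply/orP; left; apply/eqP; ring.
Qed.

(** Equality in the energy space for y1, y3 is pointwise, as they are
    continuous, and almost everywhere for y2, y4. *)
Lemma timo_eqv (y z : X) : snvec y -> snvec z ->
  (forall x, 0 <= x <= l -> yc y 1 x = yc z 1 x) -> aein 0 l (fun x => yc y 2 x = yc z 2 x) ->
  (forall x, 0 <= x <= l -> yc y 3 x = yc z 3 x) -> aein 0 l (fun x => yc y 4 x = yc z 4 x) ->
  eqv y z.
Proof.
move=> hy hz e1 e2 e3 e4; split => //.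
have hyz := qsn_vecB timo_qsn hy hz.
have E k x : yc (y - z) k x = yc y k x - yc z k x by rewrite /yc /coordf !mxE.
rewrite snormE (_ : Rintegral _ _ _ = 0) ?sqrtr0//.
transitivity (\int[mu]_(x in `[0%R, l]) (0 : R)); last by rewrite Rintegral_cst// mul0r.
apply: Rint_ae; [exact: itg_meas (dens_itg hyz)|exact: measurable_cst|].
have d1 : aein 0 l (fun x => aederiv 0 l (yc (y - z) 1) x = 0).
  by apply: aederiv_eq0 => // x /e1; rewrite E => ->; rewrite subrr.
have d3 : aein 0 l (fun x => aederiv 0 l (yc (y - z) 3) x = 0).
  by apply: aederiv_eq0 => // x /e3; rewrite E => ->; rewrite subrr.
apply: aein_imp2 (aein_and d1 d3) (aein_and e2 e4) => x /andP[x0 xl] [h1 h3] [h2 h4].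
rewrite /dens h1 h3 !E h2 h4 e1 ?(ltW x0) ?(ltW xl)// !subrr cmod0 expr0n/=.
by rewrite !mulr0 !addr0.
Qed.

End TimoSpace.

(** * Characteristic variables *)

Section Transform.
Variables (R : realType) (l c c' M b1 b2 : R) (EI Irho K rho gamma xt tm : R -> R).
Variables (p1 p2 : R -> R[i]).
Local Notation C := R[i].
Local Notation mu := (@lebesgue_measure R).
Local Notation h1 := (h1f EI Irho).
Local Notation h2 := (h2f K rho).
Let g1 x := b1 * gamma x.
Let g2 x := b2 * gamma x.

Hypothesis l0 : 0 <= l.
Hypothesis c0 : 0 < c.
Hypothesis M0 : 0 < M.
Hypothesis bd : forall x, 0 <= x <= l ->
  [/\ c <= EI x <= c', c <= Irho x <= c', c <= K x <= c' & c <= rho x <= c'].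
Hypothesis bdh : forall x, 0 <= x <= l ->
  [/\ c <= h1 x <= c', c <= h2 x <= c', c <= g1 x <= c' & c <= g2 x <= c'].
Hypothesis rel : forall x, 0 <= x <= l ->
  [/\ h1 x * g1 x = Irho x, EI x * g1 x = h1 x, h2 x * g2 x = rho x & K x * g2 x = h2 x].
Hypotheses (mEI : measurable_fun `[0, l] EI) (mI : measurable_fun `[0, l] Irho)
  (mK : measurable_fun `[0, l] K) (mrho : measurable_fun `[0, l] rho)
  (mgamma : measurable_fun `[0, l] gamma).
Hypotheses (h1AC : rAC 0 l h1) (h2AC : rAC 0 l h2).
Hypothesis cov : bilip M 0 1 0 l xt tm.

Local Notation X1 := (timo_space l EI Irho K rho).
Local Notation X2 := (L2space R 4).

Let cov' : bilip M 0 l 0 1 tm xt := bilip_sym cov.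
Let tmxt t : 0 <= t <= 1 -> tm (xt t) = t.
Proof. by case: cov => h _ _ _ /h[]. Qed.
Let xtl t : 0 <= t <= 1 -> 0 <= xt t <= l.
Proof. by case: cov => h _ _ _ /h[]. Qed.
Let xttm x : 0 <= x <= l -> xt (tm x) = x.
Proof. by case: cov => _ h _ _ /h[]. Qed.
Let tm01 x : 0 <= x <= l -> 0 <= tm x <= 1.
Proof. by case: cov => _ h _ _ /h[]. Qed.

Let mg1 : measurable_fun `[0, l] g1.
Proof. by apply: measurable_funM => //; exact: measurable_cst. Qed.
Let mg2 : measurable_fun `[0, l] g2.
Proof. by apply: measurable_funM => //; exact: measurable_cst. Qed.

(** The coefficients g1, g2 are known through h1, h2 and EI, K only, and
    1 / k = m / h, where 1 / h is absolutely continuous. *)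
Lemma inv_meas (k h m : R -> R) : rAC 0 l h -> measurable_fun `[0, l] m ->
  (forall x, 0 <= x <= l -> [/\ c <= h x, 0 < k x & m x * k x = h x]) ->
  cmeasurable 0 l (fun x => ((k x)%:C : C)^-1).
Proof.
move=> hAC mm H; apply: (@cmeas_eq _ _ _ (fun x => (m x * (h x)^-1)%:C)).
  move=> x xl; have [ch k0 mk] := H x xl.
  rewrite invR -mk invfM mulrA divff ?mul1r//.
  by apply/eqP => m0; move: ch; rewrite -mk m0 mul0r leNgt c0.
apply: cmeasR; apply: measurable_funM => //; apply: rAC_meas.
by apply: (rAC_inv c0) => // x /H[].
Qed.

Lemma inv_bound (k : R) : c <= k -> cmod ((k%:C : C)^-1) <= c^-1.
Proof.
move=> ck; have k0 := lt_le_trans c0 ck.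
by rewrite invR cmodR gtr0_norm ?invr_gt0// lef_pV2.
Qed.

Lemma coef_bound (k : R) : c <= k <= c' -> cmod (k%:C : C) <= c'.
Proof. by move=> /andP[ck kc]; rewrite cmodR gtr0_norm// (lt_le_trans c0). Qed.

Lemma g1V_meas : cmeasurable 0 l (fun x => ((g1 x)%:C : C)^-1).
Proof.
apply: (inv_meas h1AC mEI) => x xl; have [_ -> _ _] := rel xl.
by have [/andP[? _] _ /andP[h _] _] := bdh xl; rewrite (lt_le_trans c0 h).
Qed.

Lemma g2V_meas : cmeasurable 0 l (fun x => ((g2 x)%:C : C)^-1).
Proof.
apply: (inv_meas h2AC mK) => x xl; have [_ _ _ ->] := rel xl.
by have [_ /andP[? _] _ /andP[h _]] := bdh xl; rewrite (lt_le_trans c0 h).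
Qed.

(** Equal to v1 / h1 on the domain of the operator, where v1 = EI y1', but
    defined for every y of finite energy; flux3 plays the same part for the
    shear force. *)
Definition flux1 (y : X1) x : C := ((g1 x)%:C)^-1 * aederiv 0 l (yc y 1) x.
Definition flux3 (y : X1) x : C := ((g2 x)%:C)^-1 * (aederiv 0 l (yc y 3) x - yc y 1 x).

Definition char_vars (y : X1) x : 'cV[C]_4 :=
  col4 (2^-1 * (yc y 2 x - flux1 y x)) (2^-1 * (yc y 2 x + flux1 y x))
       (2^-1 * (yc y 4 x - flux3 y x)) (2^-1 * (yc y 4 x + flux3 y x)).
Definition to_dirac (y : X1) : X2 := fun t => char_vars y (xt t).

Lemma flux1_L2 y : snvec y -> in_L2 0 l (flux1 y).
Proof.
move=> [y1 _ _ _]; apply: (in_L2_bdM (c := c^-1)) y1.1.2; first exact: g1V_meas.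
by move=> x /bdh[_ _ /andP[h _] _]; exact: inv_bound.
Qed.

Lemma flux3_L2 y : snvec y -> in_L2 0 l (flux3 y).
Proof.
move=> [y1 _ y3 _]; apply: (in_L2_bdM (c := c^-1)); first exact: g2V_meas.
  by move=> x /bdh[_ _ _ /andP[h _]]; exact: inv_bound.
by apply: in_L2B; [exact: y3.1.2|exact: H10_L2].
Qed.

Lemma coordf_col4 (f1 f2 f3 f4 : R -> C) k : (k < 4)%N ->
  coordf (fun x => col4 (f1 x) (f2 x) (f3 x) (f4 x)) (ord4 k) = nth (fun=> 0) [:: f1; f2; f3; f4] k.
Proof.
by move=> k4; apply/funext => x; rewrite /coordf col4E//; case: k k4 => [|[|[|[|]]]].
Qed.

Lemma char_vars_L2 y : snvec y -> forall i, in_L2 0 l (coordf (char_vars y) i).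
Proof.
move=> hy; have h1' := flux1_L2 hy; have h3' := flux3_L2 hy; have [_ y2 _ y4] := hy.
by apply: forall_ord4; rewrite coordf_col4//=; apply: in_L2Z; (apply: in_L2B || apply: in_L2D).
Qed.

Lemma to_dirac_vec y : snvec y -> snvec (to_dirac y).
Proof. by move=> hy i; exact: (cov_L2 M0 ler01 l0 cov (char_vars_L2 hy i)). Qed.

Definition slope1 (u : X2) x : C := (g1 x)%:C * (yc u 2 (tm x) - yc u 1 (tm x)).
Definition slope3 (u : X2) x : C := (g2 x)%:C * (yc u 4 (tm x) - yc u 3 (tm x)).
Definition prim1 (u : X2) x : C := cint 0 x (slope1 u).
Definition prim3 (u : X2) x : C := cint 0 x (fun s => prim1 u s + slope3 u s).
(** The differences of the characteristic variables are y1' / g1 and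
    (y3' - y1) / g2, so y1 and then y3 are found by integration from 0. *)
Definition to_timo (u : X2) : X1 := fun x =>
  col4 (prim1 u x) (yc u 1 (tm x) + yc u 2 (tm x)) (prim3 u x) (yc u 3 (tm x) + yc u 4 (tm x)).

Lemma yc_to_timo (u : X2) k : (0 < k <= 4)%N -> yc (to_timo u) k = nth (fun=> 0) [:: prim1 u;
  (fun x => yc u 1 (tm x) + yc u 2 (tm x)); prim3 u; (fun x => yc u 3 (tm x) + yc u 4 (tm x))] k.-1.
Proof. by case: k => // k /= k4; rewrite /yc coordf_col4. Qed.

Lemma comp_tm_L2 (u : X2) k : snvec u -> in_L2 0 l (fun x => yc u k (tm x)).
Proof. by move=> hu; apply: (cov_L2 M0 l0 ler01 cov'); exact: hu. Qed.

Lemma slope1_L2 (u : X2) : snvec u -> in_L2 0 l (slope1 u).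
Proof.
move=> hu; apply: (in_L2_bdM (c := c')); first exact: cmeasR.
  by move=> x /bdh[_ _ h _]; exact: coef_bound.
by apply: in_L2B; exact: comp_tm_L2.
Qed.

Lemma slope3_L2 (u : X2) : snvec u -> in_L2 0 l (slope3 u).
Proof.
move=> hu; apply: (in_L2_bdM (c := c')); first exact: cmeasR.
  by move=> x /bdh[_ _ _ h]; exact: coef_bound.
by apply: in_L2B; exact: comp_tm_L2.
Qed.

Lemma cint_pt a (f : R -> C) : cint a a f = 0.
Proof. by rewrite /cint !set_itv1 !Rintegral_set1. Qed.

Lemma prim1P (u : X2) : snvec u ->
  [/\ in_AC 0 l (prim1 u), is_aederiv 0 l (prim1 u) (slope1 u) & in_H10 l (prim1 u)].
Proof.
move=> hu; have dL2 := slope1_L2 hu.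
have [yAC yd] : in_AC 0 l (prim1 u) /\ is_aederiv 0 l (prim1 u) (slope1 u).
  by apply: int_AC; [exact: in_L2_L1|move=> x _; rewrite {2}/prim1 cint_pt add0r].
by split => //; apply: (H10I yAC yd) => //; rewrite /prim1 cint_pt.
Qed.

Lemma prim3P (u : X2) : snvec u -> [/\ in_AC 0 l (prim3 u),
  is_aederiv 0 l (prim3 u) (fun x => prim1 u x + slope3 u x) & in_H10 l (prim3 u)].
Proof.
move=> hu; have [yAC _ _] := prim1P hu.
have dL2 : in_L2 0 l (fun x => prim1 u x + slope3 u x).
  by apply: in_L2D; [exact: AC_L2|exact: slope3_L2].
have [y3AC y3d] : in_AC 0 l (prim3 u) /\ is_aederiv 0 l (prim3 u) (fun x => prim1 u x + slope3 u x).
  by apply: int_AC; [exact: in_L2_L1|move=> x _; rewrite {2}/prim3 cint_pt add0r].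
by split => //; apply: (H10I y3AC y3d) => //; rewrite /prim3 cint_pt.
Qed.

Lemma to_timo_vec (u : X2) : snvec u -> snvec (to_timo u).
Proof.
move=> hu; have [_ _ h1'] := prim1P hu; have [_ _ h3'] := prim3P hu.
by split; rewrite yc_to_timo//=; apply: in_L2D; exact: comp_tm_L2.
Qed.

Lemma col4_lin a (z1 z2 z3 z4 w1 w2 w3 w4 : C) :
  a *: col4 z1 z2 z3 z4 + col4 w1 w2 w3 w4 =
  col4 (a * z1 + w1) (a * z2 + w2) (a * z3 + w3) (a * z4 + w4).
Proof.
apply/colP => i; rewrite mxE [X in X + _]mxE; move: i.
by apply: forall_ord4; rewrite !col4E.
Qed.

Let q1 : quasi_seminormed X1 := timo_qsn l0 c0 bd mEI mI mK mrho.
Let q2 : quasi_seminormed X2 := L2_qsn R 4.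

Lemma to_dirac_lin a (y z : X1) : snvec y -> snvec z ->
  eqv (to_dirac (a *: y + z)) (a *: to_dirac y + to_dirac z).
Proof.
move=> hy hz; have hyz := qsn_veclin q1 a hy hz.
apply: L2_eqv; [exact: to_dirac_vec|exact: (qsn_veclin q2 a (to_dirac_vec hy) (to_dirac_vec hz))|].
apply: (cov_ae M0 ler01 l0 cov (S := fun x =>
  char_vars (a *: y + z) x = a *: char_vars y x + char_vars z x)).
have [y1 _ y3 _] := hy; have [z1 _ z3 _] := hz.
have E k : yc (a *: y + z) k = (fun x => a * yc y k x + yc z k x).
  by apply/funext => x; rewrite /yc /coordf !mxE.
apply: aein_imp2 (H10_aederiv_lin l0 a y1 z1) (H10_aederiv_lin l0 a y3 z3) => x _ e1 e3.
rewrite /char_vars col4_lin /flux1 /flux3 !E e1 e3; congr col4; ring.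
Qed.

Lemma sq4 (v : 'cV[C]_4) : \sum_i cmod (v i 0) ^+ 2 = cmod (v (ord4 0) 0) ^+ 2 +
  cmod (v (ord4 1) 0) ^+ 2 + cmod (v (ord4 2) 0) ^+ 2 + cmod (v (ord4 3) 0) ^+ 2.
Proof. exact: sum_ord4. Qed.

Lemma half_sq (a b : C) :
  cmod (2^-1 * (a - b)) ^+ 2 + cmod (2^-1 * (a + b)) ^+ 2 <= cmod a ^+ 2 + cmod b ^+ 2.
Proof.
rewrite !cmodM !exprMn.
have -> : cmod (2^-1 : C) ^+ 2 = 4^-1.
  have -> : (2^-1 : C) = (2^-1 : R)%:C by rewrite -invR rmorph_nat.
  by rewrite cmodR -normrX ger0_norm ?sqr_ge0// expr2 -invfM -natrM.
have := cmodD_sq a b; have := cmodD_sq a (- b); rewrite cmodN; lra.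
Qed.

Lemma to_dirac_arith (p q A1 A2 A3 A4 e1 e2 e3 e4 E1 E2 E3 E4 : R) : 0 <= p -> 0 <= q ->
  A1 + A2 <= e2 + e1 -> A3 + A4 <= e4 + e3 ->
  e2 <= p * E2 -> e4 <= p * E4 -> e1 <= q * E1 -> e3 <= q * E3 ->
  0 <= E2 -> 0 <= E4 -> 0 <= E1 -> 0 <= E3 ->
  A1 + A2 + A3 + A4 <= (p + q) * (E1 + E2 + E3 + E4).
Proof.
move=> p0 q0 h1 h2 h3 h4 h5 h6 n2 n4 n1 n3.
have := (mulr_ge0 p0 n1, mulr_ge0 p0 n3, mulr_ge0 q0 n2, mulr_ge0 q0 n4).
move=> [[[? ?] ?] ?]; lra.
Qed.

(** The Jacobian of the change of variable and the coefficients are absorbed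
    by their bounds; the factor (c^-1)^3 bounds 1 / (g1^2 EI) and 1 / (g2^2 K). *)
Lemma to_dirac_bounded : bounded_operator to_dirac.
Proof.
split; [exact: to_dirac_vec|exact: to_dirac_lin|].
pose k := c^-1 + c^-1 ^+ 3.
have ci0 : 0 < c^-1 by rewrite invr_gt0.
have k0 : 0 <= k by rewrite addr_ge0// ?exprn_ge0// ltW.
exists (Num.sqrt ((M + 1) * k)) => y hy.
have M1 : 0 <= M + 1 by rewrite addr_ge0// ltW.
rewrite (snormE y) -sqrtrM ?mulr_ge0// ler_wsqrtr//.
have iT : mu.-integrable `[0, l] (EFin \o (fun x => \sum_i cmod (char_vars y x i 0) ^+ 2)).
  by apply: itg_sum => i; have [] := char_vars_L2 hy i.
have idens := dens_itg l0 c0 bd mEI mI mK mrho hy.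
apply: (le_trans (cov_Rint M0 ler01 l0 cov iT _)).
  by move=> x _; apply: sumr_ge0 => i _; exact: sqr_ge0.
rewrite -mulrA; apply: ler_wpM2l => //; rewrite -RintegralZl//.
apply: Rint_le => //; first exact: itgZ.
apply: aein_all => x /andP[x0 xl]; have xl' : 0 <= x <= l by rewrite !ltW.
have [/andP[e1 _] /andP[e2 _] /andP[e3 _] /andP[e4 _]] := bd xl'.
have [_ _ /andP[e5 _] /andP[e6 _]] := bdh xl'.
rewrite sq4 /char_vars !col4E//=.
have hs := half_sq (yc y 2 x) (flux1 y x); have hs' := half_sq (yc y 4 x) (flux3 y x).
have low (q : R) (z : C) : c <= q -> cmod z ^+ 2 <= c^-1 * (q * cmod z ^+ 2).
  move=> cq; rewrite mulrA ler_peMl ?sqr_ge0//.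
  by rewrite mulrC ler_pdivlMr// mul1r.
have low3 (g q : R) (z : C) : c <= g -> c <= q ->
    cmod ((g%:C)^-1 * z) ^+ 2 <= c^-1 ^+ 3 * (q * cmod z ^+ 2).
  move=> cg cq; rewrite cmodM exprMn (exprSr c^-1) -mulrA; apply: ler_pM; rewrite ?sqr_ge0//.
    by rewrite lerXn2r ?nnegrE ?cmod_ge0 ?(ltW ci0)//; exact: inv_bound.
  exact: low.
have m1 := low _ (yc y 2 x) e2; have m2 := low _ (yc y 4 x) e4.
have m3 := low3 _ _ (aederiv 0 l (yc y 1) x) e5 e1.
have m4 := low3 _ _ (aederiv 0 l (yc y 3) x - yc y 1 x) e6 e3.
have pos (q : R) (z : C) : c <= q -> 0 <= q * cmod z ^+ 2.
  by move=> cq; rewrite mulr_ge0 ?sqr_ge0// (le_trans (ltW c0)).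
have n1 := pos _ (yc y 2 x) e2; have n2 := pos _ (yc y 4 x) e4.
have n3 := pos _ (aederiv 0 l (yc y 1) x) e1.
have n4 := pos _ (aederiv 0 l (yc y 3) x - yc y 1 x) e3.
have ci3 : 0 <= c^-1 ^+ 3 by rewrite exprn_ge0// ltW.
by apply: (to_dirac_arith (ltW ci0) ci3 hs hs' m1 m2 m3 m4).
Qed.

Lemma to_timo_lin a (u v : X2) : snvec u -> snvec v ->
  eqv (to_timo (a *: u + v)) (a *: to_timo u + to_timo v).
Proof.
move=> hu hv; have huv := qsn_veclin q2 a hu hv.
have E k x : yc (a *: u + v : X2) k x = a * yc u k x + yc v k x.
  by rewrite /yc /coordf !mxE.
have F k : yc (a *: to_timo u + to_timo v) k = (fun x => a * yc (to_timo u) k x + yc (to_timo v) k x).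
  by apply/funext => x; rewrite /yc /coordf !mxE.
have [uA ud _] := prim1P hu; have [vA vd _] := prim1P hv; have [wA wd _] := prim1P huv.
have e1 x : 0 <= x <= l -> prim1 (a *: u + v) x = a * prim1 u x + prim1 v x.
  apply: (AC_eq l0 wA (in_ACD (in_ACZ a l0 uA) vA) _ wd).
    by rewrite /prim1 !cint_pt mulr0 addr0.
  have -> : slope1 (a *: u + v) = (fun x => a * slope1 u x + slope1 v x).
    by apply/funext => s; rewrite /slope1 !E; ring.
  exact: (aederD (aederZ a ud) vd).
have [uB ue _] := prim3P hu; have [vB ve _] := prim3P hv; have [wB we _] := prim3P huv.
have e3 x : 0 <= x <= l -> prim3 (a *: u + v) x = a * prim3 u x + prim3 v x.
  have zd := aederD (aederZ a ue) ve; have zB := in_ACD (in_ACZ a l0 uB) vB.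
  apply: (AC_eq l0 wB zB _ we); first by rewrite /prim3 !cint_pt mulr0 addr0.
  apply: (aederiv_eq _ _ _ zd) => //; first by case: we.
  apply: aein_all => s /andP[s0 sl]; rewrite e1 ?(ltW s0) ?(ltW sl)// /slope3 !E; ring.
apply: (timo_eqv l0 c0 bd mEI mI mK mrho); [exact: to_timo_vec| |..].
  exact: (qsn_veclin q1 a (to_timo_vec hu) (to_timo_vec hv)).
- by move=> x xl; rewrite F !yc_to_timo//= e1.
- by apply: aein_all => x _; rewrite F !yc_to_timo//= !E; ring.
- by move=> x xl; rewrite F !yc_to_timo//= e3.
- by apply: aein_all => x _; rewrite F !yc_to_timo//= !E; ring.
Qed.

Lemma to_timo_arith (p q A1 A2 A3 A4 u1 u2 u3 u4 : R) :
  A1 <= q * (2 * u2 + 2 * u1) -> A2 <= p * (2 * u1 + 2 * u2) ->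
  A3 <= q * (2 * u4 + 2 * u3) -> A4 <= p * (2 * u3 + 2 * u4) ->
  A1 + A2 + A3 + A4 <= 2 * (p + q) * (u1 + u2 + u3 + u4).
Proof. lra. Qed.

(** Conversely EI |y1'|^2 = EI g1^2 |u2 - u1|^2, whence the factor c'^3. *)
Lemma to_timo_bounded : bounded_operator to_timo.
Proof.
split; [exact: to_timo_vec|exact: to_timo_lin|].
have c'0 : 0 <= c'.
  have [/andP[h h'] _ _ _] := bd (introT andP (conj (lexx 0) l0)).
  exact: (le_trans (ltW c0) (le_trans h h')).
pose k := 2 * (c' + c' ^+ 3).
have k0 : 0 <= k by rewrite mulr_ge0// addr_ge0// exprn_ge0.
exists (Num.sqrt (k * (M + 1))) => u hu.
have M1 : 0 <= M + 1 by rewrite addr_ge0// ltW.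
rewrite snormE (_ : snorm u = Num.sqrt (L2sq u))// -(sqrtrM _ (mulr_ge0 k0 M1)).
rewrite ler_wsqrtr// /L2sq.
have iu := L2_itg hu; have hS := to_timo_vec hu.
have iu' := cov_itg M0 l0 ler01 cov' iu.
rewrite -mulrA; apply: (@le_trans _ _ (k *
  \int[mu]_(x in `[0%R, l]) (\sum_i cmod (u (tm x) i 0) ^+ 2))); last first.
  apply: ler_wpM2l => //; apply: (cov_Rint M0 l0 ler01 cov' iu).
  by move=> x _; apply: sumr_ge0 => i _; exact: sqr_ge0.
rewrite -RintegralZl//; apply: Rint_le; [exact: (dens_itg l0 c0 bd mEI mI mK mrho hS)|exact: itgZ|].
have [_ flux1 _] := prim1P hu; have [_ flux3 _] := prim3P hu.
apply: aein_imp2 (AC_aederivE flux1).2 (AC_aederivE flux3).2 => x /andP[x0 xl] e1 e3.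
have xl' : 0 <= x <= l by rewrite !ltW.
rewrite /dens !yc_to_timo//= e1 e3 (_ : prim1 u x + slope3 u x - prim1 u x = slope3 u x); last by ring.
have [E1 E2 E3 E4] := bd xl'; have [_ _ E5 E6] := bdh xl'.
have low (q : R) (z w : C) : c <= q <= c' ->
    q * cmod (z + w) ^+ 2 <= c' * (2 * cmod z ^+ 2 + 2 * cmod w ^+ 2).
  move=> /andP[cq qc]; apply: ler_pM; rewrite ?sqr_ge0//; first exact: le_trans (ltW c0) cq.
  exact: cmodD_sq.
have low3 (g q : R) (z w : C) : c <= g <= c' -> c <= q <= c' ->
    q * cmod (g%:C * (z - w)) ^+ 2 <= c' ^+ 3 * (2 * cmod z ^+ 2 + 2 * cmod w ^+ 2).
  move=> cg cq; rewrite cmodM exprMn (exprSr c') mulrCA -(mulrA (c' ^+ 2)); apply: ler_pM; rewrite ?sqr_ge0//.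
  - by rewrite mulr_ge0 ?sqr_ge0//; move: cq => /andP[/(le_trans (ltW c0))].
  - by rewrite lerXn2r ?nnegrE ?cmod_ge0//; exact: coef_bound.
  - by rewrite -[cmod w]cmodN; exact: low.
rewrite sq4; apply: to_timo_arith; [exact: low3|exact: low|exact: low3|exact: low].
Qed.

Let gh_neq0 x : 0 <= x <= l -> [/\ (g1 x)%:C != 0 :> C, (g2 x)%:C != 0 :> C,
  (h1 x)%:C != 0 :> C & (h2 x)%:C != 0 :> C].
Proof.
have pos q : c <= q <= c' -> q%:C != 0 :> C.
  by move=> /andP[cq _]; apply/RC_neq0/lt0r_neq0/(lt_le_trans c0 cq).
by move=> /bdh[e1 e2 e3 e4]; split; exact: pos.
Qed.

Let Irho_rho_neq0 x : 0 <= x <= l -> (Irho x)%:C != 0 :> C /\ (rho x)%:C != 0 :> C.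
Proof.
have pos q : c <= q <= c' -> q%:C != 0 :> C.
  by move=> /andP[cq _]; apply/RC_neq0/lt0r_neq0/(lt_le_trans c0 cq).
by move=> /bd[e1 e2 e3 e4]; split; exact: pos.
Qed.

Lemma to_diracK y : snvec y -> eqv (to_timo (to_dirac y)) y.
Proof.
move=> hy; have hTy := to_dirac_vec hy; have [y1 _ y3 _] := hy.
have yT k x : 0 <= x <= l -> yc (to_dirac y) k (tm x) = yc (char_vars y) k x.
  by move=> xl; rewrite /yc /coordf /to_dirac xttm.
have yTx k : (k < 4)%N -> yc (char_vars y) k.+1 = nth (fun=> 0)
   [:: (fun x => 2^-1 * (yc y 2 x - flux1 y x)); (fun x => 2^-1 * (yc y 2 x + flux1 y x));
       (fun x => 2^-1 * (yc y 4 x - flux3 y x)); (fun x => 2^-1 * (yc y 4 x + flux3 y x))] k.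
  by move=> k4; rewrite /yc coordf_col4.
have f1 x : 0 <= x <= l -> slope1 (to_dirac y) x = aederiv 0 l (yc y 1) x.
  by move=> xl; have [n _ _ _] := gh_neq0 xl; rewrite /slope1 !yT// !yTx//= /flux1; field.
have f3 x : 0 <= x <= l -> slope3 (to_dirac y) x = aederiv 0 l (yc y 3) x - yc y 1 x.
  by move=> xl; have [_ n _ _] := gh_neq0 xl; rewrite /slope3 !yT// !yTx//= /flux3; field.
have [Y1A Y1d _] := prim1P hTy; have [Y3A Y3d _] := prim3P hTy.
have [y1d _ _] := AC_aederiv l0 (H10_AC y1); have [y3d _ _] := AC_aederiv l0 (H10_AC y3).
have e1 x : 0 <= x <= l -> prim1 (to_dirac y) x = yc y 1 x.
  apply: (AC_eq l0 Y1A (H10_AC y1) _ _ y1d); first by rewrite /prim1 cint_pt y1.2.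
  apply: (aederiv_eq _ _ _ Y1d) => //; first by case: y1d.
  by apply: aein_all => s /andP[s0 sl]; rewrite f1// !ltW.
have e3 x : 0 <= x <= l -> prim3 (to_dirac y) x = yc y 3 x.
  apply: (AC_eq l0 Y3A (H10_AC y3) _ _ y3d); first by rewrite /prim3 cint_pt y3.2.
  apply: (aederiv_eq _ _ _ Y3d) => //; first by case: y3d.
  apply: aein_all => s /andP[s0 sl]; have sl' : 0 <= s <= l by rewrite !ltW.
  by rewrite f3// e1//; ring.
apply: (timo_eqv l0 c0 bd mEI mI mK mrho) => //; first exact: to_timo_vec.
- by move=> x xl; rewrite yc_to_timo//= e1.
- apply: aein_all => x /andP[x0 xl]; rewrite yc_to_timo//= !yT ?(ltW x0) ?(ltW xl)// !yTx//=; by field.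
- by move=> x xl; rewrite yc_to_timo//= e3.
- apply: aein_all => x /andP[x0 xl]; rewrite yc_to_timo//= !yT ?(ltW x0) ?(ltW xl)// !yTx//=; by field.
Qed.

Lemma to_timoK (u : X2) : snvec u -> eqv (to_dirac (to_timo u)) u.
Proof.
move=> hu; have hS := to_timo_vec hu.
apply: L2_eqv => //; first exact: to_dirac_vec.
have ae : aein 0 l (fun x => char_vars (to_timo u) x = u (tm x)).
  have [_ y1d _] := prim1P hu; have [_ y3d _] := prim3P hu.
  apply: aein_imp2 (AC_aederivE y1d).2 (AC_aederivE y3d).2 => x /andP[x0 xl] e1 e3.
  have [n1 n2 _ _] : [/\ (g1 x)%:C != 0 :> C, (g2 x)%:C != 0 :> C,
    (h1 x)%:C != 0 :> C & (h2 x)%:C != 0 :> C] by apply: gh_neq0; rewrite !ltW.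
  rewrite /char_vars /flux1 /flux3 !yc_to_timo//= e1 e3 /slope1 /slope3.
  apply/colP; apply: forall_ord4; rewrite col4E//= /yc /coordf/=; by field.
apply: aein_imp (cov_ae M0 ler01 l0 cov ae) => t /andP[t0 t1].
by rewrite tmxt// !ltW.
Qed.

Hypotheses (b1_gt0 : 0 < b1) (b2_gt0 : 0 < b2).
Hypothesis dtm : aein 0 l (fun x => is_derive x 1 tm (gamma x)).
Let B : 'M[C]_4 := Bmx b1 b2.
Let Q t : 'M[C]_4 := Qhat l EI Irho K rho p1 p2 (xt t).

(** The pointwise identities of dirac_expr_char, with A1, ..., A4 for the
    derivatives of the components in t; then A_k g is the derivative in x.  Sums
    of paired components give the momentum equations and differences the
    kinematic ones; the coupling terms of Q contribute U1 + U2 to the last. *)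
Lemma dirac_char_algebra (i g b I r b2' p q h hr h' hr' U1 U2 U3 U4 A1 A2 A3 A4 w1 w2 w3 w4 : C) :
  i^-1 = - i -> b != 0 -> b2' != 0 -> I != 0 -> r != 0 ->
  h * (b * g) = I -> hr * (b2' * g) = r ->
  w1 = - i * (- b^-1 * A1) + i * (((p + h') * U1 + (p - h') * U2 + hr * U3 - hr * U4) / (2 * I)) ->
  w2 = - i * (b^-1 * A2) + i * (((p + h') * U1 + (p - h') * U2 + hr * U3 - hr * U4) / (2 * I)) ->
  w3 = - i * (- b2'^-1 * A3) + i * ((- hr * U1 - hr * U2 + (q + hr') * U3 + (q - hr') * U4) / (2 * r)) ->
  w4 = - i * (b2'^-1 * A4) + i * ((hr * U1 + hr * U2 + (q + hr') * U3 + (q - hr') * U4) / (2 * r)) ->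
  [/\ w1 + w2 = i^-1 * (I^-1 * (hr * (U4 - U3) + (h' * (U2 - U1) + h * (A2 * g - A1 * g)) - p * (U1 + U2))),
      (b * g) * (w2 - w1) = i^-1 * (A1 * g + A2 * g),
      w3 + w4 = i^-1 * (r^-1 * ((hr' * (U4 - U3) + hr * (A4 * g - A3 * g)) - q * (U3 + U4))) &
      (b2' * g) * (w4 - w3) = i^-1 * ((A3 * g + A4 * g) - (U1 + U2))].
Proof.
move=> iE b0 b20 I0 r0 hI hr_ -> -> -> ->; rewrite iE.
have h0 : h != 0 by apply: contraNneq I0 => z; rewrite -hI z mul0r.
have hr0 : hr != 0 by apply: contraNneq r0 => z; rewrite -hr_ z mul0r.
have g0 : g != 0 by apply: contraNneq I0 => z; rewrite -hI z !mulr0.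
by split; rewrite -?hI -?hr_; field; rewrite ?h0 ?hr0 ?g0 ?b0 ?b20.
Qed.

Lemma aederiv_tm (f : R -> C) : in_AC 0 1 f ->
  is_aederiv 0 l (fun x => f (tm x)) (fun x => aederiv 0 1 f (tm x) * (gamma x)%:C).
Proof.
move=> fA; have [[mf fd] _ _] := AC_aederiv ler01 fA; split.
  by apply: cmeasM; [exact: (cov_cmeas M0 l0 ler01 cov')|exact: cmeasR].
have fd' : aein 0 1 (fun t => cder f t (aederiv 0 1 f t)) by exact: fd.
apply: aein_imp2 (cov_ae M0 l0 ler01 cov' fd') dtm => x _ e1 e2.
exact: cder_comp e1 e2.
Qed.

(** In the characteristic variables the Dirac-type expression is the
    Timoshenko operator: this is the computation behind the form of B and Q. *)
Lemma dirac_expr_char (u : R -> 'cV[C]_4) (y2 y4 v1 v3 : R -> C) : (forall i, in_AC 0 1 (coordf u i)) ->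
  (forall x, 0 <= x <= l -> [/\ yc u 1 (tm x) + yc u 2 (tm x) = y2 x,
     (h1 x)%:C * (yc u 2 (tm x) - yc u 1 (tm x)) = v1 x,
     yc u 3 (tm x) + yc u 4 (tm x) = y4 x &
     (h2 x)%:C * (yc u 4 (tm x) - yc u 3 (tm x)) = v3 x]) ->
  let w := dirac_expr B Q u in
  aein 0 l (fun x => [/\
    yc w 1 (tm x) + yc w 2 (tm x) =
      'i%C^-1 * (((Irho x)%:C)^-1 * (v3 x + aederiv 0 l v1 x - p1 x * y2 x)),
    (g1 x)%:C * (yc w 2 (tm x) - yc w 1 (tm x)) = 'i%C^-1 * aederiv 0 l y2 x,
    yc w 3 (tm x) + yc w 4 (tm x) =
      'i%C^-1 * (((rho x)%:C)^-1 * (aederiv 0 l v3 x - p2 x * y4 x)) &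
    (g2 x)%:C * (yc w 4 (tm x) - yc w 3 (tm x)) = 'i%C^-1 * (aederiv 0 l y4 x - y2 x)]).
Proof.
move=> uA E w.
have ud k := aederiv_tm (uA (ord4 k.-1)).
have uA' k : in_AC 0 l (fun x => yc u k (tm x)) by exact: (cov_AC M0 cov' (uA _)).
have [h1d _ _] := AC_aederiv l0 ((in_ACR 0 l h1).2 h1AC).
have [h2d _ _] := AC_aederiv l0 ((in_ACR 0 l h2).2 h2AC).
have tr (f f' g : R -> C) : (forall x, 0 <= x <= l -> f x = f' x) -> is_aederiv 0 l f g ->
    aein 0 l (fun x => aederiv 0 l f' x = g x).
  move=> ff' fg; have h : is_aederiv 0 l f' g.
    by apply: (aederiv_eq ff' _ _ fg); [case: fg|exact: aein_all].
  exact: (AC_aederivE h).2.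
have e2 := tr _ y2 _ (fun x xl => let: And4 h _ _ _ := E x xl in h) (aederD (ud 1%N) (ud 2%N)).
have e4 := tr _ y4 _ (fun x xl => let: And4 _ _ h _ := E x xl in h) (aederD (ud 3%N) (ud 4%N)).
have e1 := tr _ v1 _ (fun x xl => let: And4 _ h _ _ := E x xl in h)
  (aederM ((in_ACR 0 l h1).2 h1AC) (in_ACB l0 (uA' 2%N) (uA' 1%N)) h1d (aederB (ud 2%N) (ud 1%N))).
have e3 := tr _ v3 _ (fun x xl => let: And4 _ _ _ h := E x xl in h)
  (aederM ((in_ACR 0 l h2).2 h2AC) (in_ACB l0 (uA' 4%N) (uA' 3%N)) h2d (aederB (ud 4%N) (ud 3%N))).
apply: aein_imp2 (aein_and e1 e2) (aein_and e3 e4) => x /andP[x0 xl] [-> ->] [-> ->].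
have xl' : 0 <= x <= l by rewrite !ltW.
have [<- _ <- <-] := E x xl'.
have [I0 r0] := Irho_rho_neq0 xl'.
have n1 := RC_neq0 (lt0r_neq0 b1_gt0); have n2 := RC_neq0 (lt0r_neq0 b2_gt0).
have [rel1 _ rel2 _] := rel xl'.
have I0' : Irho x != 0 by apply: contraNneq I0 => ->.
have r0' : rho x != 0 by apply: contraNneq r0 => ->.
have wE : w (tm x) = (- 'i%C) *: (diag4 (- (b1^-1)%:C) (b1^-1)%:C (- (b2^-1)%:C) (b2^-1)%:C *m
    vderiv 0 1 u (tm x)) + Qhat l EI Irho K rho p1 p2 x *m u (tm x).
  have BV : invmx B = diag4 (- (b1^-1)%:C) (b1^-1)%:C (- (b2^-1)%:C) (b2^-1)%:C.
    exact: (Bmx_unit b1_gt0 b2_gt0).2.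
  have QE : Q (tm x) = Qhat l EI Irho K rho p1 p2 x by rewrite /Q (xttm xl').
  by rewrite -BV -QE.
rewrite (Qhat_mul _ _ _ _ _ _ I0' r0') diag4_col in wE.
rewrite /g1 /g2 !rmorphM/=; apply: (dirac_char_algebra (iV R)); rewrite -?rmorphM/= ?rel1 ?rel2//.
all: rewrite /yc /coordf wE mxE [X in X + _]mxE !col4E//= !invR.
all: by rewrite /vderiv !mxE.
Qed.

Variables (alpha1 alpha2 beta1 beta2 : C).
Hypotheses (p1L1 : in_L1 0 l p1) (p2L1 : in_L1 0 l p2).
Local Notation timoL := (@timo_operator R l EI Irho K rho p1 p2 alpha1 alpha2 beta1 beta2).
Local Notation diracL := (@dirac_operator R 4 B (Cmx R) (Dmx l EI Irho K rho alpha1 alpha2 beta1 beta2) Q).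

(** The value of the Timoshenko operator at y, given the absolutely continuous
    representatives v1, v3 of the moment and of the shear force. *)
Definition timo_value (y : X1) (v1 v3 : R -> C) : X1 := fun x => ('i%C)^-1 *: col4
  (yc y 2 x) ((Irho x)%:C^-1 * (v3 x + aederiv 0 l v1 x - p1 x * yc y 2 x))
  (yc y 4 x) ((rho x)%:C^-1 * (aederiv 0 l v3 x - p2 x * yc y 4 x)).

Lemma yc_timo_value y v1 v3 k : (k < 4)%N -> yc (timo_value y v1 v3) k.+1 =
  nth (fun=> 0) [:: (fun x => 'i%C^-1 * yc y 2 x);
   (fun x => 'i%C^-1 * ((Irho x)%:C^-1 * (v3 x + aederiv 0 l v1 x - p1 x * yc y 2 x)));
   (fun x => 'i%C^-1 * yc y 4 x);
   (fun x => 'i%C^-1 * ((rho x)%:C^-1 * (aederiv 0 l v3 x - p2 x * yc y 4 x)))] k.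
Proof.
move=> k4; apply/funext => x; rewrite /yc /coordf mxE col4E//.
by case: k k4 => [|[|[|[|]]]].
Qed.

Lemma IrhoV_meas : cmeasurable 0 l (fun x => ((Irho x)%:C : C)^-1).
Proof.
have h : cmeasurable 0 l (fun x => ((h1 x)^-1)%:C * ((g1 x)%:C : C)^-1).
  apply: cmeasM g1V_meas; apply: cmeasR; apply: rAC_meas.
  by apply: (rAC_inv c0) h1AC => x /bdh[/andP[]].
apply: cmeas_eq h => x xl; have [<- _ _ _] := rel xl.
by rewrite -invR -invfM -rmorphM.
Qed.

Lemma rhoV_meas : cmeasurable 0 l (fun x => ((rho x)%:C : C)^-1).
Proof.
have h : cmeasurable 0 l (fun x => ((h2 x)^-1)%:C * ((g2 x)%:C : C)^-1).
  apply: cmeasM g2V_meas; apply: cmeasR; apply: rAC_meas.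
  by apply: (rAC_inv c0) h2AC => x /bdh[_ /andP[]].
apply: cmeas_eq h => x xl; have [_ _ <- _] := rel xl.
by rewrite -invR -invfM -rmorphM.
Qed.

Lemma timo_value_vec y v1 v3 : in_H10 l (yc y 2) -> in_H10 l (yc y 4) -> in_AC 0 l v3 ->
  in_L2 0 l (fun x => aederiv 0 l v1 x - p1 x * yc y 2 x) ->
  in_L2 0 l (fun x => aederiv 0 l v3 x - p2 x * yc y 4 x) -> snvec (timo_value y v1 v3).
Proof.
move=> y2 y4 v3A L1 L3.
have coef (k : R -> R) f : cmeasurable 0 l (fun x => ((k x)%:C : C)^-1) ->
    (forall x, 0 <= x <= l -> c <= k x) -> in_L2 0 l f ->
    in_L2 0 l (fun x => 'i%C^-1 * (((k x)%:C)^-1 * f x)).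
  move=> mk kb fL; apply: in_L2Z; apply: (in_L2_bdM (c := c^-1)) => // x /kb.
  exact: inv_bound.
split; rewrite yc_timo_value//=; [exact: H10Z| |exact: H10Z|].
- apply: coef; [exact: IrhoV_meas|by move=> x /bd[_ /andP[]]|].
  apply: in_L2_eq (in_L2D (AC_L2 l0 v3A) L1) => x _.
  by rewrite addrA.
- by apply: coef; [exact: rhoV_meas|by move=> x /bd[_ _ _ /andP[]]|].
Qed.

Lemma tm0 : tm 0 = 0. Proof. exact: (bilip_a l0 ler01 cov'). Qed.
Lemma tml : tm l = 1. Proof. exact: (bilip_b l0 ler01 cov'). Qed.

Lemma bc_mx (u0 u1 : 'cV[C]_4) : Cmx R *m u0 + Dmx l EI Irho K rho alpha1 alpha2 beta1 beta2 *m u1 = 0 <->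
  [/\ u0 (ord4 0) 0 + u0 (ord4 1) 0 = 0, u0 (ord4 2) 0 + u0 (ord4 3) 0 = 0,
    (h1 l)%:C * (u1 (ord4 1) 0 - u1 (ord4 0) 0) + alpha1 * (u1 (ord4 0) 0 + u1 (ord4 1) 0) +
      beta1 * (u1 (ord4 2) 0 + u1 (ord4 3) 0) = 0 &
    (h2 l)%:C * (u1 (ord4 3) 0 - u1 (ord4 2) 0) + alpha2 * (u1 (ord4 2) 0 + u1 (ord4 3) 0) +
      beta2 * (u1 (ord4 0) 0 + u1 (ord4 1) 0) = 0].
Proof.
split.
  move=> /colP E; have e k := E (ord4 k); split.
  - by have := e 0%N; rewrite mxE !mulmx4E !mx4E// mxE /=; move=> <-; ring.
  - by have := e 2%N; rewrite mxE !mulmx4E !mx4E// mxE /=; move=> <-; ring.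
  - by have := e 1%N; rewrite mxE !mulmx4E !mx4E// mxE /=; move=> <-; ring.
  - by have := e 3%N; rewrite mxE !mulmx4E !mx4E// mxE /=; move=> <-; ring.
move=> [e0 e2 e1 e3]; apply/colP; apply: forall_ord4; rewrite mxE !mulmx4E !mx4E// mxE /=.
- by rewrite -[RHS]e0; ring.
- by rewrite -[RHS]e1; ring.
- by rewrite -[RHS]e2; ring.
- by rewrite -[RHS]e3; ring.
Qed.

Lemma aeE (f g : R -> C) : aein 0 l (fun x => f x = g x) <-> f = g %[ae mu in `[0%R, l]%classic].
Proof. exact: aein_cc. Qed.

(** The reconstruction of y from u gives y2 = u1 + u2, v1 = h1 (u2 - u1) and
    their analogues as absolutely continuous functions. The kinematic
    identities put the derivatives of y2, y4 in L2, and integrating them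
    identifies the first and third components of the value with those of
    to_timo w. *)
Lemma to_timo_intertwines (u w : X2) : diracL u w -> op_graph timoL (to_timo u) (to_timo w).
Proof.
move=> [uW wL2 bc wE]; have hw : snvec w by rewrite wE.
have uA i : in_AC 0 1 (coordf u i) by case: (uW i).
have hu : snvec u by move=> i; exact: (AC_L2 ler01 (uA i)).
have uA' k : in_AC 0 l (fun x => yc u k (tm x)) by exact: (cov_AC M0 cov' (uA _)).
pose y2 x := yc u 1 (tm x) + yc u 2 (tm x); pose y4 x := yc u 3 (tm x) + yc u 4 (tm x).
pose v1 x := (h1 x)%:C * (yc u 2 (tm x) - yc u 1 (tm x)).
pose v3 x := (h2 x)%:C * (yc u 4 (tm x) - yc u 3 (tm x)).
have := dirac_expr_char (y2 := y2) (y4 := y4) (v1 := v1) (v3 := v3) uA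
  (fun x _ => And4 erefl erefl erefl erefl).
rewrite [dirac_expr B Q u](_ : _ = w); last by rewrite wE.
move=> cr.
have y2A : in_AC 0 l y2 by exact: in_ACD.
have y4A : in_AC 0 l y4 by exact: in_ACD.
have v1A : in_AC 0 l v1 by apply: in_ACM => //; [exact/in_ACR|exact: in_ACB].
have v3A : in_AC 0 l v3 by apply: in_ACM => //; [exact/in_ACR|exact: in_ACB].
have [y2d y2L _] := AC_aederiv l0 y2A; have [y4d y4L _] := AC_aederiv l0 y4A.
have [v1d v1L _] := AC_aederiv l0 v1A; have [v3d v3L _] := AC_aederiv l0 v3A.
have i0 := @iC_neq0 R.
have wL k : in_L2 0 l (fun x => yc w k (tm x)) := comp_tm_L2 k hw.
have [bc1 bc2 bc3 bc4] := (bc_mx _ _).1 bc.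
have f1L := slope1_L2 hw; have f3L := slope3_L2 hw.
have y2H : in_H10 l y2.
  apply: (H10I y2A y2d); last by rewrite /y2 tm0.
  apply: in_L2_ae (in_L2Z 'i%C f1L); first by case: y2d.
  by apply: aein_imp cr => x _ [_ e _ _]; rewrite /slope1 e mulrA divff// mul1r.
have y4H : in_H10 l y4.
  apply: (H10I y4A y4d); last by rewrite /y4 tm0.
  apply: in_L2_ae (in_L2D (in_L2Z 'i%C f3L) (H10_L2 l0 y2H)); first by case: y4d.
  by apply: aein_imp cr => x _ [_ _ _ e]; rewrite /slope3 e mulrA divff// mul1r subrK.
have v1L2 : in_L2 0 l (fun x => aederiv 0 l v1 x - p1 x * y2 x).
  have h : in_L2 0 l (fun x => 'i%C * ((Irho x)%:C * (yc w 1 (tm x) + yc w 2 (tm x))) - v3 x).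
    apply: in_L2B; last exact: AC_L2.
    apply: in_L2Z; apply: (in_L2_bdM (c := c')); [exact: cmeasR| |exact: in_L2D].
    by move=> x /bd[_ h _ _]; exact: coef_bound.
  apply: in_L2_ae h.
    by apply: cmeasB; [case: v1d|apply: cmeasM; [case: p1L1|exact: in_AC_meas]].
  apply: aein_imp cr => x /andP[x0 xl] [-> _ _ _].
  have [I0 _] : (Irho x)%:C != 0 :> C /\ (rho x)%:C != 0 :> C by apply: Irho_rho_neq0; rewrite !ltW.
  by field; rewrite I0 i0.
have v3L2 : in_L2 0 l (fun x => aederiv 0 l v3 x - p2 x * y4 x).
  have h : in_L2 0 l (fun x => 'i%C * ((rho x)%:C * (yc w 3 (tm x) + yc w 4 (tm x)))).
    apply: in_L2Z; apply: (in_L2_bdM (c := c')); [exact: cmeasR| |exact: in_L2D].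
    by move=> x /bd[_ _ _ h]; exact: coef_bound.
  apply: in_L2_ae h.
    by apply: cmeasB; [case: v3d|apply: cmeasM; [case: p2L1|exact: in_AC_meas]].
  apply: aein_imp cr => x /andP[x0 xl] [_ _ -> _].
  have [_ r0] : (Irho x)%:C != 0 :> C /\ (rho x)%:C != 0 :> C by apply: Irho_rho_neq0; rewrite !ltW.
  by field; rewrite r0 i0.
have [Y1A Y1d Y1H] := prim1P hu; have [Y3A Y3d Y3H] := prim3P hu.
have E2 : yc (to_timo u) 2 = y2 by rewrite yc_to_timo.
have E4 : yc (to_timo u) 4 = y4 by rewrite yc_to_timo.
have hS := to_timo_vec hu; have hSw := to_timo_vec hw.
have hz : snvec (timo_value (to_timo u) v1 v3).
  by apply: timo_value_vec; rewrite ?E2 ?E4.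
exists (to_timo u), (timo_value (to_timo u) v1 v3); split; [exact: (eqv_refl q1)| |].
  have [W1A W1d _] := prim1P hw; have [W3A W3d _] := prim3P hw.
  have e1 x : 0 <= x <= l -> prim1 w x = 'i%C^-1 * y2 x.
    apply: (AC_eq l0 W1A (in_ACZ _ l0 y2A) _ W1d).
      by rewrite /prim1 cint_pt y2H.2 mulr0.
    have h := aederZ ('i%C^-1) y2d.
    apply: (aederiv_eq _ _ _ h) => //; first by case: W1d.
    by apply: aein_imp cr => x' _ [_ e _ _]; rewrite /slope1 e.
  apply: (timo_eqv l0 c0 bd mEI mI mK mrho) => //.
  - by move=> x xl; rewrite yc_to_timo// yc_timo_value//= E2 e1.
  - apply: aein_imp cr => x _ [e _ _ _].
    by rewrite yc_to_timo// yc_timo_value//= E2 e.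
  - move=> x; rewrite yc_to_timo// yc_timo_value//= E4.
    apply: (AC_eq l0 W3A (in_ACZ _ l0 y4A) _ W3d).
      by rewrite /prim3 cint_pt y4H.2 mulr0.
    have h := aederZ ('i%C^-1) y4d.
    apply: (aederiv_eq _ _ _ h) => //; first by case: W3d.
    apply: aein_imp cr => x' /andP[x0 xl] [_ _ _ e].
    by rewrite /slope3 e e1 ?(ltW x0) ?(ltW xl)//; ring.
  - apply: aein_imp cr => x _ [_ _ e _].
    by rewrite yc_to_timo// yc_timo_value//= E4 e.
split.
  apply: forall_ord4.
  - by rewrite -/(yc (to_timo u) 1) yc_to_timo.
  - by rewrite -/(yc (to_timo u) 2) E2.
  - by rewrite -/(yc (to_timo u) 3) yc_to_timo.
  - by rewrite -/(yc (to_timo u) 4) E4.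
exists v1, v3; rewrite E2 E4.
have W1 : v1 = (fun x => (EI x)%:C * aederiv 0 l (yc (to_timo u) 1) x) %[ae mu in `[0%R, l]%classic].
  apply/aeE; apply: aein_imp (AC_aederivE Y1d).2 => x /andP[x0 xl].
  rewrite yc_to_timo//= => ->; have [_ r _ _] := rel (introT andP (conj (ltW x0) (ltW xl))).
  by rewrite /slope1 mulrA -rmorphM/= r.
have W3 : v3 = (fun x => (K x)%:C * (aederiv 0 l (yc (to_timo u) 3) x - yc (to_timo u) 1 x))
    %[ae mu in `[0%R, l]%classic].
  apply/aeE; apply: aein_imp (AC_aederivE Y3d).2 => x /andP[x0 xl].
  rewrite !yc_to_timo//= => ->; have [_ _ _ r] := rel (introT andP (conj (ltW x0) (ltW xl))).
  by rewrite addrAC subrr add0r /slope3 mulrA -rmorphM/= r.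
have B1 : v1 l + alpha1 * y2 l + beta1 * y4 l = 0 by rewrite /v1 /y2 /y4 tml.
have B3 : v3 l + alpha2 * y4 l + beta2 * y2 l = 0 by rewrite /v3 /y2 /y4 tml.
do 5![split => //]; split => //.
by apply/funext => x; rewrite /timo_value E2 E4.
Qed.

Lemma in_L1_AC (f : R -> C) : in_AC 0 l f -> in_L1 0 l f.
Proof. by move=> fA; apply: in_L2_L1; exact: AC_L2. Qed.

(** Entries of Q are images of basis vectors, so the explicit product with a
    constant vector suffices; p1, p2, h1', h2' are integrable and the other
    factors are bounded. *)
Lemma Qhat_L1 (v : 'cV[C]_4) i :
  in_L1 0 l (fun x => (Qhat l EI Irho K rho p1 p2 x *m v) i 0).
Proof.
have [_ h1L _] := AC_aederiv l0 ((in_ACR 0 l h1).2 h1AC).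
have [_ h2L _] := AC_aederiv l0 ((in_ACR 0 l h2).2 h2AC).
have h2L' := in_L1_AC ((in_ACR 0 l h2).2 h2AC).
have coef (k : R -> R) f : cmeasurable 0 l (fun x => ((k x)%:C : C)^-1) ->
    (forall x, 0 <= x <= l -> c <= k x) -> in_L1 0 l f ->
    in_L1 0 l (fun x => ('i%C / 2) * (((k x)%:C)^-1 * f x)).
  move=> mk kb fL; apply: in_L1Z; apply: (in_L1_bdM (c := c^-1)) => // x /kb.
  exact: inv_bound.
have lin f1 f2 f3 f4 (z1 z2 z3 z4 : C) : in_L1 0 l f1 -> in_L1 0 l f2 -> in_L1 0 l f3 ->
    in_L1 0 l f4 -> in_L1 0 l (fun x => z1 * f1 x + z2 * f2 x + z3 * f3 x + z4 * f4 x).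
  by move=> L1 L2 L3 L4; do 3?[apply: in_L1D]; exact: in_L1Z.
have E x : 0 <= x <= l -> Irho x != 0 /\ rho x != 0.
  move=> /bd[_ /andP[eI _] _ /andP[er _]].
  by rewrite !gt_eqF// (lt_le_trans c0).
pose v1 := v (ord4 0) 0; pose v2 := v (ord4 1) 0; pose v3 := v (ord4 2) 0; pose v4 := v (ord4 3) 0.
pose dh1 := aederiv 0 l (fun s => (h1 s)%:C); pose dh2 := aederiv 0 l (fun s => (h2 s)%:C).
(* rows 1 and 2 coincide; rows 3 and 4 differ by the sign s *)
have F1 := coef _ _ IrhoV_meas (fun x xl => let: And4 _ h _ _ := bd xl in (andP h).1)
   (lin _ _ _ _ (v1 + v2) (v1 - v2) (v3 - v4) 0 p1L1 h1L h2L' h2L').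
have F3 (s : C) := coef _ _ rhoV_meas (fun x xl => let: And4 _ _ _ h := bd xl in (andP h).1)
   (lin _ _ _ _ (v3 + v4) (v3 - v4) (s * (v1 + v2)) 0 p2L1 h2L h2L' h2L').
move: i; apply: forall_ord4.
- apply: in_L1_eq F1 => x xl; have [I0 r0] := E x xl; have [I1 r1] := Irho_rho_neq0 xl.
  by rewrite (Qhat_mul _ _ _ _ _ _ I0 r0) col4E//= -/v1 -/v2 -/v3 -/v4; field.
- apply: in_L1_eq F1 => x xl; have [I0 r0] := E x xl; have [I1 r1] := Irho_rho_neq0 xl.
  by rewrite (Qhat_mul _ _ _ _ _ _ I0 r0) col4E//= -/v1 -/v2 -/v3 -/v4; field.
- apply: in_L1_eq (F3 (-1)) => x xl; have [I0 r0] := E x xl; have [I1 r1] := Irho_rho_neq0 xl.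
  by rewrite (Qhat_mul _ _ _ _ _ _ I0 r0) col4E//= -/v1 -/v2 -/v3 -/v4; field.
- apply: in_L1_eq (F3 1) => x xl; have [I0 r0] := E x xl; have [I1 r1] := Irho_rho_neq0 xl.
  by rewrite (Qhat_mul _ _ _ _ _ _ I0 r0) col4E//= -/v1 -/v2 -/v3 -/v4; field.
Qed.

Lemma Q_L1 i j : in_L1 0 1 (fun t => Q t i j).
Proof.
have := Qhat_L1 (delta_mx j 0) i => h.
apply: in_L1_eq (cov_L1 M0 ler01 l0 cov h) => t _.
by rewrite -colE mxE.
Qed.

(** The absolutely continuous representative of to_dirac y is built from
    v1 / h1 and v3 / h2; they coincide with flux1 y and flux3 y almost everywhere. *)
Lemma to_dirac_intertwines (y z : X1) : timoL y z -> op_graph diracL (to_dirac y) (to_dirac z).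
Proof.
move=> [yH [v1 [v3 [[v1A /aeE v1E] [v1L2 [[v3A /aeE v3E] [v3L2 [bc1 [bc3 zE]]]]]]]]].
have yk k : in_H10 l (yc y k) := yH _.
have yA k : in_AC 0 l (yc y k) := H10_AC (yk k).
have hy : snvec y by split => //; exact: H10_L2.
have hz : snvec z.
  by rewrite zE; apply: (timo_value_vec (v1 := v1) (v3 := v3)).
have rinv (h : R -> R) : rAC 0 l h -> (forall x, 0 <= x <= l -> c <= h x) ->
    in_AC 0 l (fun x => ((h x)^-1)%:C).
  by move=> hA hc; apply/in_ACR; exact: (rAC_inv c0).
have h1I : in_AC 0 l (fun x => ((h1 x)^-1)%:C) by apply: rinv => // x /bdh[/andP[]].
have h2I : in_AC 0 l (fun x => ((h2 x)^-1)%:C) by apply: rinv => // x /bdh[_ /andP[]].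
pose d1' x := ((h1 x)^-1)%:C * v1 x; pose d3' x := ((h2 x)^-1)%:C * v3 x.
have d1A : in_AC 0 l d1' by exact: in_ACM.
have d3A : in_AC 0 l d3' by exact: in_ACM.
pose f1 x := 2^-1 * (yc y 2 x - d1' x); pose f2 x := 2^-1 * (yc y 2 x + d1' x).
pose f3 x := 2^-1 * (yc y 4 x - d3' x); pose f4 x := 2^-1 * (yc y 4 x + d3' x).
pose U x := col4 (f1 x) (f2 x) (f3 x) (f4 x).
have UA i : in_AC 0 l (coordf U i).
  move: i; apply: forall_ord4; rewrite coordf_col4//=; apply: in_ACZ => //.
  - exact: in_ACB.
  - exact: in_ACD.
  - exact: in_ACB.
  - exact: in_ACD.
pose u : X2 := fun t => U (xt t).
have uA i : in_AC 0 1 (coordf u i) by exact: (cov_AC M0 cov (UA i)).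
have hu : snvec u by move=> i; exact: (AC_L2 ler01 (uA i)).
have uE x : 0 <= x <= l -> u (tm x) = U x by move=> xl; rewrite /u xttm.
have ukE k x : 0 <= x <= l -> (k < 4)%N -> yc u k.+1 (tm x) = nth 0 [:: f1 x; f2 x; f3 x; f4 x] k.
  by move=> xl k4; rewrite /yc /coordf (uE _ xl) col4E.
have hne0 x : 0 <= x <= l -> (h1 x)%:C != 0 :> C /\ (h2 x)%:C != 0 :> C.
  by move=> /gh_neq0[].
have E x : 0 <= x <= l -> [/\ yc u 1 (tm x) + yc u 2 (tm x) = yc y 2 x,
     (h1 x)%:C * (yc u 2 (tm x) - yc u 1 (tm x)) = v1 x,
     yc u 3 (tm x) + yc u 4 (tm x) = yc y 4 x &
     (h2 x)%:C * (yc u 4 (tm x) - yc u 3 (tm x)) = v3 x].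
  move=> xl; have [n1 n2] := hne0 x xl.
  rewrite !(ukE _ x xl)//= /f1 /f2 /f3 /f4 /d1' /d3' -!invR.
  by split; field.
have cr := dirac_expr_char uA E.
set w := dirac_expr B Q u in cr.
have Tz : aein 0 l (fun x => char_vars z x = w (tm x)).
  have [y2d _ _] := AC_aederiv l0 (yA 2%N); have [y4d _ _] := AC_aederiv l0 (yA 4%N).
  have zk k : yc z k = yc (timo_value y v1 v3) k by rewrite zE.
  have Z1 := (AC_aederivE (aederZ ('i%C^-1) y2d)).2.
  have Z3 := (AC_aederivE (aederZ ('i%C^-1) y4d)).2.
  apply: aein_imp3 Z1 Z3 cr => x /andP[x0 xl] Z1x Z3x [c1 c2 c3 c4].
  have [n1 n2 _ _] := gh_neq0 (introT andP (conj (ltW x0) (ltW xl))).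
  rewrite /char_vars /flux1 /flux3 !zk !yc_timo_value//= Z1x Z3x -c1 -c2 -c3 -mulrBr -c4 !mulKf//.
  by apply/colP; apply: forall_ord4; rewrite col4E//= /yc /coordf /=; field.
have Ty : aein 0 l (fun x => char_vars y x = u (tm x)).
  apply: aein_imp2 v1E v3E => x /andP[x0 xl] V1 V3.
  have xl' : 0 <= x <= l by rewrite !ltW.
  have [n1 n2 n3 n4] := gh_neq0 xl'; have [_ r1 _ r2] := rel xl'.
  rewrite uE// /U /f1 /f2 /f3 /f4.
  have -> : d1' x = flux1 y x.
    rewrite /d1' /flux1 V1 -invR -r1 rmorphM/=; field.
    by rewrite n1; have := n3; rewrite -r1 rmorphM/= mulf_eq0 negb_or => /andP[->].
  have -> // : d3' x = flux3 y x.
  rewrite /d3' /flux3 V3 -invR -r2 rmorphM/=; field.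
  by rewrite n2; have := n4; rewrite -r2 rmorphM/= mulf_eq0 negb_or => /andP[->].
have back (f : R -> 'cV[C]_4) (g : R -> 'cV[C]_4) : aein 0 l (fun x => f x = g (tm x)) ->
    aein 0 1 (fun t => f (xt t) = g t).
  move=> h; apply: aein_imp (cov_ae M0 ler01 l0 cov h) => t /andP[t0 t1].
  by rewrite tmxt// !ltW.
have hw : snvec (w : X2).
  move=> i; have := to_dirac_vec hz i; apply: in_L2_ae; first exact: (expr_meas _ Q_L1).
  by apply: aein_imp (back _ _ Tz) => t _ h; rewrite /coordf -h.
exists u, w; split.
- by apply: L2_eqv => //; [exact: to_dirac_vec|exact: back].
- by apply: L2_eqv => //; [exact: to_dirac_vec|exact: back].
have l0l : 0 <= l <= l by rewrite l0 lexx.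
have [e1 e2 e3 e4] := E 0 (introT andP (conj (lexx 0) l0)).
have [g1' g2' g3 g4] := E l l0l.
split => //.
- move=> i; split => //; by have [] := AC_aederiv ler01 (uA i).
- apply/bc_mx; rewrite tm0 in e1 e3; rewrite tml in g1' g2' g3 g4.
  split; [by rewrite [LHS]e1 (yk 2%N).2|by rewrite [LHS]e3 (yk 4%N).2|..].
  + by rewrite -bc1 -g1' -g2' -g3.
  + by rewrite -bc3 -g1' -g3 -g4.
Qed.

Lemma timo_similar_dirac : similar_operators timoL diracL.
Proof.
apply: (similar_of_intertwining q1 q2 to_dirac_bounded to_timo_bounded
  to_diracK to_timoK to_dirac_intertwines to_timo_intertwines).
by apply: dirac_closed; [exact: (Bmx_unit b1_gt0 b2_gt0).1|exact: Q_L1].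
Qed.

End Transform.

(** * The change of variable and the similarity *)

Section Integrals.
Variable R : realType.
Local Notation mu := (@lebesgue_measure R).
Implicit Types (a b l m G x y : R) (g : R -> R).

Lemma Rint_cst_itv a b m : a <= b -> \int[mu]_(s in `[a, b]) m = m * (b - a).
Proof.
move=> ab; rewrite Rintegral_cst//= lebesgue_measure_itv/= lte_fin.
case: ltP => [_|ba]; first by rewrite -EFinB.
by rewrite /= (le_anti (introT andP (conj ab ba))) subrr.
Qed.

Lemma bounded_itg a b m G g : measurable_fun `[a, b] g ->
  (forall x, a <= x <= b -> m <= g x <= G) -> mu.-integrable `[a, b] (EFin \o g).
Proof.
move=> mg gb; apply: (@integrable_dom R _ _ (fun=> `|m| + `|G|)) => //; last exact: itg_cst.
move=> x /=; rewrite in_itv/= => /gb /andP[g1 g2].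
rewrite ler_norml; apply/andP; split.
  by have := ler_norm (- m); rewrite normrN; have := normr_ge0 G; lra.
by have := ler_norm G; have := normr_ge0 m; lra.
Qed.

Lemma tmap_incr l m G g x y : measurable_fun `[0, l] g ->
  (forall x, 0 <= x <= l -> m <= g x <= G) -> 0 <= x -> x <= y -> y <= l ->
  m * (y - x) <= tmap g y - tmap g x <= G * (y - x).
Proof.
move=> mg gb x0 xy yl; have ig := bounded_itg mg gb.
have igy : mu.-integrable `[0, y] (EFin \o g) by apply: itg_sub ig.
have igxy : mu.-integrable `[x, y] (EFin \o g) by apply: itg_sub ig.
have -> : tmap g y - tmap g x = \int[mu]_(s in `[x, y]) g s.
  rewrite /tmap (Rintegral_itvB igy) ?bnd_simp// Rintegral_itv_obnd_cbnd//.
  by apply: integrableS igxy => //; apply: subset_itvr; rewrite bnd_simp.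
have B s : x < s < y -> m <= g s <= G.
  by move=> /andP[xs sy]; apply: gb; rewrite (le_trans x0 (ltW xs)) (le_trans (ltW sy)).
rewrite -!(Rint_cst_itv _ xy); apply/andP; split; apply: Rint_le => //; try exact: itg_cst;
  by apply: aein_all => s /B /andP[].
Qed.

(** For (a, b) = (EI, Irho) or (K, rho) the square roots are h and g, and the
    last two identities are h g = b and a g = h. *)
Lemma sqrt_mean (p q a b : R) : 0 < p -> p <= a <= q -> p <= b <= q ->
  [/\ p <= Num.sqrt (a * b) <= q, p / q <= Num.sqrt (b / a) <= q / p,
    Num.sqrt (a * b) * Num.sqrt (b / a) = b & a * Num.sqrt (b / a) = Num.sqrt (a * b)].
Proof.
move=> p0 /andP[pa aq] /andP[pb bq].
have a0 := lt_le_trans p0 pa; have b0 := lt_le_trans p0 pb; have q0 := lt_le_trans a0 aq.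
have sq (x : R) : 0 < x -> Num.sqrt (x ^+ 2) = x by move=> x0; rewrite sqrtr_sqr gtr0_norm.
split.
- rewrite -(sq p p0) -(sq q q0) !ler_wsqrtr//.
    by rewrite expr2 ler_pM// ltW.
  by rewrite expr2 ler_pM// ltW.
- have pq : 0 < p / q by rewrite divr_gt0.
  have qp : 0 < q / p by rewrite divr_gt0.
  have r1 : p / q <= b / a.
    by rewrite ler_pdivrMr// mulrAC ler_pdivlMr// ler_pM// ltW.
  have r2 : b / a <= q / p.
    by rewrite ler_pdivrMr// mulrAC ler_pdivlMr// ler_pM// ltW.
  have p1 : p / q <= 1 by rewrite ler_pdivrMr// mul1r (le_trans pa).
  have q1 : 1 <= q / p by rewrite ler_pdivlMr// mul1r (le_trans pa).
  rewrite -(sq _ pq) -(sq _ qp) !ler_wsqrtr//.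
    by apply: le_trans r1; rewrite expr2 ler_piMr// ltW.
  by apply: (le_trans r2); rewrite expr2 ler_peMr// ltW.
- rewrite -sqrtrM ?mulr_ge0 ?ltW// (_ : a * b * (b / a) = b ^+ 2) ?sq//.
  by field; rewrite gt_eqF.
- by rewrite -{1}(sq a a0) -sqrtrM ?sqr_ge0//; congr Num.sqrt; field; rewrite gt_eqF.
Qed.

End Integrals.

Section ChangeOfVariable.
Variables (R : realType) (l C1 C2 : R) (rho Irho K EI : R -> R).
Local Notation mu := (@lebesgue_measure R).
Hypothesis l_gt0 : 0 < l.
Hypothesis C1_gt0 : 0 < C1.
Hypothesis bounds : forall x : R, 0 <= x <= l ->
    [/\ C1 <= rho x <= C2, C1 <= Irho x <= C2,
        C1 <= K x <= C2 & C1 <= EI x <= C2].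
Hypotheses (mI : measurable_fun `[0, l] Irho) (h1AC : rAC 0 l (h1f EI Irho)).

Let l0 : 0 <= l := ltW l_gt0.
Let g1 x := Num.sqrt (Irho x / EI x).
Let m := C1 / C2.
Let G := C2 / C1.
Let C2_gt0 : 0 < C2.
Proof.
have [/andP[a b] _ _ _] := bounds (introT andP (conj (lexx 0) l0)).
exact: lt_le_trans C1_gt0 (le_trans a b).
Qed.
Let m_gt0 : 0 < m. Proof. by rewrite divr_gt0. Qed.
Let G_gt0 : 0 < G. Proof. by rewrite divr_gt0. Qed.

Let g1b x : 0 <= x <= l -> m <= g1 x <= G.
Proof. by move=> /bounds[_ I _ E]; have [] := sqrt_mean C1_gt0 E I. Qed.

Lemma g1_meas : measurable_fun `[0, l] g1.
Proof.
apply: (eq_measurable_fun (fun x => Irho x * (h1f EI Irho x)^-1)).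
  move=> x; rewrite inE/= in_itv/= => /bounds[_ I _ E].
  have [/andP[h _] _ r _] := sqrt_mean C1_gt0 E I.
  have h0 : h1f EI Irho x != 0 by rewrite gt_eqF// (lt_le_trans C1_gt0).
  apply: (mulfI h0); rewrite r mulrCA divff ?mulr1//.
apply: measurable_funM => //; apply: rAC_meas; apply: (rAC_inv C1_gt0) h1AC => x /bounds[_ I _ E].
by have [/andP[]] := sqrt_mean C1_gt0 E I.
Qed.

(** The number b1 normalises the integral of gamma. The constant ratio makes
    sqrt (rho / K) a multiple of sqrt (Irho / EI). The inverse exists since
    t(x) is continuous and, gamma being bounded below, strictly increasing. *)
Lemma change_of_variable_exists :
  (exists c : R, forall x : R, 0 <= x <= l -> EI x * rho x / (K x * Irho x) = c) ->
  exists (b1 b2 : R) (gamma xt : R -> R),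
    change_of_variable l EI Irho K rho b1 b2 gamma xt.
Proof.
move=> [k kE].
have b1_gt0 : 0 < tmap g1 l.
  have := tmap_incr g1_meas g1b (lexx 0) l0 (lexx l).
  rewrite {2}/tmap set_itv1 Rintegral_set1 !subr0 => /andP[h _].
  by apply: lt_le_trans h; rewrite mulr_gt0.
set b1 := tmap g1 l in b1_gt0.
pose gamma x := g1 x / b1.
have gb x : 0 <= x <= l -> m / b1 <= gamma x <= G / b1.
  by move=> /g1b /andP[a b]; rewrite !ler_pM2r ?invr_gt0// a.
have mg : measurable_fun `[0, l] gamma by apply: measurable_funM => //; exact: g1_meas.
have mb : 0 < m / b1 by rewrite divr_gt0.
have t0 : tmap gamma 0 = 0 by rewrite /tmap set_itv1 Rintegral_set1.
have tl : tmap gamma l = 1.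
  rewrite /tmap /gamma RintegralZr//; last exact: bounded_itg g1_meas g1b.
  by rewrite -/(tmap g1 l) divff// gt_eqF.
have lt_t x y : 0 <= x -> x < y -> y <= l -> tmap gamma x < tmap gamma y.
  move=> x0 xy yl; have /andP[h _] := tmap_incr mg gb x0 (ltW xy) yl.
  by rewrite -subr_gt0; apply: lt_le_trans h; rewrite mulr_gt0// subr_gt0.
have le_t x y : 0 <= x -> x <= y -> y <= l -> tmap gamma x <= tmap gamma y.
  by move=> x0; rewrite le_eqVlt => /predU1P[->//|xy] yl; rewrite ltW// lt_t.
have inj x y : 0 <= x <= l -> 0 <= y <= l -> tmap gamma x = tmap gamma y -> x = y.
  move=> /andP[x0 xl] /andP[y0 yl] e; case: (ltgtP x y) => // h.
    by have := lt_t _ _ x0 h yl; rewrite e ltxx.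
  by have := lt_t _ _ y0 h xl; rewrite e ltxx.
pose P t x := 0 <= x <= l /\ tmap gamma x = t.
pose xt t := xget 0 [set x | P t x].
have xtP t : 0 <= t <= 1 -> P t (xt t).
  move=> t01; have ct := parameterized_integral_continuous l0 (bounded_itg mg gb).
  have [|x] := @IVT _ (tmap gamma) 0 l t l0 ct.
    by rewrite t0 tl (min_idPl ler01) (max_idPr ler01).
  by rewrite in_itv/= => xl xE; apply: (@xgetPex _ 0 [set x | P t x]); exists x.
have k_gt0 : 0 < k.
  rewrite -(kE 0 (introT andP (conj (lexx 0) l0))).
  have [/andP[a _] /andP[b _] /andP[c _] /andP[d _]] := bounds (introT andP (conj (lexx 0) l0)).
  by rewrite !(divr_gt0, mulr_gt0) ?(lt_le_trans C1_gt0).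
exists b1, (Num.sqrt k * b1), gamma, xt.
split; [by rewrite mulr_gt0 ?sqrtr_gt0|split; [|split; [|split; [|split]]]].
- by move=> x _; rewrite /gamma [RHS]mulrC divfK// gt_eqF.
- move=> x xl; have [/andP[a _] /andP[b _] /andP[c _] /andP[d _]] := bounds xl.
  rewrite /gamma -mulrA [b1 * _]mulrC divfK ?gt_eqF// /g1 -sqrtrM ?ltW//.
  rewrite -(kE x xl); congr Num.sqrt; field.
  by rewrite !gt_eqF// (lt_le_trans C1_gt0).
- exact: tl.
- by move=> t /xtP.
- move=> x /andP[x0 xl]; have tx : 0 <= tmap gamma x <= 1.
    by rewrite -t0 -tl !le_t.
  split => //; have [h1 h2] := xtP _ tx.
  by apply: inj h2 => //; rewrite x0.
Qed.

End ChangeOfVariable.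

Section Main.
Variables (R : realType) (l : R) (alpha1 alpha2 beta1 beta2 : R[i]).
Variables (rho Irho K EI : R -> R) (p1 p2 : R -> R[i]) (C1 C2 : R).
Local Notation mu := (@lebesgue_measure R).
Hypothesis l_gt0 : 0 < l.
Hypotheses (mrho : measurable_fun `[0, l] rho) (mI : measurable_fun `[0, l] Irho)
  (mK : measurable_fun `[0, l] K) (mEI : measurable_fun `[0, l] EI).
Hypotheses (p1_L1 : in_L1 0 l p1) (p2_L1 : in_L1 0 l p2).
Hypothesis C1_gt0 : 0 < C1.
Hypothesis bounds : forall x : R, 0 <= x <= l ->
    [/\ C1 <= rho x <= C2, C1 <= Irho x <= C2,
        C1 <= K x <= C2 & C1 <= EI x <= C2].
Hypotheses (h1AC : rAC 0 l (h1f EI Irho)) (h2AC : rAC 0 l (h2f K rho)).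

(** Any data satisfying the defining relations lie between positive constants,
    since b1 gamma = sqrt (Irho / EI); so t(x) and its inverse are Lipschitz. *)
Lemma similar_of_change_of_variable b1 b2 gamma xt :
  change_of_variable l EI Irho K rho b1 b2 gamma xt ->
  similar_operators
    (@timo_operator R l EI Irho K rho p1 p2 alpha1 alpha2 beta1 beta2)
    (@dirac_operator R 4 (Bmx b1 b2) (Cmx R)
       (Dmx l EI Irho K rho alpha1 alpha2 beta1 beta2)
       (fun t => Qhat l EI Irho K rho p1 p2 (xt t))).
Proof.
move=> [[b1_gt0 b2_gt0] [g1E [g2E [int1 [xtP tmP]]]]].
have l0 := ltW l_gt0.
have C2_gt0 : 0 < C2.
  have [/andP[a b] _ _ _] := bounds (introT andP (conj (lexx 0) l0)).
  exact: lt_le_trans C1_gt0 (le_trans a b).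
(* C1, C2 bound the coefficients and h1, h2; C1 / C2, C2 / C1 bound g1, g2 *)
pose c := Num.min C1 (C1 / C2); pose c' := Num.max C2 (C2 / C1).
have c0 : 0 < c by rewrite lt_min C1_gt0 divr_gt0.
have cC x : C1 <= x <= C2 -> c <= x <= c'.
  by move=> /andP[a b]; rewrite ge_min le_max a b.
have cG x : C1 / C2 <= x <= C2 / C1 -> c <= x <= c'.
  by move=> /andP[a b]; rewrite ge_min le_max a b !orbT.
have B1 x : 0 <= x <= l -> [/\ C1 <= h1f EI Irho x <= C2, C1 / C2 <= b1 * gamma x <= C2 / C1,
    h1f EI Irho x * (b1 * gamma x) = Irho x & EI x * (b1 * gamma x) = h1f EI Irho x].
  by move=> xl; have [_ I _ E] := bounds xl; rewrite -g1E//; exact: sqrt_mean.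
have B2 x : 0 <= x <= l -> [/\ C1 <= h2f K rho x <= C2, C1 / C2 <= b2 * gamma x <= C2 / C1,
    h2f K rho x * (b2 * gamma x) = rho x & K x * (b2 * gamma x) = h2f K rho x].
  by move=> xl; have [r _ k _] := bounds xl; rewrite -g2E//; exact: sqrt_mean.
have mg : measurable_fun `[0, l] gamma.
  apply: (eq_measurable_fun (fun x => b1^-1 * Num.sqrt (Irho x / EI x))).
    by move=> x; rewrite inE/= in_itv/= => xl; rewrite g1E// mulKf// gt_eqF.
  apply: measurable_funM => //; exact: (g1_meas C1_gt0 bounds).
pose m := C1 / C2 / b1; pose G := C2 / C1 / b1.
have m0 : 0 < m by rewrite !divr_gt0.
have gb x : 0 <= x <= l -> m <= gamma x <= G.
  by move=> /B1[_ /andP[a b] _ _]; rewrite /m /G ler_pdivrMr// ler_pdivlMr// (mulrC _ b1) a b.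
pose M := Num.max G m^-1.
have M0 : 0 < M by rewrite lt_max invr_gt0 m0 orbT.
have incr := tmap_incr mg gb.
have cov : bilip M 0 1 0 l xt (tmap gamma).
  split => //.
  - move=> s t s0 st t1.
    have /xtP[/andP[ps ps'] es] : 0 <= s <= 1 by rewrite s0 (le_trans st).
    have /xtP[/andP[pt pt'] et] : 0 <= t <= 1 by rewrite t1 (le_trans s0).
    have le : xt s <= xt t.
      rewrite leNgt; apply/negP => h; have /andP[h1 _] := incr _ _ pt (ltW h) ps'.
      have : 0 < m * (xt s - xt t) by rewrite mulr_gt0// subr_gt0.
      by move=> /lt_le_trans /(_ h1); rewrite es et subr_gt0 ltNge st.
    rewrite subr_ge0 le/=; have /andP[h1 _] := incr _ _ ps le pt'.
    rewrite es et in h1; apply: (@le_trans _ _ (m^-1 * (t - s))).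
      by rewrite ler_pdivlMl.
    by rewrite ler_wpM2r ?subr_ge0// le_max lexx orbT.
  - move=> x y x0 xy yl; have /andP[h1 h2] := incr x y x0 xy yl.
    apply/andP; split.
      by apply: le_trans h1; rewrite mulr_ge0 ?subr_ge0// ltW.
    by apply: (le_trans h2); rewrite ler_wpM2r ?subr_ge0// le_max lexx.
have dtm : aein 0 l (fun x => is_derive x 1 (tmap gamma) (gamma x)).
  apply: (int_derive (bounded_itg mg gb)) => x _.
  by rewrite [X in _ = X + _]/tmap set_itv1 Rintegral_set1 add0r.
apply: (@timo_similar_dirac _ l c c' M b1 b2 EI Irho K rho gamma xt (tmap gamma)) => //.
- by move=> x /bounds[? ? ? ?]; split; exact: cC.
- move=> x xl; have [? ? _ _] := B1 x xl; have [? ? _ _] := B2 x xl.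
  by split; [exact: cC|exact: cC|exact: cG|exact: cG].
- by move=> x xl; have [_ _ ? ?] := B1 x xl; have [_ _ ? ?] := B2 x xl.
Qed.

End Main.

Theorem proposition7p1 (R : realType) (l : R) (l_gt0 : 0 < l)
  (alpha1 alpha2 beta1 beta2 : R[i])
  (rho Irho K EI : R -> R) (p1 p2 : R -> R[i]) (C1 C2 : R)
  (rho_cont : {within `[0, l], continuous rho})
  (Irho_cont : {within `[0, l], continuous Irho})
  (K_cont : {within `[0, l], continuous K})
  (EI_cont : {within `[0, l], continuous EI})
  (p1_L1 : in_L1 0 l p1) (p2_L1 : in_L1 0 l p2)
  (C1_gt0 : 0 < C1)
  (bounds : forall x : R, 0 <= x <= l ->
    [/\ C1 <= rho x <= C2, C1 <= Irho x <= C2,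
        C1 <= K x <= C2 & C1 <= EI x <= C2])
  (ratio_const : exists c : R, forall x : R, 0 <= x <= l ->
    EI x * rho x / (K x * Irho x) = c)
  (h1_AC : in_AC 0 l (fun x => (h1f EI Irho x)%:C))
  (h2_AC : in_AC 0 l (fun x => (h2f K rho x)%:C)) :
  (exists (b1 b2 : R) (gamma xt : R -> R),
    change_of_variable l EI Irho K rho b1 b2 gamma xt) /\
  (forall (b1 b2 : R) (gamma xt : R -> R),
    change_of_variable l EI Irho K rho b1 b2 gamma xt ->
    similar_operators
      (@timo_operator R l EI Irho K rho p1 p2 alpha1 alpha2 beta1 beta2)
      (@dirac_operator R 4 (Bmx b1 b2) (Cmx R)
         (Dmx l EI Irho K rho alpha1 alpha2 beta1 beta2)
         (fun t => Qhat l EI Irho K rho p1 p2 (xt t)))).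
Proof.
have meas (f : R -> R) : {within `[0, l], continuous f} -> measurable_fun `[0, l] f.
  by move=> fc; apply: subspace_continuous_measurable_fun.
have h1AC := (in_ACR 0 l _).1 h1_AC; have h2AC := (in_ACR 0 l _).1 h2_AC.
split.
  exact: (change_of_variable_exists l_gt0 C1_gt0 bounds (meas _ Irho_cont) h1AC).
move=> b1 b2 gamma xt; apply: (similar_of_change_of_variable _ _ _ _ _ _ _ _ _ _ _ C1_gt0 bounds) => //;
  exact: meas.
Qed.
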